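(* Let $G=(V,E)$ be a strongly biconnected directed graph with $n=|V|$ and $m=|E|$. The following algorithm runs in time $O(nm)$: (1) compute the set $U$ of strong bridges of $G$; (2) choose $y\in V$, build a spanning tree $T$ of $G$ rooted at $y$, build the reverse graph $G_r=(V,E_r)$, $E_r=\{(v,w)\mid (w,v)\in E\}$, build a spanning tree $T_y$ of $G_r$ rooted at $y$, and let $E_y$ consist of the edges of $T$ together with all $(w,v)$ for $(v,w)$ an edge of $T_y$; (3) while $(V,E_y)$ is not strongly biconnected, compute the strongly biconnected components of $(V,E_y)$, find an edge $(u,w)\in E\setminus E_y$ such that $u,w$ lie in distinct strongly biconnected components $C_1^B,C_2^B$ of $(V,E_y)$ with $u,w\notin C_1^B\cap C_2^B$, and add $(u,w)$ to $E_y$; (4) set $B\leftarrow U$ and, for every edge $(u,w)\in E_y\setminus B$, if $(V,E\setminus\{(u,w)\})$ is not strongly biconnected, add $(u,w)$ to $B$; output $B$ (the set of b-bridges of $G$).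
   Context: A directed graph is strongly biconnected if it is strongly connected and its underlying undirected graph is biconnected. An edge $e$ of a strongly connected directed graph $(V,E)$ is a strong bridge if $(V,E\setminus\{e\})$ is not strongly connected. A strongly biconnected component of a strongly connected directed graph $H=(V,F)$ is a maximal vertex subset $U\subseteq V$ such that the subgraph of $H$ induced by $U$ is strongly biconnected. For a strongly biconnected directed graph $G=(V,E)$, an edge $e\in E$ is a b-bridge if $(V,E\setminus\{e\})$ is not strongly biconnected. *)

(* Defs.v *)
From mathcomp Require Import all_boot.

Set Implicit Arguments.
Unset Strict Implicit.
Unset Printing Implicit Defensive.

(** * Directed graphs

    A directed graph is given by a vertex set [U] and a set of ordered pairs
    [F]; only the pairs of [F] with both ends in [U] count as edges, so that
    [(U, F)] with [U] a proper subset of the vertices is the subgraph of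
    [([set: V], F)] induced by [U]. *)

Definition dedge (V : finType) (U : {set V}) (F : {set V * V}) : rel V :=
  [rel x y | [&& x \in U, y \in U & (x, y) \in F]].

Definition uedge (V : finType) (U : {set V}) (F : {set V * V}) : rel V :=
  [rel x y | dedge U F x y || dedge U F y x].

Definition strongly_connected (V : finType) (U : {set V}) (F : {set V * V}) :=
  [forall x in U, forall y in U, connect (dedge U F) x y].

Definition uconnected (V : finType) (U : {set V}) (F : {set V * V}) :=
  [forall x in U, forall y in U, connect (uedge U F) x y].

Definition articulation (V : finType) (U : {set V}) (F : {set V * V}) (x : V) :=
  (x \in U) && ~~ uconnected (U :\ x) F.

(* Biconnected = connected without articulation point; in particular a single
   vertex and a single undirected edge are biconnected. *)
Definition biconnected (V : finType) (U : {set V}) (F : {set V * V}) :=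
  uconnected U F && [forall x, ~~ articulation U F x].

Definition strongly_biconnected (V : finType) (U : {set V}) (F : {set V * V}) :=
  strongly_connected U F && biconnected U F.

Definition sb_components (V : finType) (F : {set V * V}) : {set {set V}} :=
  [set C | maxset (fun U : {set V} => strongly_biconnected U F) C].

Definition strong_bridge (V : finType) (F : {set V * V}) (e : V * V) :=
  (e \in F) && ~~ strongly_connected [set: V] (F :\ e).

Definition b_bridge (V : finType) (F : {set V * V}) (e : V * V) :=
  (e \in F) && ~~ strongly_biconnected [set: V] (F :\ e).

Definition swap (V : Type) (e : V * V) : V * V := (e.2, e.1).

Definition reverse (V : finType) (F : {set V * V}) : {set V * V} :=
  [set swap e | e in F].

(* Spanning out-arborescence: every vertex is reached from the root, the root
   has in-degree 0 and every other vertex has in-degree 1. *)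
Definition spanning_tree (V : finType) (F : {set V * V}) (y : V)
    (T : {set V * V}) :=
  [&& T \subset F,
      [forall v, connect (dedge [set: V] T) y v]
    & [forall v, #|[set u | (u, v) \in T]| == (v != y)]].

(** * A unit-cost random access machine

    Registers and array cells hold natural numbers; addition, truncated
    subtraction, comparisons and memory accesses cost one unit each.  There is
    deliberately no multiplication, and no primitive acting on more than a
    constant number of cells. *)

Record store := Store { reg : nat -> nat; arr : nat -> nat -> nat }.

Inductive expr :=
| Const of nat
| Reg of nat
| Get of nat & expr
| Add of expr & expr
| Sub of expr & expr
| Eq of expr & expr
| Lt of expr & expr.

Fixpoint eval (st : store) (e : expr) : nat :=
  match e with
  | Const k => k
  | Reg x => reg st x
  | Get a i => arr st a (eval st i)
  | Add e1 e2 => eval st e1 + eval st e2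
  | Sub e1 e2 => eval st e1 - eval st e2
  | Eq e1 e2 => eval st e1 == eval st e2
  | Lt e1 e2 => eval st e1 < eval st e2
  end.

Fixpoint ecost (e : expr) : nat :=
  match e with
  | Const _ | Reg _ => 1
  | Get _ i => (ecost i).+1
  | Add e1 e2 | Sub e1 e2 | Eq e1 e2 | Lt e1 e2 => (ecost e1 + ecost e2).+1
  end.

Definition set_reg (st : store) (x v : nat) : store :=
  Store (fun y => if y == x then v else reg st y) (arr st).

Definition set_arr (st : store) (a i v : nat) : store :=
  Store (reg st)
    (fun b j => if (b == a) && (j == i) then v else arr st b j).

Inductive cmd :=
| Skip
| Assign of nat & expr
| Put of nat & expr & expr
| Seq of cmd & cmd
| If of expr & cmd & cmd
| While of expr & cmd.

(* [exec c st t st']: started in [st], [c] halts in [st'] after [t] units. *)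
Inductive exec : cmd -> store -> nat -> store -> Prop :=
| ExecSkip st : exec Skip st 1 st
| ExecAssign st x e :
    exec (Assign x e) st (ecost e).+1 (set_reg st x (eval st e))
| ExecPut st a i e :
    exec (Put a i e) st (ecost i + ecost e).+1
         (set_arr st a (eval st i) (eval st e))
| ExecSeq st1 st2 st3 t1 t2 c1 c2 :
    exec c1 st1 t1 st2 -> exec c2 st2 t2 st3 ->
    exec (Seq c1 c2) st1 (t1 + t2) st3
| ExecIfTrue st st' t e c1 c2 :
    eval st e != 0 -> exec c1 st t st' ->
    exec (If e c1 c2) st ((ecost e).+1 + t) st'
| ExecIfFalse st st' t e c1 c2 :
    eval st e = 0 -> exec c2 st t st' ->
    exec (If e c1 c2) st ((ecost e).+1 + t) st'
| ExecWhileTrue st1 st2 st3 t1 t2 e c :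
    eval st1 e != 0 -> exec c st1 t1 st2 -> exec (While e c) st2 t2 st3 ->
    exec (While e c) st1 ((ecost e).+1 + t1 + t2) st3
| ExecWhileFalse st e c :
    eval st e = 0 -> exec (While e c) st (ecost e).+1 st.

Declare Scope cmd_scope.
Delimit Scope cmd_scope with cmd.
Notation "c1 ;; c2" := (Seq c1 c2)
  (at level 95, right associativity) : cmd_scope.

(** * Memory layout

    The [i]-th edge of the input list is [(a_src[i], a_dst[i])].  A set of edges
    is an array indexed by edge numbers, a nonzero cell meaning membership.
    Registers from [n_reg] on and arrays from [n_arr] on are scratch space. *)

Definition r_n := 0.    (* number of vertices *)
Definition r_m := 1.    (* number of edges *)
Definition r_y := 2.    (* chosen root *)
Definition r_ans := 3.  (* outcome of the last test *)
Definition r_e := 4.    (* current edge number *)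
Definition r_nc := 5.   (* number of strongly biconnected components *)
Definition r_np := 6.   (* number of (component, vertex) incidences *)
Definition n_reg := 7.

Definition a_src := 0.
Definition a_dst := 1.
Definition a_rsrc := 2. (* edges of the reverse graph *)
Definition a_rdst := 3.
Definition a_U := 4.
Definition a_T := 5.
Definition a_Ty := 6.
Definition a_Ey := 7.
Definition a_B := 8.
Definition a_cid := 9.  (* component number of an incidence *)
Definition a_cvx := 10. (* vertex of an incidence *)
Definition n_arr := 11.

Definition holds_edges (n m : nat) (es : m.-tuple ('I_n * 'I_n)) (a b : nat)
    (st : store) : Prop :=
  forall i : 'I_m,
    arr st a i = (tnth es i).1 :> nat /\ arr st b i = (tnth es i).2 :> nat.

(* The edges are stored in an arbitrary order. *)
Definition is_input (n m : nat) (E : {set 'I_n * 'I_n})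
    (es : m.-tuple ('I_n * 'I_n)) (st : store) : Prop :=
  [/\ perm_eq es (enum E), reg st r_n = n, reg st r_m = m
    & holds_edges es a_src a_dst st].

Definition edge_set (n m : nat) (es : m.-tuple ('I_n * 'I_n)) (a : nat)
    (st : store) : {set 'I_n * 'I_n} :=
  [set tnth es i | i : 'I_m & arr st a i != 0].

(* Components may overlap, hence a list of incidences and not a labelling. *)
Definition stored_component (n : nat) (st : store) (k : nat) : {set 'I_n} :=
  [set v : 'I_n | [exists j : 'I_(reg st r_np),
     (arr st a_cid j == k) && (arr st a_cvx j == v)]].

Definition stored_components (n : nat) (st : store) : {set {set 'I_n}} :=
  [set stored_component n st k | k : 'I_(reg st r_nc)].

(** * The algorithm

    The steps that the algorithm only describes by their result are
    subroutines; everything else is spelled out. *)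

Record subroutines := Subroutines {
  sub_strong_bridges : cmd;
  sub_tree : cmd;
  sub_reverse_tree : cmd;
  sub_test_Ey : cmd;
  sub_components : cmd;
  sub_find_edge : cmd;
  sub_test_without : cmd }.

Definition for_edges (body : cmd) : cmd :=
  (Assign r_e (Const 0) ;;
   While (Lt (Reg r_e) (Reg r_m))
     (body ;; Assign r_e (Add (Reg r_e) (Const 1))))%cmd.

(* Edge number [i] of the reverse graph is the reverse of edge number [i], so
   that undoing the reversal of the tree in [a_Ty] keeps edge numbers. *)
Definition algorithm (p : subroutines) : cmd :=
  (sub_strong_bridges p ;;
   sub_tree p ;;
   for_edges (Put a_rsrc (Reg r_e) (Get a_dst (Reg r_e)) ;;
              Put a_rdst (Reg r_e) (Get a_src (Reg r_e))) ;;
   sub_reverse_tree p ;;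
   for_edges (Put a_Ey (Reg r_e)
                (Add (Get a_T (Reg r_e)) (Get a_Ty (Reg r_e)))) ;;
   sub_test_Ey p ;;
   While (Eq (Reg r_ans) (Const 0))
     (sub_components p ;;
      sub_find_edge p ;;
      Put a_Ey (Reg r_e) (Const 1) ;;
      sub_test_Ey p) ;;
   for_edges (Put a_B (Reg r_e) (Get a_U (Reg r_e))) ;;
   for_edges
     (If (Get a_Ey (Reg r_e))
        (If (Eq (Get a_B (Reg r_e)) (Const 0))
           (sub_test_without p ;;
            If (Eq (Reg r_ans) (Const 0)) (Put a_B (Reg r_e) (Const 1)) Skip)
           Skip)
        Skip))%cmd.

(* Total correctness, with [rs] and [ars] the only registers and arrays outside
   the scratch space that may change. *)
Definition computes (pre : store -> Prop) (c : cmd) (rs ars : seq nat)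
    (post : store -> Prop) : Prop :=
  forall st, pre st -> exists t st',
    [/\ exec c st t st',
        forall x, x < n_reg -> x \notin rs -> reg st' x = reg st x,
        forall a, a < n_arr -> a \notin ars -> arr st' a =1 arr st a
      & post st'].

(* [(u, w)] is an edge of [E] outside [F] whose ends lie in distinct strongly
   biconnected components of [F], and not in their intersection. *)
Definition eligible (V : finType) (E F : {set V * V}) (e : V * V) : Prop :=
  e \in E :\: F /\
  exists C1 C2 : {set V},
    [/\ C1 \in sb_components F, C2 \in sb_components F, C1 != C2,
        (e.1 \in C1) && (e.2 \in C2)
      & (e.1 \notin C1 :&: C2) && (e.2 \notin C1 :&: C2)].

Definition correct (p : subroutines) : Prop :=
  forall (n m : nat) (E : {set 'I_n * 'I_n}) (es : m.-tuple ('I_n * 'I_n))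
         (y : 'I_n),
    strongly_biconnected [set: 'I_n] E ->
  let input st := is_input E es st /\ reg st r_y = y in
  let Ey st := edge_set es a_Ey st in
  [/\ computes input
        (sub_strong_bridges p) [::] [:: a_U]
        (fun st => edge_set es a_U st = [set e | strong_bridge E e]),
      computes input
        (sub_tree p) [::] [:: a_T]
        (fun st => spanning_tree E y (edge_set es a_T st)),
      computes
        (fun st => input st /\
                   holds_edges [tuple of map (@swap _) es] a_rsrc a_rdst st)
        (sub_reverse_tree p) [::] [:: a_Ty]
        (fun st => spanning_tree (reverse E) y
                     (edge_set [tuple of map (@swap _) es] a_Ty st))
    & [/\ computes input
            (sub_test_Ey p) [:: r_ans] [::]
            (fun st => (reg st r_ans != 0)
                       = strongly_biconnected [set: 'I_n] (Ey st)),
          computes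
            (fun st => input st /\ strongly_connected [set: 'I_n] (Ey st))
            (sub_components p) [:: r_nc; r_np] [:: a_cid; a_cvx]
            (fun st => stored_components n st = sb_components (Ey st)),
          computes
            (fun st => [/\ input st,
                           strongly_connected [set: 'I_n] (Ey st),
                           ~~ strongly_biconnected [set: 'I_n] (Ey st)
                         & stored_components n st = sb_components (Ey st)])
            (sub_find_edge p) [:: r_e] [::]
            (fun st => exists2 i : 'I_m,
                         reg st r_e = i & eligible E (Ey st) (tnth es i))
        & forall i : 'I_m,
          computes
            (fun st => input st /\ reg st r_e = i)
            (sub_test_without p) [:: r_ans] [::]
            (fun st => (reg st r_ans != 0)
                       = strongly_biconnected [set: 'I_n] (E :\ tnth es i))]].

(* Main.v *)
(** All subroutines are linear-time programs around one depth-first search on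
    linked adjacency lists, run on the graph, on its reverse, or on the
    underlying undirected graph.

    In the undirected case every edge joins an ancestor and a descendant.  Call
    a vertex [h] a head if no edge leads from the subtree at [h] to a vertex
    strictly above the parent of [h]; low points detect heads.  The biconnected
    components are the sets made of the parent of a head [h] and of the vertices
    whose deepest head above or equal is [h].  A component is a retract of the
    graph, so in a strongly connected graph it is strongly connected, and these
    sets are the strongly biconnected components.

    Step (1) tests only the edges of an out-tree and an in-tree of the root:
    deleting any other edge leaves the graph strongly connected.  Step (3) picks
    an edge whose ends share no component; adding it makes the number of
    components, initially at most [n], drop.  Hence there are at most [n]
    iterations, [E_y] has at most [3n] edges, and the algorithm makes [O(n)]
    calls to subroutines that take time [O(n + m) = O(m)]. *)

Require Import Defs.
From mathcomp Require Import all_boot zify.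

Set Implicit Arguments.
Unset Strict Implicit.
Unset Printing Implicit Defensive.

(** * Execution within a time budget *)

(** The contract [eligible] does not bound the number of rounds of step (3): a third component may
    contain both ends of the edge, and adding the edge then merges nothing. The time analysis
    therefore uses stronger specifications of the concrete subroutines than [correct] states. Times
    are kept symbolic. A program whose loops are all innermost costs at most [lin c * X], with
    [X = n + 4 * m + 2]; the [4 * m] is the variant of a search over [2 * m] half-edges. Three loops
    call such programs, and they are granted multiples of [n * X]. Two of these run over all [m]
    edges while only [O(n)] iterations may be expensive, so a loop rule with a cost per iteration is
    required. Counting components compares the graphs before and after an insertion, hence needs
    search trees of both. Existence of a tree is proved by running the verified search on an
    artificial store. Finally [n <= m] when [n > 1], because every vertex has an outgoing edge. *)

Definition runs (k : nat) (c : cmd) (st : store) (Q : store -> Prop) : Prop :=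
  exists t st', [/\ exec c st t st', t <= k & Q st'].

(* Time coefficient: the running time is at most [lin c * X] as soon as every
   loop, all of them innermost, makes fewer than [X] iterations. *)
Fixpoint lin (c : cmd) : nat :=
  match c with
  | Skip => 1
  | Assign _ e => (ecost e).+1
  | Put _ i e => (ecost i + ecost e).+1
  | Seq c1 c2 => lin c1 + lin c2
  | If e c1 c2 => (ecost e).+1 + (lin c1 + lin c2)
  | While e b => (ecost e).+1 + ((ecost e).+1 + lin b)
  end.

Notation runl X c st Q := (runs (lin c * X) c st Q).

Fixpoint loop_free (c : cmd) : bool :=
  match c with
  | Seq c1 c2 | If _ c1 c2 => loop_free c1 && loop_free c2
  | While _ _ => false
  | _ => true
  end.

(* Meaningful on loop-free commands only. *)
Fixpoint sem (c : cmd) (st : store) : store :=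
  match c with
  | Assign x e => set_reg st x (eval st e)
  | Put a i e => set_arr st a (eval st i) (eval st e)
  | Seq c1 c2 => sem c2 (sem c1 st)
  | If e c1 c2 => if eval st e != 0 then sem c1 st else sem c2 st
  | _ => st
  end.

Lemma runs_weaken k k' c st (Q Q' : store -> Prop) :
  runs k c st Q -> k <= k' -> (forall st', Q st' -> Q' st') -> runs k' c st Q'.
Proof.
move=> [t [st' [ex le_tk Qst]]] le_kk QQ'; exists t, st'; split=> //.
- exact: leq_trans le_kk.
- exact: QQ'.
Qed.

Lemma runs_seq k1 k2 c1 c2 st Q :
  runs k1 c1 st (fun st' => runs k2 c2 st' Q) ->
  runs (k1 + k2) (c1 ;; c2)%cmd st Q.
Proof.
move=> [t1 [st1 [ex1 le1 [t2 [st2 [ex2 le2 Q2]]]]]].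
by exists (t1 + t2), st2; split; [apply: ExecSeq ex1 ex2 | apply: leq_add |].
Qed.

Lemma runl_seq X c1 c2 st Q :
  runl X c1 st (fun st' => runl X c2 st' Q) -> runl X (c1 ;; c2)%cmd st Q.
Proof. by move=> H; rewrite /= mulnDl; apply: runs_seq. Qed.

Lemma exec_sem c st : loop_free c ->
  exists2 t, exec c st t (sem c st) & t <= lin c.
Proof.
elim: c st => [|x e|a i e|c1 IH1 c2 IH2|e c1 IH1 c2 IH2|e c IH] st //=.
- by exists 1 => //; apply: ExecSkip.
- by exists (ecost e).+1 => //; apply: ExecAssign.
- by exists (ecost i + ecost e).+1 => //; apply: ExecPut.
- case/andP=> /(IH1 st) [t1 ex1 le1] /(IH2 (sem c1 st)) [t2 ex2 le2].
  by exists (t1 + t2); [apply: ExecSeq ex1 ex2 | apply: leq_add].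
- case/andP=> /(IH1 st) [t1 ex1 le1] /(IH2 st) [t2 ex2 le2].
  case: ifP => [ne0|/negbFE/eqP eq0].
    by exists ((ecost e).+1 + t1); [apply: ExecIfTrue | lia].
  by exists ((ecost e).+1 + t2); [apply: ExecIfFalse | lia].
Qed.

Lemma runs_sem c st (Q : store -> Prop) :
  loop_free c -> Q (sem c st) -> runs (lin c) c st Q.
Proof. by move=> /(exec_sem st) [t ex le] Qst; exists t, (sem c st). Qed.

Lemma runl_sem X c st (Q : store -> Prop) :
  loop_free c -> 0 < X -> Q (sem c st) -> runl X c st Q.
Proof.
move=> lf X0 Qst; apply: (runs_weaken (runs_sem lf Qst)) => //.
by rewrite leq_pmulr.
Qed.

Lemma runl_if X e c1 c2 st (Q : store -> Prop) : 0 < X ->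
  (eval st e != 0 -> runl X c1 st Q) -> (eval st e = 0 -> runl X c2 st Q) ->
  runl X (If e c1 c2) st Q.
Proof.
move=> X0 H1 H2; case: (eqVneq (eval st e) 0) => [e0|ne0].
- have [t [st' [ex le Qs]]] := H2 e0.
  exists ((ecost e).+1 + t), st'; split=> //; first exact: ExecIfFalse.
  by rewrite /= !mulnDl leq_add ?leq_pmulr // (leq_trans le) // leq_addl.
- have [t [st' [ex le Qs]]] := H1 ne0.
  exists ((ecost e).+1 + t), st'; split=> //; first exact: ExecIfTrue.
  by rewrite /= !mulnDl leq_add ?leq_pmulr // (leq_trans le) // leq_addr.
Qed.

(** * Written variables and loop rules *)

Fixpoint wregs (c : cmd) : seq nat :=
  match c with
  | Assign x _ => [:: x]
  | Seq c1 c2 | If _ c1 c2 => wregs c1 ++ wregs c2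
  | While _ b => wregs b
  | _ => [::]
  end.

Fixpoint warrs (c : cmd) : seq nat :=
  match c with
  | Put a _ _ => [:: a]
  | Seq c1 c2 | If _ c1 c2 => warrs c1 ++ warrs c2
  | While _ b => warrs b
  | _ => [::]
  end.

Definition agree (rs ars : seq nat) (st st' : store) : Prop :=
  (forall x, x \notin rs -> reg st' x = reg st x) /\
  (forall a, a \notin ars -> arr st' a =1 arr st a).

Lemma agree_trans rs ars st1 st2 st3 :
  agree rs ars st1 st2 -> agree rs ars st2 st3 -> agree rs ars st1 st3.
Proof.
move=> [r12 a12] [r23 a23]; split=> [x x_rs|a a_ars i].
- by rewrite r23 ?r12.
- by rewrite a23 ?a12.
Qed.

Lemma agree_sub (rs rs' ars ars' : seq nat) st st' :
  agree rs ars st st' -> {subset rs <= rs'} -> {subset ars <= ars'} ->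
  agree rs' ars' st st'.
Proof.
move=> [rE aE] srs sars; split=> [x|a] nin.
- by apply: rE; apply: contra nin => /srs.
- by apply: aE; apply: contra nin => /sars.
Qed.

(** The frame is read off the syntax, so specifications need not list what they preserve; callers
    recover it through [runs_agree]. *)
Lemma exec_agree c st t st' :
  exec c st t st' -> agree (wregs c) (warrs c) st st'.
Proof.
have subl (s1 s2 : seq nat) : {subset s1 <= s1 ++ s2}.
  by move=> x; rewrite mem_cat => ->.
have subr (s1 s2 : seq nat) : {subset s2 <= s1 ++ s2}.
  by move=> x; rewrite mem_cat orbC => ->.
elim=> {c st t st'} /=.
- by move=> st.
- by move=> st x e; split=> //= y; rewrite inE; case: eqP.
- by move=> st a i e; split=> //= b; rewrite inE => /negbTE ->.
- move=> st1 st2 st3 _ _ c1 c2 _ H1 _ H2.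
  by apply: agree_trans (agree_sub H1 _ _) (agree_sub H2 _ _).
- by move=> st st' t e c1 c2 _ _ H; apply: agree_sub H _ _.
- by move=> st st' t e c1 c2 _ _ H; apply: agree_sub H _ _.
- by move=> st1 st2 st3 _ _ e c _ _ H1 _; apply: agree_trans.
- by [].
Qed.

Lemma runs_agree k c st (Q : store -> Prop) : runs k c st Q ->
  runs k c st (fun st' => agree (wregs c) (warrs c) st st' /\ Q st').
Proof.
move=> [t [st' [ex le Qs]]]; exists t, st'; split=> //; split=> //.
exact: exec_agree ex.
Qed.

(* [I j st] is an invariant with a variant [j]; [f j] bounds the time of an
   iteration started with variant [j]. *)
Lemma runs_while e b (I : nat -> store -> Prop) (f : nat -> nat) j st :
  I j st ->
  (forall j1 st1, I j1 st1 -> agree (wregs b) (warrs b) st st1 ->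
     eval st1 e != 0 ->
     runs (f j1) b st1 (fun st2 => exists2 j2, j2 < j1 & I j2 st2)) ->
  runs ((ecost e).+1 + \sum_(i < j.+1) ((ecost e).+1 + f i)) (While e b) st
    (fun st' => exists2 j', I j' st' & eval st' e = 0).
Proof.
move=> Ij Hb; have: agree (wregs b) (warrs b) st st by [].
(* The current store becomes [st1], while [agree] keeps comparing with the store before the loop. *)
move: {1 3 4}st Ij => st1; have [k] := ubnP j.
elim: k => // k IH in j st1 *; rewrite ltnS => le_jk Ij ag.
case: (eqVneq (eval st1 e) 0) => [e0|ne0].
  exists (ecost e).+1, st1; split; [exact: ExecWhileFalse | | by exists j].
  exact: leq_addr.
have [t1 [st2 [ex1 le1 [j2 lt_j2 I2]]]] := Hb _ _ Ij ag ne0.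
have ag2 : agree (wregs b) (warrs b) st st2.
  exact: agree_trans ag (exec_agree ex1).
have [t2 [st3 [ex2 le2 Q3]]] := IH j2 st2 (leq_trans lt_j2 le_jk) I2 ag2.
exists ((ecost e).+1 + t1 + t2), st3; split=> //.
  exact: ExecWhileTrue ne0 ex1 ex2.
rewrite big_ord_recr /=.
set S := \sum_(i < j2.+1) _ in le2; set S' := \sum_(i < j) _.
(* The variant may drop by more than one; the skipped terms only enlarge the budget. *)
have leS : S <= S'.
  rewrite /S /S' -!(big_mkord xpredT (fun i => (ecost e).+1 + f i)).
  by rewrite [leqRHS](@big_cat_nat _ _ _ j2.+1) //= leq_addr.
lia.
Qed.

Lemma runl_while X e b (I : nat -> store -> Prop) j st (Q : store -> Prop) :
  I j st -> j < X ->
  (forall j1 st1, I j1 st1 -> agree (wregs b) (warrs b) st st1 ->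
     eval st1 e != 0 ->
     runs (lin b) b st1 (fun st2 => exists2 j2, j2 < j1 & I j2 st2)) ->
  (forall j1 st1, I j1 st1 -> agree (wregs b) (warrs b) st st1 ->
     eval st1 e = 0 -> Q st1) ->
  runl X (While e b) st Q.
Proof.
move=> Ij lt_jX Hb HQ.
apply: (runs_weaken (runs_agree (runs_while (f := fun=> lin b) Ij Hb))).
  rewrite /= mulnDl; apply: leq_add; first by rewrite leq_pmulr //; lia.
  by rewrite sum_nat_const card_ord mulnC leq_mul2l lt_jX orbT.
by move=> st' [ag [j' I' e0]]; apply: HQ I' ag e0.
Qed.

(** With [r_e] and [r_m] this is convertible to [for_edges], which [algorithmE] relies on. *)
Definition for_to (x r : nat) (body : cmd) : cmd :=
  (Assign x (Const 0) ;;
   While (Lt (Reg x) (Reg r))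
     (body ;; Assign x (Add (Reg x) (Const 1))))%cmd.

(** The cost [f i] depends on the iteration, so that a loop over all edges may be expensive at few
    of them. Guard and increment cost 4 each, hence 8 per iteration; initialisation and the last
    guard make up the 6. *)
Lemma runs_for (x r : nat) body (M : nat) (I : nat -> store -> Prop) (f :
  nat -> nat)
    st (Q : store -> Prop) :
  r \notin x :: wregs body -> x \notin wregs body -> reg st r = M ->
  I 0 (set_reg st x 0) ->
  (forall i st1, i < M -> agree (x :: wregs body) (warrs body) st st1 ->
     reg st1 x = i -> I i st1 ->
     runs (f i) body st1 (fun st2 => I i.+1 (set_reg st2 x i.+1))) ->
  (forall st1, agree (x :: wregs body) (warrs body) st st1 ->
     I M st1 -> Q st1) ->
  runs (6 + \sum_(i < M) (8 + f i)) (for_to x r body) st Q.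
Proof.
move=> r_ne x_ne rM I0 Hb HQ.
(* Induction on the number [k] of iterations left, the counter being [M - k]. *)
have loop k st1 : k <= M -> reg st1 x = M - k ->
    agree (x :: wregs body) (warrs body) st st1 -> I (M - k) st1 ->
    runs (4 + \sum_(i < M | M - k <= i) (8 + f i))
      (While (Lt (Reg x) (Reg r)) (body ;; Assign x (Add (Reg x)
        (Const 1)))%cmd)
      st1 Q.
  elim: k st1 => [|k IH] st1 leM rx ag Ik.
    exists 4, st1; split=> //; last by apply: HQ => //; rewrite -[M]subn0.
    by apply: (@ExecWhileFalse st1 (Lt (Reg x) (Reg r)));
      rewrite /= rx subn0 ag.1 // rM ltnn.
  have lt_M : M - k.+1 < M by lia.
  have [t1 [st2 [ex1 le1 I2]]] := Hb _ _ lt_M ag rx Ik.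
  have ag12 := exec_agree ex1.
  have rx2 : reg st2 x = M - k.+1 by rewrite ag12.1.
  have eM : (M - k.+1).+1 = M - k by lia.
  have ex2 : exec (Assign x (Add (Reg x) (Const 1))) st2 4
      (set_reg st2 x (M - k)).
    have := ExecAssign st2 x (Add (Reg x) (Const 1)).
    by rewrite /= rx2 (addn1 (M - _)) eM.
  have := IH (set_reg st2 x (M - k)); case=> //.
  - by lia.
  - by rewrite /= eqxx.
  - apply: agree_trans ag _; apply: agree_trans.
      by apply: agree_sub ag12 _ _ => // z zin; rewrite inE zin orbT.
    by split=> //= z; rewrite inE negb_or => /andP[/negbTE ->].
  - by rewrite -eM.
  move=> t3 [st3 [ex3 le3 Q3]].
  exists (4 + (t1 + 4) + t3), st3; split=> //.
    apply: (@ExecWhileTrue st1 (set_reg st2 x (M - k)) _ _ _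
              (Lt (Reg x) (Reg r))) => //.
      by rewrite /= rx ag.1 // rM lt_M.
    exact: ExecSeq ex1 ex2.
  rewrite (bigD1 (Ordinal lt_M)) //=.
  rewrite (eq_bigl (fun i : 'I_M => M - k <= i)); last first.
    by move=> i; rewrite -val_eqE /=; lia.
  move: le3 le1; set S := \sum_(i < M | M - k <= i) _; lia.
have := loop M (set_reg st x 0) (leqnn M).
rewrite subnn /= eqxx; case=> //.
  by split=> //= z; rewrite inE negb_or => /andP[/negbTE ->].
move=> t [st' [ex le Qs]]; exists (2 + t), st'; split=> //.
  exact: (ExecSeq (ExecAssign st x (Const 0)) ex).
Qed.

Lemma runl_for X (x r : nat) body (M : nat) (I : nat -> store -> Prop) st
    (Q : store -> Prop) :
  loop_free body ->
  r \notin x :: wregs body -> x \notin wregs body -> reg st r = M -> M < X ->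
  I 0 (set_reg st x 0) ->
  (forall i st1, i < M -> agree (x :: wregs body) (warrs body) st st1 ->
     reg st1 x = i -> I i st1 -> I i.+1 (set_reg (sem body st1) x i.+1)) ->
  (forall st1, agree (x :: wregs body) (warrs body) st st1 ->
     I M st1 -> Q st1) ->
  runl X (for_to x r body) st Q.
Proof.
move=> lf r_ne x_ne rM ltMX I0 Hb HQ.
have Hb' : forall i st1, i < M ->
    agree (x :: wregs body) (warrs body) st st1 -> reg st1 x = i -> I i st1 ->
    runs (lin body) body st1 (fun st2 => I i.+1 (set_reg st2 x i.+1)).
  by move=> i st1 iM ag rx Ii; apply: runs_sem => //; apply: Hb.
apply: (runs_weaken (runs_for r_ne x_ne rM I0 Hb' HQ)) => //=.
rewrite sum_nat_const card_ord.
have : M.+1 * (8 + lin body) <= X * (8 + lin body)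
  by rewrite leq_mul2r ltMX orbT.
lia.
Qed.

Lemma sem_agree c st :
  loop_free c -> agree (wregs c) (warrs c) st (sem c st).
Proof. by move/(exec_sem st) => [t /exec_agree]. Qed.

(** * Blocks of a depth-first search tree *)

Definition sym_edge (V : finType) (F : {set V * V}) (a b : V) : bool :=
  ((a, b) \in F) || ((b, a) \in F).

Lemma sym_edgeC (V : finType) (F : {set V * V}) a b :
  sym_edge F a b = sym_edge F b a.
Proof. by rewrite /sym_edge orbC. Qed.

Lemma uedgeE (V : finType) (U : {set V}) (F : {set V * V}) a b :
  uedge U F a b = [&& a \in U, b \in U & sym_edge F a b].
Proof. by rewrite /uedge /dedge /sym_edge /=; do 2 case: (_ \in U). Qed.

Lemma connect_uedgeC (V : finType) (U : {set V}) (F : {set V * V}) :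
  connect_sym (uedge U F).
Proof. by apply: sym_connect_sym => a b; rewrite /uedge /= orbC. Qed.

Lemma connect_inv (V : finType) (e : rel V) (P : V -> Prop) a b :
  (forall x z, e x z -> P x -> P z) -> connect e a b -> P a -> P b.
Proof.
move=> eP /connectP[p]; elim: p a => [|z p IH] a /= => [_ -> //|].
by case/andP=> /eP Pz /IH{}IH /IH{}IH /Pz.
Qed.

Lemma strongly_connectedP (V : finType) (U : {set V}) (F : {set V * V}) :
  reflect {in U &, forall a b, connect (dedge U F)
    a b} (strongly_connected U F).
Proof.
apply: (iffP forall_inP) => H a; first by move=> b aU; move: b;
  apply/forall_inP/H.
by move=> aU; apply/forall_inP => b; apply: H.
Qed.

Lemma uconnectedP (V : finType) (U : {set V}) (F : {set V * V}) :
  reflect {in U &, forall a b, connect (uedge U F) a b} (uconnected U F).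
Proof.
apply: (iffP forall_inP) => H a; first by move=> b aU; move: b;
  apply/forall_inP/H.
by move=> aU; apply/forall_inP => b; apply: H.
Qed.

Lemma strongly_uconnected (V : finType) (U : {set V}) (F : {set V * V}) :
  strongly_connected U F -> uconnected U F.
Proof.
move/strongly_connectedP=> H; apply/uconnectedP => a b aU bU.
apply: connect_sub (H a b aU bU) => x z xz.
by apply: connect1; rewrite /uedge /= in xz *; rewrite xz.
Qed.

(** Letting [x] range over all vertices is harmless: deleting a vertex outside [U] leaves the
    connected set [U]. *)
Lemma biconnectedP (V : finType) (U : {set V}) (F : {set V * V}) :
  reflect (uconnected U F /\ forall x, uconnected (U :\ x) F) (biconnected U F).
Proof.
apply: (iffP andP) => -[H1 H2]; split=> //; last first.
  by apply/forallP => x; rewrite negb_and negbK H2 orbT.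
move=> x; have /forallP/(_ x) := H2; rewrite negb_and negbK; case/orP=> // nx.
by have /setDidPl -> :
  [disjoint U & [set x]] by rewrite disjoint_sym disjoints1.
Qed.

Lemma strongly_biconnectedP (V : finType) (U : {set V}) (F : {set V * V}) :
  reflect (strongly_connected U F /\ forall x, uconnected (U :\ x) F)
    (strongly_biconnected U F).
Proof.
apply: (iffP andP) => [[sc /biconnectedP[_ H]]|[sc H]]; split=> //.
by apply/biconnectedP; split=> //; apply: strongly_uconnected.
Qed.

Lemma strongly_connectedS (V : finType) (U : {set V}) (F F' : {set V * V}) :
  F \subset F' -> strongly_connected U F -> strongly_connected U F'.
Proof.
move=> /subsetP sFF /strongly_connectedP H.
apply/strongly_connectedP => a b aU bU.
apply: connect_sub (H a b aU bU) => x z /and3P[xU zU /sFF xz].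
by apply: connect1; rewrite /dedge /= xU zU.
Qed.

Lemma uconnectedS (V : finType) (U : {set V}) (F F' : {set V * V}) :
  F \subset F' -> uconnected U F -> uconnected U F'.
Proof.
move=> /subsetP sFF /uconnectedP H; apply/uconnectedP => a b aU bU.
apply: connect_sub (H a b aU bU) => x z; rewrite uedgeE => /and3P[xU zU xz].
by apply: connect1; rewrite uedgeE xU zU; case/orP: xz => /sFF xz;
  rewrite /sym_edge xz ?orbT.
Qed.

Lemma strongly_biconnectedS (V : finType) (U : {set V}) (F F' : {set V * V}) :
  F \subset F' -> strongly_biconnected U F -> strongly_biconnected U F'.
Proof.
move=> sFF /strongly_biconnectedP[sc H].
apply/strongly_biconnectedP; split=> [|x]; first exact: strongly_connectedS sc.
exact: uconnectedS (H x).
Qed.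

(** Numbers can replace ancestry here: the subtree of [h] is numbered above [par h], and an edge
    leaving it ends at an ancestor, so [num z < num (par h)] means that the edge passes above the
    parent. This is the comparison that low points decide. *)
Definition is_head (V : finType) (F : {set V * V}) (y : V) (par : V -> V)
    (num : V -> nat) (h : V) : bool :=
  (h != y) && [forall x, forall z,
    fconnect par x h ==> sym_edge F x z ==> (num (par h) <= num z)].

(* A depth-first search tree of the underlying undirected graph: [num] is the
   order of discovery, and [bh v] the deepest head above [v]. *)
Record dfs_tree (V : finType) (F : {set V * V}) (y : V) (par : V -> V)
    (num : V -> nat) (bh : V -> V) : Prop := DfsTree {
  dfs_root : par y = y;
  dfs_num v : v != y -> num (par v) < num v;
  dfs_inj : injective num;
  dfs_par v : v != y -> sym_edge F (par v) v;
  dfs_anc a b : sym_edge F a b -> fconnect par a b || fconnect par b a;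
  dfs_bh v : v != y ->
    bh v = if is_head F y par num v then v else bh (par v) }.

Definition block (V : finType) (y : V) (par bh : V -> V) (h : V) : {set V} :=
  par h |: [set x | (x != y) && (bh x == h)].

Section Blocks.

Variables (V : finType) (F : {set V * V}) (y : V) (par : V -> V).
Variables (num : V -> nat) (bh : V -> V).
Hypothesis tree : dfs_tree F y par num bh.

Notation anc x a := (fconnect par x a).
Notation head := (is_head F y par num).
Notation block := (block y par bh).

Lemma anc_up x a : anc x a -> x != a -> (x != y) /\ anc (par x) a.
Proof.
move=> xa ne_xa; have := iter_findex xa; case: findex => [/= E|k].
  by rewrite E eqxx in ne_xa.
rewrite iterSr => E; have pa : anc (par x) a by rewrite -E fconnect_iter.
split=> //; apply: contra_neq ne_xa => xy; rewrite xy in E *; rewrite -E.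
by rewrite (dfs_root tree); elim: k {E} => //= k <-; rewrite (dfs_root tree).
Qed.

Lemma anc_par x : anc x (par x).
Proof. exact: fconnect1. Qed.

Lemma num_ind (P : V -> Prop) :
  (forall v, (forall w, num w < num v -> P w) -> P v) -> forall v, P v.
Proof.
move=> H v; have [k] := ubnP (num v); elim: k => // k IH in v *.
by rewrite ltnS => le; apply: H => w lt; apply: IH; apply: leq_trans le.
Qed.

Lemma anc_num x a : anc x a -> num a <= num x.
Proof.
elim/num_ind: x => x IH xa; have [->//|ne] := eqVneq x a.
have [ny pa] := anc_up xa ne.
have lt := dfs_num tree ny; exact: leq_trans (IH _ lt pa) (ltnW lt).
Qed.

Lemma anc_root x : anc x y.
Proof.
elim/num_ind: x => x IH; have [->//|ne] := eqVneq x y.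
exact: connect_trans (anc_par x) (IH _ (dfs_num tree ne)).
Qed.

Lemma anc_antisym a b : anc a b -> anc b a -> a = b.
Proof.
move=> /anc_num ba /anc_num ab; apply: (dfs_inj tree); apply/eqP.
by rewrite eqn_leq ab.
Qed.

Lemma anc_total x a b : anc x a -> anc x b -> num a <= num b -> anc b a.
Proof.
elim/num_ind: x => x IH xa xb le; have [<-//|ne] := eqVneq x b.
have [ny pb] := anc_up xb ne; have lt := dfs_num tree ny.
have [E|ne'] := eqVneq x a.
  by have := leq_ltn_trans (anc_num pb) lt; rewrite E ltnNge le.
by apply: (IH (par x)) => //; case: (anc_up xa ne').
Qed.

Lemma head_neq h : head h -> h != y.
Proof. by case/andP. Qed.

Lemma head_num h : head h -> num (par h) < num h.
Proof. by move/head_neq; apply: (dfs_num tree). Qed.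

(** The outer end [b] is an ancestor of [a] outside the subtree of [h], thus strictly above [h] and
    numbered at most [num (par h)]; the head condition gives the converse inequality. So [par h]
    separates the subtree of [h] from the rest. *)
Lemma head_cut h a b :
  head h -> anc a h -> sym_edge F a b -> ~~ anc b h -> b = par h.
Proof.
move=> hh ah ab nbh; have /andP[hy /forallP/(_ a)/forallP/(_ b)] := hh.
rewrite ah ab /= => le; have lt := head_num hh.
have nba : ~~ anc b a by apply: contra nbh => ba; apply: connect_trans ah.
have := dfs_anc tree ab; rewrite (negbTE nba) orbF => anc_ab.
have ltbh : num b < num h.
  by rewrite ltnNge; apply: contra nbh; apply: anc_total anc_ab.
have hb : anc h b by apply: (anc_total anc_ab ah); apply: ltnW.
have nhb : h != b by apply: contraTneq ltbh => ->; rewrite ltnn.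
have [_ /anc_num le'] := anc_up hb nhb.
by apply: (dfs_inj tree); apply/eqP; rewrite eqn_leq le le'.
Qed.

(** No vertex is numbered below the root, so the head condition holds trivially. The recursion for
    [bh] thus stops before the root, where [bh] is unconstrained. *)
Lemma head_child v : v != y -> par v = y -> head v.
Proof.
move=> ny E; rewrite /is_head ny E; apply/forallP=> x; apply/forallP => z.
by rewrite (anc_num (anc_root z)) !implybT.
Qed.

Lemma nhead_par v : v != y -> ~~ head v -> par v != y.
Proof. by move=> ny; apply: contraNneq => /(head_child ny). Qed.

Lemma bh_head v : v != y -> head (bh v).
Proof.
elim/num_ind: v => v IH ny; rewrite (dfs_bh tree ny); case: ifP => // /negbT nh.
by apply: IH; [apply: (dfs_num tree) | apply: nhead_par].
Qed.

Lemma bh_anc v : v != y -> anc v (bh v).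
Proof.
elim/num_ind: v => v IH ny; rewrite (dfs_bh tree ny); case: ifP => // /negbT nh.
apply: connect_trans (anc_par v) _.
by apply: IH; [apply: (dfs_num tree) | apply: nhead_par].
Qed.

Lemma bh_deepest v h : v != y -> head h -> anc v h -> anc (bh v) h.
Proof.
elim/num_ind: v => v IH ny hh vh; rewrite (dfs_bh tree ny).
case: ifP => // /negbT nh; have ne : v != h by apply: contraNneq nh => ->.
have [_ ph] := anc_up vh ne.
by apply: IH => //; [apply: (dfs_num tree) | apply: nhead_par].
Qed.

Lemma anc_head_neq x h : head h -> anc x h -> x != y.
Proof.
move=> hh xh; apply: contraTneq (xh) => ->; apply/negP => yh.
have := anc_antisym yh (anc_root h) => E.
by have := head_neq hh; rewrite E eqxx.
Qed.

(** Blocks are convex along tree paths: [bh x] is a head above [z] and [bh z] a head above [x], so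
    each of the two deepest heads lies below the other. *)
Lemma bh_between x z : x != y -> anc x z -> anc z (bh x) -> bh z = bh x.
Proof.
move=> xy xz zh; have hh := bh_head xy; have zy := anc_head_neq hh zh.
apply: anc_antisym; first exact: bh_deepest.
by apply: bh_deepest (bh_head zy) _ => //; apply: connect_trans xz (bh_anc zy).
Qed.

Lemma head_bh h : head h -> bh h = h.
Proof. by move=> hh; rewrite (dfs_bh tree (head_neq hh)) hh. Qed.

Lemma in_block x h : (x \in block h) = (x == par h) || (x != y) && (bh x == h).
Proof. by rewrite !inE. Qed.

Lemma par_in_block h : par h \in block h.
Proof. by rewrite in_block eqxx. Qed.

Lemma head_in_block h : head h -> h \in block h.
Proof. by move=> hh; rewrite in_block head_neq // head_bh // eqxx orbT. Qed.

Lemma bh_in_block x : x != y -> x \in block (bh x).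
Proof. by move=> ny; rewrite in_block ny eqxx orbT. Qed.

Lemma par_not_anc h : head h -> ~~ anc (par h) h.
Proof.
by move=> hh; apply/negP => /anc_num; rewrite leqNgt head_num.
Qed.

Lemma block_anc x h : x \in block h -> x != par h ->
  [/\ x != y, bh x = h & anc x h].
Proof.
rewrite in_block => /orP[->//|/andP[ny /eqP E]] _; split=> //.
by rewrite -E bh_anc.
Qed.

(** Otherwise [x] and [z] would be joined inside [U :\ par h], whereas a walk leaving the subtree of
    the head [h] passes through [par h]. *)
Lemma biconnected_cut (U : {set V}) h x z : biconnected U F -> head h ->
  x \in U -> anc x h -> z \in U -> ~~ anc z h -> z = par h.
Proof.
move=> /biconnectedP[_ /(_ (par h))/uconnectedP H] hh xU xh zU zh.
apply/eqP; apply: contraNT zh => ne.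
have xp : x != par h by apply: contraTneq xh => ->; apply: par_not_anc.
have := H x z; rewrite !inE xp ne => /(_ xU zU) c.
apply: (connect_inv (P := fun a => anc a h)) c xh => a b;
  rewrite uedgeE !inE => /and3P[_ /andP[bp _] ab].
by move=> ah; apply: contraNT bp => nb; rewrite (head_cut hh ah ab nb).
Qed.

Lemma biconnected_sub_block (U : {set V}) v : v != y -> biconnected U F ->
  exists2 h, head h & U \subset block h.
Proof.
move=> vy bU; case: (boolP [exists x in U, x != y]) => [/exists_inP[x xU xy]|].
  (* Among the heads with a vertex of [U] below them, take the one numbered last. A vertex of [U]
     below it has its deepest head below it too, hence equal to it by maximality. *)
  pose P h := head h && [exists u in U, anc u h].
  have P0 : P (bh x).
    by rewrite /P bh_head //; apply/exists_inP; exists x => //; apply: bh_anc.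
  case: (@arg_maxnP V (bh x) P num P0) => h /andP[hh /exists_inP[u uU uh]] hmax.
  exists h => //; apply/subsetP => z zU.
  case: (boolP (anc z h)) => zh; last first.
    by rewrite (biconnected_cut bU hh uU uh zU zh) par_in_block.
  have zy := anc_head_neq hh zh.
  have /hmax le : P (bh z).
    by rewrite /P bh_head //; apply/exists_inP; exists z => //; apply: bh_anc.
  have /anc_num le' := bh_deepest zy hh zh.
  have -> : h = bh z by apply: (dfs_inj tree); apply/eqP; rewrite eqn_leq le';
    apply: le.
  exact: bh_in_block.
(* Here [U] contains at most the root, which belongs to the block of each of its children. *)
rewrite negb_exists_in => /forall_inP H.
have [c cy pc] : exists2 c, c != y & par c = y.
  elim/num_ind: v vy => v IH vy; have [E|ne] := eqVneq (par v) y.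
    by exists v.
  exact: IH (dfs_num tree vy) ne.
exists c; first exact: head_child.
by apply/subsetP => z /H; rewrite negbK => /eqP ->; rewrite in_block pc eqxx.
Qed.

(** Two blocks share at most one vertex. Apart from the parent of its head, a vertex of a block
    determines the head by [bh]; so two common vertices of distinct blocks would be [par h] and
    [par h'], each with the head of the other block above it, forcing [num h < num h'] and
    [num h' < num h]. *)
Lemma block_inj h h' a b : head h -> head h' -> a != b ->
  a \in block h -> b \in block h -> a \in block h' -> b \in block h' -> h = h'.
Proof.
move=> hh hh' ne ah bh_ ah' bh'.
apply/eqP; apply: contraTT (ne) => nhh; rewrite negbK.
have anc_lt g g' x : head g -> head g' -> bh x = g -> x != y -> x = par g' ->
    num g < num g'.
  move=> hg hg' E xy E'; have := anc_num (bh_anc xy); rewrite E E'.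
  by move=> /leq_ltn_trans; apply; apply: head_num.
have clash x z : x != z -> x \in block h -> z \in block h -> x \in block h' ->
    z \in block h' -> x != par h -> False.
  move=> xz xh zh xh' zh' xp; have [xy E _] := block_anc xh xp.
  have E' : x = par h'.
    apply/eqP; apply: contraNT nhh => ne'.
    by have [_ <- _] := block_anc xh' ne'; rewrite E.
  have zp' : z != par h' by rewrite -E' eq_sym.
  have [zy Ez _] := block_anc zh' zp'.
  have Ez' : z = par h.
    apply/eqP; apply: contraNT nhh => ne'.
    by have [_ <- _] := block_anc zh ne'; rewrite Ez.
  have lt := anc_lt _ _ _ hh hh' E xy E'.
  by have := ltn_trans lt (anc_lt _ _ _ hh' hh Ez zy Ez'); rewrite ltnn.
case: (eqVneq a (par h)) => [ap|ap].
  case: (eqVneq b (par h)) => [bp|bp]; first by rewrite ap bp.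
  by case: (clash b a) => //; rewrite eq_sym.
by case: (clash a b).
Qed.

Lemma block_sub_eq h h' : head h -> head h' -> block h \subset block h' ->
  h = h'.
Proof.
move=> hh hh' /subsetP s; apply: (@block_inj _ _ h (par h)) => //.
- by apply: contraTneq (head_num hh) => <-; rewrite ltnn.
- exact: head_in_block.
- exact: par_in_block.
- exact/s/head_in_block.
- exact/s/par_in_block.
Qed.

(** For [a] below [b] the block of [bh a] works: either [b] is below [bh a] and convexity applies,
    or the edge leaves the subtree of a head and ends at its parent. *)
Lemma edge_in_block a b : a != b -> sym_edge F a b ->
  exists2 h, head h & (a \in block h) && (b \in block h).
Proof.
wlog ab : a b / anc a b => [W ne e|ne e].
  have /orP[ab|ba] := dfs_anc tree e; first exact: W.
  rewrite eq_sym in ne; rewrite sym_edgeC in e.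
  by have [h hh] := W b a ba ne e; rewrite andbC; exists h.
have [ay pb] := anc_up ab ne; have hh := bh_head ay; exists (bh a) => //.
rewrite bh_in_block //=; case: (boolP (anc b (bh a))) => bh_b.
  have by_ := anc_head_neq hh bh_b.
  by rewrite -(bh_between ay ab bh_b) bh_in_block.
by rewrite (head_cut hh (bh_anc ay) e bh_b) par_in_block.
Qed.

Lemma block_below h x : head h -> anc x h -> x \notin block h ->
  exists h', [/\ head h', anc x h', anc h' h, h' != h & par h' \in block h].
Proof.
elim/num_ind: x => x IH hh xh nx; have xy := anc_head_neq hh xh.
have hg := bh_head xy; have gh := bh_deepest xy hh xh.
have ng : bh x != h by apply: contraNneq nx => <-; apply: bh_in_block.
case: (boolP (par (bh x) \in block h)) => [pB|npB].
  by exists (bh x); split=> //; apply: bh_anc.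
have [_ ph] := anc_up gh ng; have xg := bh_anc xy.
have xpg : anc x (par (bh x)) by apply: connect_trans xg (anc_par _).
have lt : num (par (bh x)) < num x.
  exact: leq_trans (head_num hg) (anc_num xg).
have [h' [? a1 ? ? ?]] := IH _ lt hh ph npB.
by exists h'; split=> //; apply: connect_trans a1.
Qed.

Lemma block_not_below h h' x : head h -> head h' -> anc h' h -> h' != h ->
  x \in block h -> ~~ anc x h'.
Proof.
move=> hh hh' h'h ne xB; apply/negP => xh'.
have xp : x != par h.
  apply: contraNneq (par_not_anc hh) => <-; exact: connect_trans h'h.
have [xy E _] := block_anc xB xp; have := bh_deepest xy hh' xh'.
by rewrite E => /(anc_antisym h'h)/eqP; apply/negP.
Qed.

(* Blocks are retracts: what hangs below a head [h'] of the block is sent to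
   [par h'], and everything outside the subtree of [h] to [par h]. *)
Lemma block_retract (e : rel V) h a b : head h -> subrel e (sym_edge F) ->
  a \in block h -> b \in block h -> connect e a b ->
  connect [rel x z | [&& x \in block h, z \in block h & e x z]] a b.
Proof.
move=> hh sub aB bB; set e' := [rel x z | _].
(* The retraction is kept as a relation [Pr], total by [PrB]; this avoids choosing the head [h']. *)
pose Pr x z := if x \in block h then z = x else if anc x h then
  exists h', [/\ head h', anc x h', anc h' h, h' != h & z = par h' /\
    z \in block h]
  else z = par h.
have PrB x : exists z, Pr x z.
  case: (boolP (x \in block h)) => [xB|nx]; first by exists x; rewrite /Pr xB.
  case: (boolP (anc x h)) => xh; last first.
    by exists (par h); rewrite /Pr (negbTE nx) (negbTE xh).
  have [h' [? ? ? ? ?]] := block_below hh xh nx.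
  by exists (par h'); rewrite /Pr (negbTE nx) xh; exists h'.
(* An edge is either collapsed or kept with its direction, so directed walks retract to directed
   walks. *)
suff step x x' z : e x x' -> Pr x z -> exists2 z', Pr x' z' & connect e' z z'.
  move=> c; have : exists2 z, Pr b z & connect e' a z.
    apply: (connect_inv (P := fun x => exists2 z, Pr x z & connect e' a z)) c _.
      move=> x x' xx' [z /(step _ _ _ xx')[z' ? zz'] az]; exists z' => //.
      exact: connect_trans az zz'.
    by exists a => //; rewrite /Pr aB.
  by case=> z; rewrite /Pr bB => ->.
move=> /[dup] exx /sub xx'; have x'x : sym_edge F x' x by rewrite sym_edgeC.
rewrite {1}/Pr; case: ifP => [xB ->|/negbT nxB].
  case: (boolP (x' \in block h)) => [x'B|nx'B].
    by exists x'; [rewrite /Pr x'B | apply: connect1; rewrite /= xB x'B].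
  exists x => //; rewrite /Pr (negbTE nx'B); case: ifP => [x'h|/negbT nx'h].
    have [h' [hh' x'h' h'h ne pB]] := block_below hh x'h nx'B.
    have nxh' := block_not_below hh hh' h'h ne xB.
    by exists h'; split=> //; split=> //; apply: head_cut x'x nxh'.
  apply/eqP; apply: contraNT nx'B => xp; have [_ _ xh] := block_anc xB xp.
  by rewrite (head_cut hh xh xx' nx'h) par_in_block.
case: ifP => [xh [h' [hh' xh' h'h ne [-> pB]]]|/negbT nxh ->].
  case: (boolP (anc x' h')) => x'h'.
    exists (par h') => //; rewrite /Pr.
    rewrite ifN; last by apply: contraL x'h' =>
      /(block_not_below hh hh' h'h ne).
    by rewrite (connect_trans x'h' h'h); exists h'.
  by exists (par h') => //; rewrite /Pr (head_cut hh' xh' xx' x'h') pB.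
have nx'h : ~~ anc x' h.
  by apply: contra nxB => x'h; rewrite (head_cut hh x'h x'x nxh) par_in_block.
exists (par h) => //; rewrite /Pr (negbTE nx'h); case: ifP => // x'B.
by apply/eqP; rewrite eq_sym; apply: contraNT nx'h => /(block_anc x'B)[].
Qed.

Lemma block_strongly_connected h : strongly_connected [set: V] F -> head h ->
  strongly_connected (block h) F.
Proof.
move=> /strongly_connectedP sc hh; apply/strongly_connectedP => a b aB bB.
have sub : subrel (dedge [set: V] F) (sym_edge F).
  by move=> x z /and3P[_ _]; rewrite /sym_edge => ->.
have := block_retract hh sub aB bB (sc a b (in_setT _) (in_setT _)).
apply: connect_sub => x z /and3P[xB zB /and3P[_ _ xz]].
by apply: connect1; rewrite /dedge /= xB zB.
Qed.

Lemma block_par h w : head h -> bh w = h -> w != y -> w != h ->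
  [/\ ~~ head w, par w \in block h, par w != par h, bh (par w)
    = h & par w != y].
Proof.
move=> hh E wy ne; have nhw : ~~ head w.
  by apply: contra ne => hw; rewrite -(head_bh hw) E.
have py := nhead_par wy nhw.
have Ep : bh (par w) = h by rewrite -E (dfs_bh tree wy) (negbTE nhw).
split=> //; first by rewrite -Ep bh_in_block.
apply: contraNneq (par_not_anc hh) => <-.
have wh : anc w h by rewrite -E bh_anc.
by case: (anc_up wh ne).
Qed.

(** If [par h] is deleted, tree edges lead every vertex up to [h]. Otherwise one climbs to [par h];
    the climb is blocked only at a child [w] of [x], and as [w] is not a head, some edge jumps from
    its subtree to above [x]. Induction on [num] resumes there. *)
Lemma block_uconnectedD h x : head h -> x \in block h ->
  uconnected (block h :\ x) F.
Proof.
move=> hh xB; set D := block h :\ x.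
suff [r Hr] : exists r, forall w, w \in D -> connect (uedge D F) w r.
  apply/uconnectedP => a b aD bD; apply: connect_trans (Hr a aD) _.
  by rewrite connect_uedgeC Hr.
have step a b : a \in D -> b \in D -> sym_edge F a b -> connect (uedge D F) a b.
  by move=> aD bD ab; apply: connect1; rewrite uedgeE aD bD.
have inD z : (z \in D) = (z != x) && (z \in block h) by rewrite !inE.
case: (eqVneq x (par h)) => [Ex|xp].
  exists h; elim/num_ind => w IH wD; have [->//|ne] := eqVneq w h.
  have := wD; rewrite inD Ex => /andP[wp wB].
  have [wy E _] := block_anc wB wp; have [_ pB pp _ _] := block_par hh E wy ne.
  have pD : par w \in D by rewrite inD Ex pp.
  apply: connect_trans (IH _ (dfs_num tree wy) pD).
  by apply: step => //; rewrite sym_edgeC; apply: (dfs_par tree).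
have [xy Ex xh] := block_anc xB xp.
exists (par h); elim/num_ind => w IH wD; have [->//|wp] := eqVneq w (par h).
have := wD; rewrite inD => /andP[wx wB]; have [wy E wh] := block_anc wB wp.
have lt := dfs_num tree wy.
have up : par w \in D -> connect (uedge D F) w (par h).
  move=> pD; apply: connect_trans (IH _ lt pD).
  by apply: step => //; rewrite sym_edgeC; apply: (dfs_par tree).
have [Ew|ne] := eqVneq w h.
  by apply: up; rewrite inD Ew par_in_block andbT eq_sym.
have [nhw pB _ Ep py] := block_par hh E wy ne.
have [Epx|ne'] := eqVneq (par w) x; last by apply: up; rewrite inD ne'.
(* The detour around [x]: down from [w] to [d], then along the edge to [z], which is above [x]. It
   remains to see that it stays in the block. *)
have [d [z [dw dz ltz]]] : exists d z, [/\ anc d w,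
  sym_edge F d z & num z < num x].
  move: nhw; rewrite /is_head wy /= => /forallPn[d /forallPn[z]].
  by rewrite !negb_imply -ltnNge Epx => /and3P[? ? ?]; exists d, z.
have le_wd := anc_num dw; rewrite Epx in lt.
have dz' : anc d z.
  have /orP[//|/anc_num] := dfs_anc tree dz.
  by rewrite leqNgt (ltn_trans ltz (leq_trans lt le_wd)).
have dx : anc d x by apply: connect_trans dw _; rewrite -Epx anc_par.
have xz : anc x z by apply: anc_total dz' dx (ltnW ltz).
have dh : anc d h by apply: connect_trans dw wh.
have dy := anc_head_neq hh dh.
have hg := bh_head dy; have dg := bh_anc dy.
(* A deepest head of [d] strictly below [w] would force [z] to be its parent, which is at or below
   [w], although [z] is numbered before [x]. *)
have Ed : bh d = h.
  apply: (anc_antisym (bh_deepest dy hh dh)).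
  have [gw|wg] := leqP (num (bh d)) (num w).
    rewrite -E; apply: bh_deepest => //; exact: anc_total dg dw gw.
  have gw : anc (bh d) w by apply: anc_total dw dg (ltnW wg).
  have ngw : bh d != w by apply: contraTneq wg => ->; rewrite ltnn.
  have [_ pw] := anc_up gw ngw.
  have nz : ~~ anc z (bh d).
    apply/negP => /anc_num.
    by rewrite leqNgt (ltn_trans ltz (ltn_trans lt wg)).
  have := anc_num pw; rewrite -(head_cut hg dg dz nz).
  by rewrite leqNgt (ltn_trans ltz lt).
have zD : z \in D.
  rewrite inD; apply/andP; split; first by apply: contraTneq ltz => ->;
    rewrite ltnn.
  case: (boolP (anc z h)) => zh; last by rewrite (head_cut hh dh dz zh)
    par_in_block.
  rewrite -Ex in zh; have zy : z != y by apply: anc_head_neq zh; rewrite Ex.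
  by rewrite -Ex -(bh_between xy xz zh) bh_in_block.
(* The tree path between [c] and [w] avoids [x] because its vertices are numbered from [num w] on,
   after [x]. *)
have down c : anc c w -> bh c = h -> c \in D /\ connect (uedge D F) c w.
  elim/num_ind: c => c IHc cw Ec; have ch : anc c h by apply: connect_trans wh.
  have cy := anc_head_neq hh ch.
  have cD : c \in D.
    rewrite inD -Ec bh_in_block // andbT; apply: contraTneq (anc_num cw) => ->.
    by rewrite -ltnNge.
  split=> //; have [->//|ncw] := eqVneq c w; have [_ pw] := anc_up cw ncw.
  have Epc : bh (par c) = h.
    rewrite -Ec; apply: bh_between => //; first exact: anc_par.
    by rewrite Ec; apply: connect_trans wh.
  have [pD pcw] := IHc _ (dfs_num tree cy) pw Epc.
  apply: connect_trans pcw; apply: step => //.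
  by rewrite sym_edgeC; apply: (dfs_par tree).
have [dD dcw] := down d dw Ed.
rewrite connect_uedgeC in dcw; apply: connect_trans dcw _.
apply: connect_trans (step _ _ dD zD dz) (IH _ (ltn_trans ltz lt) zD).
Qed.

Lemma block_strongly_biconnected h : strongly_connected [set: V] F -> head h ->
  strongly_biconnected (block h) F.
Proof.
move=> sc hh; have scB := block_strongly_connected sc hh.
apply/strongly_biconnectedP; split=> // x.
case: (boolP (x \in block h)) => [|nx]; first exact: block_uconnectedD.
have /setDidPl -> : [disjoint block h & [set x]] by rewrite disjoint_sym disjoints1.
exact: strongly_uconnected.
Qed.

(** Blocks are strongly biconnected, absorb every biconnected set and are pairwise incomparable. A
    second vertex [v] is required: a one-vertex graph has a component but no head. *)
Lemma sb_components_blocks v : v != y -> strongly_connected [set: V] F ->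
  sb_components F = [set block h | h in head].
Proof.
move=> vy sc; apply/setP => C; rewrite inE.
apply/maxsetP/imsetP => [[/andP[_ bC] Cmax]|[h hh ->]].
  have [h hh CB] := biconnected_sub_block vy bC; exists h => //.
  by rewrite (Cmax (block h)) // block_strongly_biconnected.
split=> [|D /andP[_ bD] hD]; first exact: block_strongly_biconnected.
have [h' hh' DB] := biconnected_sub_block vy bD.
have E := block_sub_eq hh hh' (subset_trans hD DB).
by apply/eqP; rewrite eqEsubset hD E DB.
Qed.

(** A singleton is biconnected. *)
Lemma in_some_block v u : v != y -> exists2 h, head h & u \in block h.
Proof.
move=> vy; have [|h hh /subsetP s] := @biconnected_sub_block [set u] v vy;
  last first.
  by exists h => //; apply: s; rewrite inE.
apply/biconnectedP; split=> [|x]; apply/uconnectedP => a b; rewrite !inE.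
  by move=> /eqP -> /eqP ->.
by move=> /andP[_ /eqP ->] /andP[_ /eqP ->].
Qed.

End Blocks.

(** * Crossing edges and the number of components *)

Section Merging.

Variables (V : finType) (y : V).

(** A search tree of [F] gives none for [e |: F]; statements about a growing graph only ask that
    some tree exist. *)
Definition treeable (F : {set V * V}) : Prop :=
  exists par num bh, dfs_tree F y par num bh.

Lemma sb_components_trivial (F : {set V * V}) :
  (forall v, v = y) -> strongly_biconnected [set: V] F /\
  sb_components F = [set [set: V]].
Proof.
move=> Vy; have sT : strongly_biconnected [set: V] F.
  apply/strongly_biconnectedP; split=> [|x].
    by apply/strongly_connectedP => a b _ _; rewrite (Vy a) (Vy b) connect0.
  apply/uconnectedP => a b; rewrite !inE.
  by rewrite (Vy a) (Vy b) connect0.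
split=> //; apply/setP => C; rewrite !inE; apply/maxsetP/eqP => [[_ H]|->].
  by rewrite (H setT) // subsetT.
split=> // D _; rewrite subTset => /eqP ->//.
Qed.

(** Reduces the test to counting heads. The bound is [<= 1] and not [= 1] because of the one-vertex
    graph. *)
Lemma sb_heads (F : {set V * V}) par num bh :
  dfs_tree F y par num bh -> strongly_connected [set: V] F ->
  strongly_biconnected [set: V] F =
  (#|[set h | is_head F y par num h]| <= 1).
Proof.
move=> tree sc; case: (pickP (fun v => v != y)) => [v vy|Vy]; last first.
  have Vy' v : v = y by apply/eqP; rewrite -[_ == _]negbK Vy.
  have [-> _] := sb_components_trivial F Vy'; apply/esym.
  rewrite (eq_card0 (A := mem [set h | _])) // => h; rewrite !inE.
  by rewrite /is_head (Vy' h) eqxx.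
apply/idP/idP => [sb|le1].
  apply/card_le1_eqP => h h'; rewrite !inE => hh hh'.
  have [g hg /subsetP s] := biconnected_sub_block tree vy (proj2 (andP sb)).
  have W x : is_head F y par num x -> x = g.
    move=> hx; apply: (block_sub_eq tree) => //; apply/subsetP => z _.
    exact: s.
  by rewrite (W h) // (W h').
have [h hh _] := in_some_block tree y vy.
suff E : block y par bh h = [set: V].
  by rewrite -E; apply: (block_strongly_biconnected tree).
apply/eqP; rewrite -subTset; apply/subsetP => x _.
have [g hg xg] := in_some_block tree x vy.
by rewrite (card_le1_eqP le1 g h) // inE.
Qed.

(** The boolean side needs only [bh] and [par] at the two vertices, so [common_expr] evaluates it in
    constant time. *)
Lemma common_blockP (F : {set V * V}) par num bh v u w :
  dfs_tree F y par num bh -> v != y ->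
  reflect (exists2 h, is_head F y par num h &
             (u \in block y par bh h) && (w \in block y par bh h))
    [|| u == w, [&& u != y, w != y & bh u == bh w],
        (u != y) && (w == par (bh u)) | (w != y) && (u == par (bh w))].
Proof.
move=> tree vy; apply: (iffP or4P).
- case=> [/eqP <-|/and3P[uy wy /eqP E]|/andP[uy /eqP ->]|/andP[wy /eqP ->]].
  + by have [h hh uh] := in_some_block tree u vy; exists h; rewrite ?uh.
  + exists (bh u); first exact: bh_head tree _ _.
    by rewrite bh_in_block // E bh_in_block.
  + exists (bh u); first exact: bh_head tree _ _.
    by rewrite bh_in_block // par_in_block.
  + exists (bh w); first exact: bh_head tree _ _.
    by rewrite bh_in_block // par_in_block.
case=> h hh; rewrite !in_block => /andP[].
case/orP=> [/eqP->|/andP[uy /eqP Eu]]; case/orP=> [/eqP->|/andP[wy /eqP Ew]].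
- by constructor 1.
- by constructor 4; rewrite wy Ew eqxx.
- by constructor 3; rewrite uy Eu eqxx.
- by constructor 2; rewrite uy wy Eu Ew eqxx.
Qed.

Lemma sb_component_exists (F : {set V * V}) u : treeable F ->
  strongly_connected [set: V] F -> exists2 C, C \in sb_components F & u \in C.
Proof.
move=> [par [num [bh tree]]] sc.
case: (pickP (fun v => v != y)) => [v vy|Vy].
  have [h hh uh] := in_some_block tree u vy; exists (block y par bh h) => //.
  by rewrite (sb_components_blocks tree vy sc) imset_f.
have Vy' v : v = y by apply/eqP; rewrite -[_ == _]negbK Vy.
by have [_ ->] := sb_components_trivial F Vy'; exists setT; rewrite ?inE.
Qed.

(* Stronger than [eligible], whose two ends may share a third component: adding
   a crossing edge always merges components. *)
Definition crossing (F : {set V * V}) (e : V * V) : Prop :=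
  forall C, C \in sb_components F -> ~~ ((e.1 \in C) && (e.2 \in C)).

Lemma sub_sb_component (F : {set V * V}) (U : {set V}) : treeable F ->
  strongly_connected [set: V] F -> biconnected U F ->
  exists2 C, C \in sb_components F & U \subset C.
Proof.
move=> [par [num [bh tree]]] sc bU.
case: (pickP (fun v => v != y)) => [v vy|Vy].
  have [h hh uh] := biconnected_sub_block tree vy bU.
  exists (block y par bh h) => //.
  by rewrite (sb_components_blocks tree vy sc) imset_f.
have Vy' v : v = y by apply/eqP; rewrite -[_ == _]negbK Vy.
have [_ ->] := sb_components_trivial F Vy'.
by exists setT; rewrite ?inE ?subsetT.
Qed.

Lemma edge_sb_component (F : {set V * V}) a b : treeable F ->
  strongly_connected [set: V] F -> sym_edge F a b ->
  exists C, [/\ C \in sb_components F, a \in C & b \in C].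
Proof.
move=> tF sc e; have [<-|ne] := eqVneq a b.
  by have [C ? ?] := sb_component_exists a tF sc; exists C.
have [par [num [bh tree]]] := tF.
have [h hh /andP[ah bh_]] := edge_in_block tree ne e.
have hy := head_neq hh; exists (block y par bh h); split=> //.
by rewrite (sb_components_blocks tree hy sc) imset_f.
Qed.

(** An edge of [F] has both ends in one component, so a crossing edge is new; any components around
    its two ends then serve as [C1] and [C2]. *)
Lemma crossing_eligible (E F : {set V * V}) e : treeable F ->
  strongly_connected [set: V] F -> e \in E -> crossing F e -> eligible E F e.
Proof.
move=> tF sc eE cr; split.
  rewrite inE eE andbT; apply/negP => eF.
  have [|C [CF a b]] := @edge_sb_component F e.1 e.2 tF sc.
    by rewrite /sym_edge -surjective_pairing eF.
  by have := cr C CF; rewrite a b.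
have [C1 C1F u1] := sb_component_exists e.1 tF sc.
have [C2 C2F w2] := sb_component_exists e.2 tF sc.
have := cr C1 C1F; have := cr C2 C2F; rewrite u1 w2 andbT /= => u2 w1.
exists C1, C2; split=> //; last by rewrite !inE (negbTE u2) (negbTE w1) andbF.
  by apply: contraNneq w1 => ->.
by rewrite u1.
Qed.

(** Two heads give a head [h] and a vertex [z], other than [par h], outside its subtree. As [E]
    stays connected without [par h], some edge of [E] leaves the subtree elsewhere; by
    [biconnected_cut] no component of [F] contains both of its ends. *)
Lemma crossing_exists (E F : {set V * V}) : treeable F -> F \subset E ->
  strongly_connected [set: V] F -> ~~ strongly_biconnected [set: V] F ->
  strongly_biconnected [set: V] E -> exists2 e, e \in E & crossing F e.
Proof.
move=> [par [num [bh tree]]] sFE sc nsb /strongly_biconnectedP[_ sbE].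
move: nsb; rewrite (sb_heads tree sc) -ltnNge => /card_gt1P[h1 [h2 []]].
rewrite !inE => hh1 hh2 ne12.
have [h [z [hh nzh nzp]]] : exists h z,
    [/\ is_head F y par num h, ~~ fconnect par z h & z != par h].
  (* The head numbered first is not below the other one. If it is the parent of the other, the root
     replaces it and differs from it, a head never being the root. *)
  wlog le : h1 h2 hh1 hh2 ne12 / num h1 <= num h2 => [W|].
    have /orP[|] := leq_total (num h1) (num h2); first exact: W.
    by apply: W => //; rewrite eq_sym.
  have n1 : ~~ fconnect par h1 h2.
    apply: contra ne12 => /(anc_num tree) le'; apply/eqP/(dfs_inj tree).
    by apply/eqP; rewrite eqn_leq le.
  have [E12|] := eqVneq h1 (par h2); last by exists h2, h1.
  exists h2, y; split=> //.
    by apply/negP => /(anc_head_neq tree hh2); rewrite eqxx.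
  by rewrite -E12 eq_sym (head_neq hh1).
have hp : h != par h.
  by apply: contraTneq (head_num tree hh) => <-; rewrite ltnn.
have c : connect (uedge ([set: V] :\ par h) E) h z.
  by apply: (uconnectedP _ _ (sbE (par h))); rewrite !inE ?nzp ?hp.
have [a [b [e ah nbh bp]]] : exists a b,
    [/\ sym_edge E a b, fconnect par a h, ~~ fconnect par b h & b != par h].
  case: (boolP [exists a, exists b, [&& sym_edge E a b, fconnect par a h,
            ~~ fconnect par b h & b != par h]]) => [|no].
    by case/existsP=> a /existsP[b /and4P[]]; exists a, b.
  case/negP: nzh; apply: (connect_inv (P := fun a => fconnect par a h)) c _ =>
    //.
  move=> a b; rewrite uedgeE !inE => /and3P[_ /andP[bp _] e] ah.
  apply: contraNT no => nb; apply/existsP; exists a; apply/existsP; exists b.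
  by rewrite e ah nb.
have vy := head_neq hh.
have no C : C \in sb_components F -> ~~ ((a \in C) && (b \in C)).
  rewrite inE => /maxsetP[/andP[_ bC] _]; apply/negP => /andP[aC bC'].
  by have := biconnected_cut tree bC hh aC ah bC' nbh => /eqP; apply/negP.
case/orP: e => e; [exists (a, b) => // | exists (b, a) => //] => C /no //=.
by rewrite andbC.
Qed.

(* Every component of [F] lies in one of [e |: F]; this map is onto because a
   component is a retract, and it identifies the components met by a walk of
   [F] from [e.1] to [e.2] inside the component containing [e]. *)
Lemma crossing_merges (F : {set V * V}) e v : v != y ->
  treeable F -> treeable (e |: F) -> strongly_connected [set: V] F ->
  crossing F e -> #|sb_components (e |: F)| < #|sb_components F|.
Proof.
set F' := e |: F => vy tF tF' sc cr; have sF : F \subset F' by apply: subsetUr.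
have sc' := strongly_connectedS sF sc.
(* The default [C] is a placeholder: by [fP] the choice succeeds on components of [F]. *)
pose f (C : {set V}) := odflt C [pick C' in sb_components F' | C \subset C'].
have fP C : C \in sb_components F -> (f C \in sb_components F')
  && (C \subset f C).
  rewrite inE => /maxsetP[/(strongly_biconnectedS sF)/andP[_ bC] _].
  have [C' C'F s] := sub_sb_component tF' sc' bC.
  by rewrite /f; case: pickP => //= /(_ C'); rewrite C'F s.
(* Loops are dropped because two blocks are identified by two distinct common vertices. Walks of [r]
   use only [F], not the new edge. *)
pose r := [rel a b | (a != b) && sym_edge F a b].
have cr_r a b : connect r a b.
  apply: connect_sub (strongly_connectedP _ _ sc a b (in_setT _) (in_setT _)).
  move=> x z /and3P[_ _ xz]; have [->//|ne] := eqVneq x z.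
  by apply: connect1; rewrite /= ne /sym_edge xz.
have [par [num [bh tree]]] := tF'.
have E' := sb_components_blocks tree vy sc'.
have ret C' a b : C' \in sb_components F' -> a \in C' -> b \in C' ->
    connect [rel x z | [&& x \in C', z \in C' & r x z]] a b.
  rewrite E' => /imsetP[h hh ->] aC bC; apply: (block_retract tree) => //.
  move=> x z /andP[_]; rewrite /sym_edge => /orP[|] /(subsetP sF) ->//.
  by rewrite orbT.
have uniq' C1 C2 a b : C1 \in sb_components F' -> C2 \in sb_components F' ->
    a != b -> a \in C1 -> b \in C1 -> a \in C2 -> b \in C2 -> C1 = C2.
  rewrite E' => /imsetP[h1 hh1 ->] /imsetP[h2 hh2 ->] ne a1 b1 a2 b2.
  by rewrite (block_inj tree hh1 hh2 ne).
have edgeC C' a b : C' \in sb_components F' ->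
    [&& a \in C', b \in C' & r a b] ->
    exists C, [/\ C \in sb_components F, f C = C', a \in C & b \in C].
  move=> C'F /and3P[aC bC /andP[ne ab]].
  have [C [CF aC1 bC1]] := edge_sb_component tF sc ab.
  have /andP[fC /subsetP s] := fP C CF.
  by exists C; split=> //; apply: uniq' ne _ _ aC bC => //; apply: s.
(* A block contains the distinct vertices [h] and [par h]; the retracted walk between them has an
   edge of [F], whose component is mapped to this block. *)
have sur : sb_components F' \subset f @: sb_components F.
  apply/subsetP => C' C'F; have := C'F; rewrite E' => /imsetP[h hh EC].
  have ne : h != par h.
    by apply: contraTneq (head_num tree hh) => <-; rewrite ltnn.
  have hC : h \in C' by rewrite EC (head_in_block tree).
  have pC : par h \in C' by rewrite EC par_in_block.
  have /connectP[[|z p] /=] := ret C' h (par h) C'F hC pC.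
    by move=> _ E; rewrite E eqxx in ne.
  case/andP=> /(edgeC _ _ _ C'F)[C [CF <- _ _]] _ _.
  by apply/imsetP; exists C.
apply: leq_ltn_trans (subset_leq_card sur) _.
rewrite ltn_neqAle leq_imset_card andbT; apply/negP => /imset_injP inj.
have [C' [C'F uC wC]] : exists C',
    [/\ C' \in sb_components F', e.1 \in C' & e.2 \in C'].
  apply: edge_sb_component => //.
  by rewrite /sym_edge -surjective_pairing !inE eqxx.
have ne : e.1 != e.2.
  have [C CF uC'] := sb_component_exists e.1 tF sc.
  by have := cr C CF; rewrite uC'; apply: contraNneq => <-.
(* If [f] were injective, all components met by the walk inside [C'] would coincide, and a single
   one would contain both ends of [e]. *)
pose P x := x = e.1 \/
  exists C, [/\ C \in sb_components F, f C = C', e.1 \in C & x \in C].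
have : P e.2.
  apply: (connect_inv (P := P)) (ret _ _ _ C'F uC wC) _; last by left.
  move=> x z /(edgeC _ _ _ C'F)[C [CF fC xC zC]].
  case=> [E|[C1 [C1F fC1 uC1 xC1]]]; right; first by exists C; rewrite -E.
  by have E : C = C1; [apply: inj; rewrite // fC | exists C;
    rewrite E in CF fC zC *].
case=> [E|[C [CF _ uC1 wC1]]]; first by rewrite E eqxx in ne.
by have := cr C CF; rewrite uC1 wC1.
Qed.

Lemma card_sb_components (F : {set V * V}) : treeable F ->
  strongly_connected [set: V] F -> #|sb_components F| <= #|V|.
Proof.
move=> [par [num [bh tree]]] sc.
case: (pickP (fun v => v != y)) => [v vy|Vy].
  rewrite (sb_components_blocks tree vy sc).
  by rewrite (leq_trans (leq_imset_card _ _)) // max_card.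
have Vy' v : v = y by apply/eqP; rewrite -[_ == _]negbK Vy.
have [_ ->] := sb_components_trivial F Vy'.
by rewrite cards1; apply/card_gt0P; exists y.
Qed.

End Merging.

(** * Depth-first search *)

Definition r_k := 7.
Definition r_i := 8.
Definition r_skip := 9.
Definition r_cur := 10.
Definition r_cnt := 11.
Definition r_v := 12.
Definition r_h := 13.
Definition r_w := 14.
Definition r_p := 15.
Definition r_sc := 16.
Definition r_nb := 17.

Definition a_head := 11.
Definition a_next := 12.
Definition a_tgt := 13.
Definition a_eid := 14.
Definition a_num := 15.
Definition a_par := 16.
Definition a_pe := 17.
Definition a_ord := 18.
Definition a_low := 19.
Definition a_bh := 20.
Definition a_id := 21.
Definition a_act := 22.
Definition a_cand := 23.

Definition insert (off : expr) (s d : nat) : cmd :=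
  (Put a_next (Add (Reg r_k) off) (Get a_head (Get s (Reg r_k))) ;;
   Put a_tgt (Add (Reg r_k) off) (Get d (Reg r_k)) ;;
   Put a_eid (Add (Reg r_k) off) (Reg r_k) ;;
   Put a_head (Get s (Reg r_k)) (Add (Add (Reg r_k) off) (Const 1)))%cmd.

Definition clear_vertices : cmd :=
  for_to r_k r_n
    (Put a_head (Reg r_k) (Const 0) ;;
     Put a_num (Reg r_k) (Const 0) ;;
     Put a_par (Reg r_k) (Const 0))%cmd.

(* Half-edge [k] traverses edge [k] forwards, half-edge [k + m] backwards; the
   half-edges leaving a vertex form a linked list, cells holding [k + 1] so that
   [0] ends the list. *)
Definition build (df dr : bool) : cmd :=
  for_to r_k r_m
    (If (Get a_act (Reg r_k))
       (If (Const df) (insert (Const 0) a_src a_dst) Skip ;;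
        If (Const dr) (insert (Reg r_m) a_dst a_src) Skip)
       Skip)%cmd.

(** The stack is the chain of parents, and [a_head] doubles as the iterator over the half-edges
    left. Vertices in [r_cur] and [a_par] are shifted by one, so that popping the root yields [0]
    and ends the loop. *)
Definition dfs_step : cmd :=
  (Assign r_v (Defs.Sub (Reg r_cur) (Const 1)) ;;
   Assign r_h (Get a_head (Reg r_v)) ;;
   If (Eq (Reg r_h) (Const 0))
     (Assign r_cur (Get a_par (Reg r_v)))
     (Assign r_h (Defs.Sub (Reg r_h) (Const 1)) ;;
      Put a_head (Reg r_v) (Get a_next (Reg r_h)) ;;
      Assign r_w (Get a_tgt (Reg r_h)) ;;
      If (Eq (Get a_num (Reg r_w)) (Const 0))
        (Put a_ord (Reg r_cnt) (Reg r_w) ;;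
         Assign r_cnt (Add (Reg r_cnt) (Const 1)) ;;
         Put a_num (Reg r_w) (Reg r_cnt) ;;
         Put a_par (Reg r_w) (Reg r_cur) ;;
         Put a_pe (Reg r_w) (Get a_eid (Reg r_h)) ;;
         Assign r_cur (Add (Reg r_w) (Const 1)))
        Skip))%cmd.

Definition dfs_init : cmd :=
  (Put a_num (Reg r_y) (Const 1) ;;
   Put a_ord (Const 0) (Reg r_y) ;;
   Assign r_cnt (Const 1) ;;
   Assign r_cur (Add (Reg r_y) (Const 1)))%cmd.

Definition search (df dr : bool) : cmd :=
  (clear_vertices ;; build df dr ;; dfs_init ;;
   While (Reg r_cur) dfs_step)%cmd.

Fixpoint chain (next : nat -> nat) (c : nat) (s : seq nat) : Prop :=
  if s is k :: s' then c = k.+1 /\ chain next (next k) s' else c = 0.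

Lemma eq_chain next next' c s :
  {in s, next =1 next'} -> chain next c s -> chain next' c s.
Proof.
elim: s c => //= k s IH c E [-> H]; split=> //; rewrite -E ?mem_head //.
by apply: IH H => x xs; apply: E; rewrite inE xs orbT.
Qed.

Lemma ordE n (u w : 'I_n) : (nat_of_ord u == nat_of_ord w) = (u == w).
Proof. by []. Qed.

Lemma ltn_ordS m i (lt_im : i < m) (j : 'I_m) :
  j < i.+1 -> j = Ordinal lt_im \/ j < i.
Proof.
rewrite ltnS leq_eqVlt => /orP[/eqP E|]; last by right.
by left; apply/val_inj.
Qed.

(** * Adjacency lists of the active graph *)

Section Search.

Variables (n m : nat) (es : m.-tuple ('I_n * 'I_n)) (y : 'I_n).
Variable F : {set 'I_n * 'I_n}.

(** The searched graph is the subset of the input edges selected by [a_act], so one program serves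
    [E], [E] without an edge, and the growing edge set. *)
Record env (st : store) : Prop := Env {
  env_n : reg st r_n = n;
  env_m : reg st r_m = m;
  env_y : reg st r_y = y :> nat;
  env_es : holds_edges es a_src a_dst st;
  env_F : forall e, e \in F -> exists j, tnth es j = e;
  env_act : forall j : 'I_m, (arr st a_act j != 0) = (tnth es j \in F) }.

Lemma env_agree rs ars st st' :
  agree rs ars st st' ->
  all (fun x => x \notin rs) [:: r_n; r_m; r_y] ->
  all (fun a => a \notin ars) [:: a_src; a_dst; a_act] ->
  env st -> env st'.
Proof.
move=> [rE aE] /= /and4P[r0 r1 r2 _] /and4P[a0 a1 a2 _] [H0 H1 H2 H3 H4 H5].
split=> //; rewrite ?rE //.
- by move=> i; rewrite !aE //; apply: H3.
- by move=> j; rewrite aE.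
Qed.

Section Direction.

Variables df dr : bool.

Definition dir_edge : rel 'I_n :=
  [rel v w | df && ((v, w) \in F) || dr && ((w, v) \in F)].

Definition half_edge (k : nat) (v w : 'I_n) (j : 'I_m) : Prop :=
  tnth es j \in F /\
  (df /\ k = j /\ tnth es j = (v, w) \/ dr /\ k = j + m /\ tnth es j = (w, v)).

(** The relation [P] is a parameter because only part of the half-edges are listed during
    construction; [N] bounds the total length, which feeds the variant of the search. *)
Definition adj (P : nat -> 'I_n -> 'I_n -> 'I_m -> Prop) (N : nat) (st : store)
    (L : 'I_n -> seq nat) : Prop :=
  [/\ forall v : 'I_n, chain (arr st a_next) (arr st a_head v) (L v),
      forall v k, k \in L v -> exists w j, P k v w j,
      forall k v w j, P k v w j ->
        [/\ k \in L v, arr st a_tgt k = w & arr st a_eid k = j]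
    & \sum_v size (L v) <= N].

Lemma adj_eq (P P' : nat -> 'I_n -> 'I_n -> 'I_m -> Prop) N N' st st' L :
  arr st' a_next =1 arr st a_next -> arr st' a_head =1 arr st a_head ->
  arr st' a_tgt =1 arr st a_tgt -> arr st' a_eid =1 arr st a_eid ->
  (forall k v w j, P' k v w j <-> P k v w j) -> N <= N' ->
  adj P N st L -> adj P' N' st' L.
Proof.
move=> E1 E2 E3 E4 PP leN [H1 H2 H3 H4]; split.
- by move=> v; rewrite E2; apply: eq_chain (H1 v) => k _.
- by move=> v k /H2[w [j /PP]]; exists w, j.
- by move=> k v w j /PP/H3; rewrite E3 E4.
- exact: leq_trans leN.
Qed.

Lemma insert_adj P N st L off s d (j : 'I_m) (v w : 'I_n) :
  reg st r_k = j -> arr st s j = v -> arr st d j = w ->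
  s \notin [:: a_next; a_tgt; a_eid] -> d \notin [:: a_next] ->
  (forall st', reg st' = reg st -> eval st' off = eval st off) ->
  adj P N st L -> (forall v' w' j', ~ P (j + eval st off) v' w' j') ->
  adj (fun k' v' w' j' => P k' v' w' j' \/
         [/\ k' = j + eval st off, v' = v, w' = w & j' = j]) N.+1
    (sem (insert off s d) st)
    (fun u => if u == v then (j + eval st off) :: L u else L u).
Proof.
move=> rk sv dw ns nd oE [H1 H2 H3 H4] fresh; set k := j + eval st off.
have Ks : (s == a_next) = false /\ (s == a_tgt) = false /\ (s == a_eid) = false.
  by move: ns; rewrite !inE !negb_or => /and3P[/negbTE-> /negbTE-> /negbTE->].
have Kd : (d == a_next) = false by move: nd; rewrite inE => /negbTE.
case: Ks => Ks1 [Ks2 Ks3].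
have nin (u : 'I_n) : k \notin L u by apply/negP => /H2[w' [j' /fresh]].
set st' := sem _ st.
have E1 x : arr st' a_next x = if x == k then arr st a_head v else arr st a_next x.
  by rewrite /st' /= rk sv.
have E2 (u : 'I_n) :
  arr st' a_head u = if u == v then k.+1 else arr st a_head u.
  by rewrite /st' /= !(oE (set_arr _ _ _ _)) // Ks1 Ks2 Ks3 /= rk sv addn1.
have E3 x : arr st' a_tgt x = if x == k then (w : nat) else arr st a_tgt x.
  by rewrite /st' /= !(oE (set_arr _ _ _ _)) // Kd /= rk dw.
have E4 x : arr st' a_eid x = if x == k then (j : nat) else arr st a_eid x.
  by rewrite /st' /= !(oE (set_arr _ _ _ _)) // rk.
have ch (u : 'I_n) : chain (arr st' a_next) (arr st a_head u) (L u).
  apply: eq_chain (H1 u) => x xL; rewrite E1; case: eqP => // xk.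
  by move: (nin u); rewrite -xk xL.
split.
- move=> u; rewrite E2; case: ifP => [/eqP ->|_]; last exact: ch.
  by split=> //; rewrite E1 eqxx; apply: ch.
- move=> u x; case: ifP => [/eqP ->|_].
    rewrite inE => /orP[/eqP ->|/H2[w' [j' ?]]]; first by exists w, j; right.
    by exists w', j'; left.
  by move/H2=> [w' [j' ?]]; exists w', j'; left.
- move=> x v' w' j' [Px|[-> -> -> ->]]; last first.
    by rewrite E3 E4 !eqxx mem_head.
  have [xL t e] := H3 _ _ _ _ Px; rewrite E3 E4.
  have /negbTE -> : x != k by apply: contraTneq xL => ->.
  by split=> //; case: ifP => // _; rewrite inE xL orbT.
- rewrite (bigD1 v) //= eqxx /= addSn ltnS; apply: leq_trans H4.
  rewrite [leqRHS](bigD1 v) //= leq_add2l; apply: leq_sum => u /negbTE -> //.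
Qed.

Lemma clear_spec X st (Q : store -> Prop) : n < X -> env st ->
  (forall st', env st' ->
     (forall v : 'I_n, [/\ arr st' a_head v = 0, arr st' a_num v = 0
                         & arr st' a_par v = 0]) -> Q st') ->
  runl X clear_vertices st Q.
Proof.
move=> nX en HQ; pose I i st1 := forall v : 'I_n, v < i ->
  [/\ arr st1 a_head v = 0, arr st1 a_num v = 0 & arr st1 a_par v = 0].
apply: (runl_for (I := I) (M := n)) => //; first exact: env_n.
- move=> i st1 lt_in _ rk Ii v; rewrite /= rk ltnS leq_eqVlt.
  by case: eqP => //= _ /Ii.
- move=> st1 ag In; apply: HQ => [|v]; last exact: In.
  exact: env_agree ag _ _ en.
Qed.

Lemma build_spec X st (Q : store -> Prop) : n < X -> m < X -> env st ->
  (forall v : 'I_n, [/\ arr st a_head v = 0, arr st a_num v = 0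
                      & arr st a_par v = 0]) ->
  (forall st' L, env st' ->
     (forall v : 'I_n, arr st' a_num v = 0 /\ arr st' a_par v = 0) ->
     adj half_edge (2 * m) st' L -> Q st') ->
  runl X (build df dr) st Q.
Proof.
move=> nX mX en cl HQ.
pose P i k v w (j : 'I_m) := half_edge k v w j /\ j < i.
pose I i st1 := exists L, adj (P i) (2 * i) st1 L.
apply: (runl_for (I := I) (M := m)) => //; first exact: env_m.
- exists (fun=> [::]); split=> //=; last by rewrite big1.
    by move=> v; case: (cl v).
  by move=> k v w j [].
- move=> i st1 lt_im ag rk [L adjL].
  have en1 : env st1 by apply: env_agree ag _ _ en.
  pose j := Ordinal lt_im; have [sj dj] := env_es en1 j.
  have rj : reg st1 r_k = j by [].
  have fresh k v w : P i k v w j -> False by case=> _; rewrite ltnn.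
  have lt_j (j' : 'I_m) : j' < i.+1 -> j' = j \/ j' < i :=
    @ltn_ordS _ _ lt_im j'.
  have skipP : tnth es j \notin F -> forall k v w j', P i.+1 k v w j' <->
    P i k v w j'.
    move=> nF k v w j'; split=> [[H /lt_j[E|]]|[H lt]]; last by split=> //; lia.
      by case: H; rewrite E (negbTE nF).
    by split.
  set st2 := set_reg _ _ _.
  have actE := env_act en1 j.
  case: (boolP (tnth es j \in F)) actE => jF actE; last first.
    have st2E : st2 = set_reg st1 r_k i.+1.
      by rewrite /st2 /= rk (negbFE actE).
    by exists L; rewrite st2E; apply: adj_eq adjL => //; [apply: skipP | lia].
  pose u := (tnth es j).1; pose w := (tnth es j).2.
  have tE : tnth es j = (u, w) by rewrite [LHS]surjective_pairing.
  pose sta := if df then sem (insert (Const 0) a_src a_dst) st1 else st1.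
  pose stb := if dr then sem (insert (Reg r_m) a_dst a_src) sta else sta.
  have st2E : st2 = set_reg stb r_k i.+1.
    by rewrite /st2 /stb /sta; cbn [sem eval]; rewrite rk actE; case: (df);
      case: (dr).
  pose Pa k v' w' j' := P i k v' w' j' \/
    df /\ [/\ k = j, v' = u, w' = w & j' = j].
  have [La adja] : exists La, adj Pa (2 * i).+1 sta La.
    rewrite /sta /Pa; case: (df); last first.
      exists L; apply: adj_eq adjL => // k v' w' j'.
      by split=> [[|[]]|] //; left.
    exists (fun u' => if u' == u then j + 0 :: L u' else L u').
    have := @insert_adj (P i) (2 * i) st1 L (Const 0)
      a_src a_dst j u w rj sj dj.
    move=> /(_ isT isT _ adjL) H; apply: adj_eq (H _ _) => //=.
      by move=> k v' w' j'; rewrite addn0; split=> [[|[_]]|[]]; auto.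
    move=> v' w' j'; rewrite addn0 => -[[_ H2] lt].
    by case: H2 => [[_ [E _]]|[_ [E _]]]; move: (ltn_ord j'); move: E lt;
      rewrite /=; lia.
  have rma : reg sta r_m = m by rewrite /sta; case: (df); apply: env_m en1.
  have rka : reg sta r_k = j by rewrite /sta; case: (df).
  have sja : arr sta a_src j = u by rewrite /sta; case: (df).
  have dja : arr sta a_dst j = w by rewrite /sta; case: (df).
  pose Pb k v' w' j' := Pa k v' w' j' \/
    dr /\ [/\ k = j + m, v' = w, w' = u & j' = j].
  have [Lb adjb] : exists Lb, adj Pb (2 * i).+2 stb Lb.
    rewrite /stb /Pb; case: (dr); last first.
      exists La; apply: adj_eq adja => // k v' w' j'.
      by split=> [[|[]]|] //; left.
    exists (fun u' => if u' == w then j + reg sta r_m :: La u' else La u').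
    have := @insert_adj Pa (2 * i).+1 sta La (Reg r_m)
      a_dst a_src j w u rka dja sja.
    have oE st' : reg st' = reg sta -> eval st' (Reg r_m) = eval sta (Reg r_m).
      by move=> /= ->.
    move=> /(_ isT isT oE adja) H; apply: adj_eq (H _) => //=.
      by move=> k v' w' j'; rewrite rma; split=> [[|[_]]|[]]; auto.
    move=> v' w' j'; rewrite rma => -[[[_ H2] lt]|[_ [E _ _ _]]].
      by case: H2 => [[_ [E _]]|[_ [E _]]]; move: (ltn_ord j'); move: E lt;
        rewrite /=; lia.
    by move: E (ltn_ord j) => /=; lia.
  exists Lb; rewrite st2E; apply: adj_eq adjb => //; last by lia.
  move=> k v' w' j'; rewrite /Pb /Pa; split.
    case=> H /lt_j[E|lt]; last by left; left; split.
    case: H => _; rewrite E tE => -[[? [-> [-> ->]]]|[? [-> [-> ->]]]].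
      by left; right.
    by right.
  case=> [[[H lt]|[? [-> -> -> ->]]]|[? [-> -> -> ->]]].
  + by split=> //; lia.
  + by split=> //; split=> //; left.
  + by split=> //; split=> //; right.
- move=> st1 ag [L adjL]; apply: (HQ st1 L).
  + exact: env_agree ag _ _ en.
  + by move=> v; rewrite !ag.2 //; case: (cl v).
  + apply: adj_eq adjL => // k v w j; split=> [H|[]//].
    by split.
Qed.

End Direction.
End Search.

(** * Invariant and outcome of the search loop *)

Section DepthFirstSearch.

Variables (n m : nat) (es : m.-tuple ('I_n * 'I_n)) (y : 'I_n).
Variables (F : {set 'I_n * 'I_n}) (df dr : bool).

Notation env := (env es y F).
Notation dir_edge := (dir_edge F df dr).
Notation half_edge := (half_edge es F df dr).
Notation visited st v := (arr st a_num v != 0).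

Lemma half_dir_edge k v w j : half_edge k v w j -> dir_edge v w.
Proof.
rewrite /half_edge /dir_edge /= => -[jF [[-> [_ E]]|[-> [_ E]]]];
  rewrite E in jF.
  by rewrite jF.
by rewrite jF orbT.
Qed.

Lemma dir_half_edge st v w : env st -> dir_edge v w -> exists k j,
  half_edge k v w j.
Proof.
move=> en /orP[] /andP[d vw]; have [j E] := env_F en vw.
  by exists j, j; split; rewrite ?E //; left.
by exists (j + m), j; split; rewrite ?E //; right.
Qed.

Lemma half_edge_tgt k v w j v' w' j' (t : nat -> nat) :
  (forall k v w j, half_edge k v w j -> t k = w) ->
  half_edge k v w j -> half_edge k v' w' j' -> w' = w.
Proof. by move=> tE /tE E /tE; rewrite E => /val_inj. Qed.

(* [A v] lists the ancestors of [v], which is the stack at the time [v] is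
   discovered; [L v] lists the half_edge-edges leaving [v] not yet traversed. *)
Record dfs_core (st : store) (A : 'I_n -> seq 'I_n) (L : 'I_n -> seq nat) :
    Prop := DfsCore {
  core_chain (v : 'I_n) : chain (arr st a_next) (arr st a_head v) (L v);
  core_half (v : 'I_n) k : k \in L v -> exists w j, half_edge k v w j;
  core_full k (v w : 'I_n) j : half_edge k v w j -> visited st w \/ k \in L v;
  core_node (v : 'I_n) : visited st v ->
    [/\ v = y, A v = [:: y] & arr st a_par v = 0] \/
    exists (p : 'I_n) (j : 'I_m) k, [/\ [/\ v != y,
      visited st p & arr st a_par v = p.+1],
      A v = v :: A p, arr st a_num p < arr st a_num v,
      arr st a_pe v = j & half_edge k p v j];
  core_root : visited st y;
  core_unvisited (v : 'I_n) : arr st a_num v = 0 -> arr st a_par v = 0;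
  core_anc (a b : 'I_n) : visited st a -> visited st b -> dir_edge a b ->
    dir_edge b a ->
    a \in A b \/ b \in A a;
  core_ord i : i < reg st r_cnt ->
    exists v : 'I_n, arr st a_ord i = v /\ arr st a_num v = i.+1;
  core_num (v : 'I_n) : visited st v ->
    exists i, [/\ i < reg st r_cnt,
      arr st a_ord i = v & arr st a_num v = i.+1] }.

(** The variant counts each remaining half-edge twice: traversing one frees two units and pushes at
    most one vertex, and a pop frees one. The last clause makes a popped vertex completely
    explored. *)
Definition dfs_stack (i : nat) (st : store) (A : 'I_n -> seq 'I_n)
    (L : 'I_n -> seq nat) : Prop :=
  exists s, [/\ i = 2 * (\sum_v size (L v)) + size s,
    (reg st r_cur = 0 /\ s = [::]) \/
      (exists v : 'I_n, [/\ reg st r_cur = v.+1, visited st v & s = A v])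
    & forall a : 'I_n, visited st a -> a \notin s -> L a = [::]].

Definition dfs_inv (i : nat) (st : store) : Prop :=
  exists A L, dfs_core st A L /\ dfs_stack i st A L.

Lemma dfs_step_inv i st : env st ->
  (forall k v w j, half_edge k v w j -> arr st a_tgt k = w /\
    arr st a_eid k = j) ->
  dfs_inv i st -> reg st r_cur != 0 ->
  exists2 i', i' < i & dfs_inv i' (sem dfs_step st).
Proof.
move=> en tgtE [A [L [core [s [-> + Ls]]]]] cur0.
case=> [[E _]|[v [cv vv sE]]]; first by rewrite E in cur0.
rewrite {}sE in Ls *.
have Av : v \in A v.
  by case: (core_node core vv) => [[-> -> _]|[p [j [k [_ -> _ _ _]]]]];
    rewrite mem_head.
have hv := core_chain core v.
(* An empty list at the top of the stack means a pop, to the parent or to the empty stack. *)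
case LE: (L v) hv => [|k l].
  move=> hv; have {}hv : arr st a_head v = 0 := hv.
  have stE : sem dfs_step st =
      set_reg (set_reg (set_reg st r_v v) r_h 0) r_cur (arr st a_par v).
    by rewrite /= cv subn1 /= hv.
  rewrite {}stE; have [[vy AE pv]|[p [j [k [[vy vp pv] AE lt _ _]]]]] :=
    core_node core vv.
    exists (2 * (\sum_u size (L u))); first by rewrite AE /=; lia.
    exists A, L; split; first by case: core.
    exists [::]; split; rewrite ?addn0 //; first by left; rewrite /= pv.
    move=> a /= va _; case: (eqVneq a v) => [->//|ne]; apply: Ls => //.
    by rewrite AE inE -vy.
  exists (2 * (\sum_u size (L u)) + size (A p)); first by rewrite AE /=; lia.
  exists A, L; split; first by case: core.
  exists (A p); split=> //; first by right; exists p; rewrite /= pv.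
  move=> a /= va na; case: (eqVneq a v) => [->//|ne]; apply: Ls => //.
  by rewrite AE inE negb_or ne.
case=> hv chl; have kL : k \in L v by rewrite LE mem_head.
have [w [j hk]] := core_half core kL; have [tk ek] := tgtE _ _ _ _ hk.
pose L' (u : 'I_n) := if u == v then l else L u.
have szL : \sum_u size (L u) = (\sum_u size (L' u)).+1.
  rewrite (bigD1 v) //= LE /= addSn [in RHS](bigD1 v) //= /L' eqxx; congr _.+1.
  by congr (_ + _); apply: eq_bigr => u /negbTE ->.
have L'L (u : 'I_n) k' : k' \in L' u -> k' \in L u.
  by rewrite /L'; case: eqP => // ->; rewrite LE inE => ->; rewrite orbT.
have LL' (u : 'I_n) k' w' j' : half_edge k' u w' j' -> k' \in L u ->
  k' \in L' u \/ w' = w.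
  rewrite /L'; case: eqP => [->|]; last by left.
  rewrite LE inE => H /orP[/eqP E|]; last by left.
  right; apply: (@half_edge_tgt k v w j v w' j' (arr st a_tgt)) => //.
    by move=> ? ? ? ? /tgtE[].
  by rewrite -E.
have Ls' (a : 'I_n) : visited st a -> a \notin A v -> L' a = [::].
  by move=> va na; rewrite /L' ifN ?Ls //; apply: contraNneq na => ->.
(* If [w] is already numbered, only the half-edge disappears. *)
have [nw|vw] := eqVneq (arr st a_num w) 0; last first.
  set st' := sem _ _.
  have stE : st' = set_reg (set_arr (set_reg (set_reg (set_reg st r_v v)
    r_h k.+1)
      r_h k) a_head v (arr st a_next k)) r_w w.
    by rewrite /st' /= cv subn1 /= hv /= subn1 /= tk (negbTE vw).
  exists (2 * (\sum_u size (L' u)) + size (A v)); first by rewrite szL; lia.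
  exists A, L'; split; last first.
    by exists (A v); split; [| right; exists v; rewrite stE /= | rewrite stE].
  case: core => c1 c2 c3 c4 c5 c6 c7 c8 c9; rewrite stE; split=> //=.
  - move=> u; rewrite ordE /L'; case: eqP => // _; exact: c1.
  - by move=> u k' /L'L /c2.
  - move=> k' u w' j' H; have [|/(LL' _ _ _ _ H)[|->]] := c3 _ _ _ _ H; by auto.
set st' := sem _ _; set c := reg st r_cnt.
have st'E : st' = set_reg (set_arr (set_arr (set_arr (set_reg (set_arr
    (set_reg (set_arr (set_reg (set_reg (set_reg st r_v v) r_h k.+1) r_h k)
    a_head v (arr st a_next k)) r_w w) a_ord c w) r_cnt c.+1) a_num w c.+1)
    a_par w v.+1) a_pe w j) r_cur w.+1.
  by rewrite /st' /= cv subn1 /= hv /= subn1 /= tk nw /= addn1 ek addn1.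
have wv : w != v by apply: contraTneq vv => <-; rewrite nw.
have E1 (u : 'I_n) :
  arr st' a_head u = if u == v then arr st a_next k else arr st a_head u.
  by rewrite st'E.
have E2 (u : 'I_n) : arr st' a_num u = if u == w then c.+1 else arr st a_num u.
  by rewrite st'E.
have E3 (u : 'I_n) : arr st' a_par u = if u == w then v.+1 else arr st a_par u.
  by rewrite st'E.
have E4 (u : 'I_n) : arr st' a_pe u = if u == w then j : nat else arr st a_pe u.
  by rewrite st'E.
have E5 x : arr st' a_ord x = if x == c then w : nat else arr st a_ord x.
  by rewrite st'E.
have E6 : arr st' a_next = arr st a_next by rewrite st'E.
have [E7 E8] : reg st' r_cnt = c.+1 /\ reg st' r_cur = w.+1 by rewrite st'E.
have {st'E} vis' (u : 'I_n) : visited st' u = (u == w) || visited st u.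
  by rewrite E2; case: (u == w).
have vis_ne (u : 'I_n) : visited st u -> u != w.
  by apply: contraNneq => ->; rewrite nw.
pose A' (u : 'I_n) := if u == w then w :: A v else A u.
have A'E (u : 'I_n) : visited st u -> A' u = A u.
  by move=> /vis_ne/negbTE; rewrite /A' => ->.
(* A visited vertex with an edge to the still unvisited [w] has an untraversed half-edge, hence is
   on the stack and becomes an ancestor of [w]. This is why no undirected edge joins incomparable
   vertices. *)
have nLw (a : 'I_n) : visited st a -> dir_edge a w -> a \in A v.
  move=> va aw; apply: contraTT (va) => na; have La := Ls _ va na.
  have [k' [j' H]] := dir_half_edge en aw.
  by have := core_full core H; rewrite nw La eqxx => -[].
exists (2 * (\sum_u size (L' u)) + (size (A v)).+1); first by rewrite szL; lia.
exists A', L'; split; last first.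
  exists (A' w); split; first by rewrite /A' eqxx.
    by right; exists w; rewrite E8 vis' eqxx.
  move=> a; rewrite vis' /A' eqxx inE negb_or => /orP[->//|va] /andP[_].
  exact: Ls'.
case: core => c1 c2 c3 c4 c5 c6 c7 c8 c9; split.
- move=> u; rewrite E1 E6 /L'; case: eqP => // _; exact: c1.
- by move=> u k' /L'L /c2.
- move=> k' u w' j' H; rewrite vis'.
  have [->|/(LL' _ _ _ _ H)[|->]] := c3 _ _ _ _ H; first by rewrite orbT; left.
    by right.
  by rewrite eqxx; left.
- move=> u; rewrite vis'; case: (eqVneq u w) => [-> _|ne /= vu].
    right; exists v, j, k;
      rewrite vis' vv orbT E3 E4 !E2 eqxx /A' eqxx (eq_sym v).
    rewrite (negbTE wv); split=> //.
      by split=> //; apply: contraTneq c5 => <-; rewrite nw.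
    by have [x [lt _ ->]] := c9 v vv.
  rewrite E2 E3 E4 A'E // (negbTE ne).
  have [|[p [j' [k' [[H1 H2 H3] H4 H5 H6 H7]]]]] := c4 u vu; first by left.
  right; exists p, j', k'; rewrite vis' H2 orbT E2 (negbTE (vis_ne _ H2))
    A'E //.
- by rewrite vis' c5 orbT.
- by move=> u; rewrite E2 E3; case: eqP => // _; apply: c6.
- move=> a b; rewrite !vis'.
  case: (eqVneq a w) => [-> _|na /= va]; case: (eqVneq b w) => [->|nb /= vb].
  + by move=> _ _ _; left; rewrite /A' eqxx mem_head.
  + move=> _ bw; right; rewrite /A' eqxx inE nLw ?orbT //.
  + move=> _ aw _; left; rewrite /A' eqxx inE nLw ?orbT //.
  + by rewrite !A'E //; apply: c7.
- move=> x; rewrite E7 E5 ltnS leq_eqVlt; case: eqP => [->|_] /= lt.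
    by exists w; rewrite E2 eqxx.
  have [u [Eo En]] := c8 x lt; exists u; split=> //.
  by rewrite E2 ifN // vis_ne // En.
- move=> u; rewrite vis'; case: (eqVneq u w) => [->|ne /= vu].
    by exists c; rewrite E7 E5 E2 !eqxx.
  have [x [lt Eo En]] := c9 u vu; exists x; rewrite E7 E5 E2 (negbTE ne)
    En ltnS.
  by rewrite (ltnW lt) ifN // neq_ltn lt.
Qed.

(** Directed searches have cross edges, so [st_anc] concerns edges traversable both ways; with [df]
    and [dr] both true these are all edges. *)
Record search_tree (st : store) (par : 'I_n -> 'I_n) : Prop := SearchTree {
  st_vis (v : 'I_n) : visited st v = connect dir_edge y v;
  st_cnt : (reg st r_cnt == n) = [forall v, connect dir_edge y v];
  st_le : reg st r_cnt <= n;
  st_ord i : i < reg st r_cnt ->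
    exists v : 'I_n, arr st a_ord i = v /\ arr st a_num v = i.+1;
  st_num (v : 'I_n) : connect dir_edge y v ->
    exists i, [/\ i < reg st r_cnt, arr st a_ord i = v & arr st a_num v = i.+1];
  st_root : par y = y;
  st_par (v : 'I_n) : arr st a_par v =
    if (v != y) && connect dir_edge y v then (par v).+1 else 0;
  st_node (v : 'I_n) : v != y -> connect dir_edge y v ->
    [/\ connect dir_edge y (par v), arr st a_num (par v) < arr st a_num v
      & exists (j : 'I_m) k, arr st a_pe v = j /\ half_edge k (par v) v j];
  st_anc a b : connect dir_edge y a -> connect dir_edge y b -> dir_edge a b ->
    dir_edge b a ->
    fconnect par a b || fconnect par b a }.

Lemma core_search_tree st A L : env st -> dfs_core st A L ->
  (forall a : 'I_n, visited st a -> L a = [::]) -> exists par,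
    search_tree st par.
Proof.
move=> en core Lnil.
(* The root and the unvisited vertices, whose cell is [0], become fixed points; for [p.+1] the
   default of [insubd] never shows. *)
pose par (v : 'I_n) := if arr st a_par v is p.+1 then insubd v p else v.
have num_ind (P : 'I_n -> Prop) : (forall v : 'I_n, (forall w : 'I_n,
    arr st a_num w < arr st a_num v -> P w) -> P v) -> forall v, P v.
  move=> H v; have [k] := ubnP (arr st a_num v); elim: k => // k IH in v *.
  by rewrite ltnS => le; apply: H => w lt; apply: IH; apply: leq_trans le.
have parE (v p : 'I_n) : arr st a_par v = p.+1 -> par v = p.
  by rewrite /par => ->; rewrite -[X in insubd _ X]/(val p) valKd.
have vis (v : 'I_n) : visited st v = connect dir_edge y v.
  apply/idP/idP.
    elim/num_ind: v => v IH vv.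
    have [[-> _ _]|[p [j [k [[_ vp _] _ lt _ /half_dir_edge pv]]]]] :=
      core_node core vv.
      exact: connect0.
    exact: connect_trans (IH p lt vp) (connect1 pv).
  move=> c; apply: (connect_inv (P := fun v : 'I_n => visited st v))
    c (core_root core).
  move=> a b ab va; have [k [j H]] := dir_half_edge en ab.
  by have [//|] := core_full core H; rewrite Lnil.
have anc (a b : 'I_n) : visited st b -> a \in A b -> fconnect par b a.
  elim/num_ind: b => b IH vb.
  have [[-> -> _]|[p [j [k [[_ vp pE] -> lt _ _]]]]] := core_node core vb.
    by rewrite inE => /eqP ->; apply: connect0.
  rewrite inE => /orP[/eqP ->|ap]; first exact: connect0.
  apply: connect_trans (IH p lt vp ap).
  by rewrite -(parE b p pE); apply: fconnect1.
(* Numbers [1] to [r_cnt] are in bijection with the visited vertices, so comparing [r_cnt] with [n]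
   tests reachability of all vertices. *)
have cntE : #|[set v : 'I_n | visited st v]| = reg st r_cnt.
  have ordP (i : 'I_(reg st r_cnt)) : exists v : 'I_n, arr st a_num v == i.+1.
    by have [v [_ E]] := core_ord core (ltn_ord i); exists v; rewrite E.
  pose f i := xchoose (ordP i).
  have fE i : arr st a_num (f i) = i.+1 by apply/eqP; exact:
    (xchooseP (ordP i)).
  rewrite -[RHS]card_ord -cardsT -(card_imset (f := f) [set:
    'I_(reg st r_cnt)]); last first.
    by move=> i i' E; apply/val_inj/eqP; rewrite -eqSS /= -!fE E.
  apply: eq_card => v; rewrite inE; apply/idP/imsetP => [vv|[i _ ->]];
    last by rewrite fE.
  have [i [lt Eo En]] := core_num core vv; exists (Ordinal lt) => //.
  have [k [_ Eo' En']] : exists k, [/\ k < reg st r_cnt,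
    arr st a_ord k = f (Ordinal lt)
      & arr st a_num (f (Ordinal lt)) = k.+1].
    by apply: (core_num core); rewrite fE.
  by apply/val_inj; rewrite /= -Eo -Eo'; move: En'; rewrite fE => -[<-].
exists par; split=> //.
- rewrite -cntE; apply/eqP/forallP => [E v|H].
    have /eqP : [set v : 'I_n | visited st v] == setT.
      by rewrite eqEcard subsetT cardsT card_ord E leqnn.
    by move/setP/(_ v); rewrite !inE vis.
  rewrite -[RHS]card_ord -cardsT; congr #|pred_of_set _|.
  by apply/setP => v; rewrite !inE vis H.
- by rewrite -cntE -[leqRHS]card_ord max_card.
- exact: core_ord core.
- by move=> v; rewrite -vis; apply: (core_num core).
- rewrite /par; have [[_ _ ->]|[p [j [k [[]]]]]] :=
  core_node core (core_root core) => //.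
  by rewrite eqxx.
- move=> v; rewrite -vis; case: (boolP (visited st v)) => vv; last first.
    by rewrite andbF (core_unvisited core) //; apply/eqP;
      rewrite -[_ == _]negbK.
  have [[-> _ ->]|[p [j [k [[-> vp pE] _ _ _ _]]]]] := core_node core vv.
    by rewrite eqxx.
  by rewrite (parE v p pE) pE.
- move=> v vy; rewrite -!vis => vv.
  have [[E _ _]|[p [j [k [[_ vp pE] _ lt pe H]]]]] := core_node core vv.
    by rewrite E eqxx in vy.
  by rewrite (parE v p pE); split=> //; exists j, k.
- move=> a b; rewrite -!vis => va vb ab ba.
  have [ab'|ba'] := core_anc core va vb ab ba; first by rewrite (anc a b)
    // orbT.
  by rewrite (anc b a).
Qed.

(** The lists hold at most [2 * m] half-edges and the stack starts with the root: the initial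
    variant is at most [4 * m + 1]. *)
Lemma search_spec X st (Q : store -> Prop) : n < X -> 4 * m + 1 < X ->
  env st -> (forall st' par, env st' -> search_tree st' par -> Q st') ->
  runl X (search df dr) st Q.
Proof.
move=> nX mX en HQ; have mX' : m < X by lia.
apply: runl_seq; apply: clear_spec en _ => // st1 en1 cl.
apply: runl_seq; apply: build_spec en1 cl _ => // st2 L en2 cl2 [H1 H2 H3 H4].
apply: runl_seq; apply: runl_sem => //; first by lia.
set st3 := sem _ _.
have en3 : env st3.
  apply: (env_agree (rs := [:: r_cnt; r_cur]) (ars := [:: a_num; a_ord]))
    en2 => //.
  split=> [x|a] /=; rewrite !inE negb_or => /andP[/negbTE-> /negbTE->] //.
have ryE := env_y en2.
have numE (v : 'I_n) : arr st3 a_num v = (v == y).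
  rewrite /= ryE ordE; case: eqP => // _; by case: (cl2 v).
have half3 k v w j : half_edge k v w j -> arr st3 a_tgt k = w /\
  arr st3 a_eid k = j.
  by case/H3.
apply: (@runl_while _ _ _ dfs_inv (2 * (\sum_v size (L v)) + 1)).
- exists (fun v => [:: y]), L; split; last first.
    exists [:: y]; split=> //; first by right; exists y;
      rewrite numE eqxx /= ryE addn1.
    by move=> a; rewrite numE inE; case: (a == y).
  split=> //.
  + by move=> k v w j /H3[? _ _]; right.
  + move=> v; rewrite numE; case: (eqVneq v y) => // -> _; left; split=> //=.
    by case: (cl2 y).
  + by rewrite numE eqxx.
  + by move=> v _ /=; case: (cl2 v).
  + move=> a b; rewrite !numE; case: (eqVneq a y) => // ->.
    by case: (eqVneq b y) => // ->; left; rewrite mem_head.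
  + by case=> // _; exists y; rewrite numE eqxx /= ryE.
  + move=> v; rewrite numE; case: (eqVneq v y) => // -> _; exists 0; split=>
    //=.
- lia.
- move=> i st4 inv ag cur; apply: runs_sem => //; apply: dfs_step_inv inv cur.
    exact: env_agree ag _ _ en3.
  by move=> k v w j /half3[E E']; rewrite !ag.2.
- move=> i st4 [A [L' [core [s [_ + Ls]]]]] ag /= cur0.
  case=> [[_ s0]|[v []]]; last by rewrite cur0.
  have en4 := env_agree ag isT isT en3.
  have [par tree] : exists par, search_tree st4 par.
    by apply: core_search_tree en4 core _ => a va; apply: Ls; rewrite // s0.
  exact: HQ en4 tree.
Qed.

End DepthFirstSearch.

(** * Low points *)

Definition strong_test : cmd :=
  (search true false ;;
   Assign r_sc (Eq (Reg r_cnt) (Reg r_n)) ;;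
   search false true ;;
   If (Eq (Reg r_cnt) (Reg r_n)) Skip (Assign r_sc (Const 0)))%cmd.

Definition lower (x z : nat) : cmd :=
  If (Lt (Get a_num (Get z (Reg r_k))) (Get a_low (Get x (Reg r_k))))
    (Put a_low (Get x (Reg r_k)) (Get a_num (Get z (Reg r_k)))) Skip.

(** Reading [a_ord] backwards treats children before parents, so a low point is complete when it is
    passed upwards. *)
Definition low_points : cmd :=
  (for_to r_k r_n (Put a_low (Reg r_k) (Get a_num (Reg r_k))) ;;
   for_to r_k r_m
     (If (Get a_act (Reg r_k)) (lower a_src a_dst ;; lower a_dst a_src) Skip) ;;
   for_to r_k r_n
     (Assign r_v (Get a_ord (Defs.Sub (Defs.Sub (Reg r_n) (Const 1))
       (Reg r_k))) ;;
      If (Get a_par (Reg r_v))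
        (Assign r_p (Defs.Sub (Get a_par (Reg r_v)) (Const 1)) ;;
         If (Lt (Get a_low (Reg r_v)) (Get a_low (Reg r_p)))
           (Put a_low (Reg r_p) (Get a_low (Reg r_v))) Skip)
        Skip))%cmd.

(** In order of discovery the cell [a_bh] of a parent is ready before its children need it. Heads
    receive consecutive numbers, which later number the components. *)
Definition find_heads : cmd :=
  (Assign r_nb (Const 0) ;;
   for_to r_k r_n
     (Assign r_v (Get a_ord (Reg r_k)) ;;
      If (Get a_par (Reg r_v))
        (Assign r_p (Defs.Sub (Get a_par (Reg r_v)) (Const 1)) ;;
         If (Lt (Get a_low (Reg r_v)) (Get a_num (Reg r_p)))
           (Put a_bh (Reg r_v) (Get a_bh (Reg r_p)))
           (Put a_bh (Reg r_v) (Reg r_v) ;;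
            Put a_id (Reg r_v) (Reg r_nb) ;;
            Assign r_nb (Add (Reg r_nb) (Const 1))))
        Skip))%cmd.

Definition find_blocks : cmd :=
  (search true true ;; low_points ;; find_heads)%cmd.

Section BlockSearch.

Variables (n m : nat) (es : m.-tuple ('I_n * 'I_n)) (y : 'I_n).
Variables (F : {set 'I_n * 'I_n}).

Notation env := (env es y F).

Lemma strongly_connected_root : strongly_connected [set: 'I_n] F =
  [forall v, connect (dir_edge F true false) y v] &&
  [forall v, connect (dir_edge F false true) y v].
Proof.
have E1 : dedge [set: 'I_n] F =2 dir_edge F true false.
  by move=> a b; rewrite /dedge /dir_edge /= !inE orbF.
have E2 : dir_edge F false true =2 [rel a b | dedge [set: 'I_n] F b a].
  by move=> a b; rewrite /dedge /dir_edge /= !inE.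
have E3 v : connect (dir_edge F false true) y v = connect (dedge [set:
  'I_n] F) v y.
  by rewrite (eq_connect E2) connect_rev.
apply/strongly_connectedP/andP => [sc|[/forallP H1 /forallP H2] a b _ _].
  by split; apply/forallP => v; rewrite ?E3 -?(eq_connect E1) sc ?inE.
have := H2 a; rewrite E3 => c; apply: connect_trans c _.
by rewrite (eq_connect E1).
Qed.

Lemma strong_test_spec X st (Q : store -> Prop) : n < X -> 4 * m + 1 < X ->
  env st -> (forall st', env st' ->
    (reg st' r_sc != 0) = strongly_connected [set: 'I_n] F -> Q st') ->
  runl X strong_test st Q.
Proof.
move=> nX mX en HQ.
apply: runl_seq; apply: search_spec en _ => // st1 par1 en1 tree1.
apply: runl_seq; apply: runl_sem => //; first by lia.
set st2 := sem _ _.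
have en2 : env st2 by case: en1.
have sc2 : (reg st2 r_sc != 0) = [forall v, connect (dir_edge F true false)
  y v].
  by rewrite -(st_cnt tree1) /= (env_n en1) eqb0 negbK.
apply: runl_seq.
pose P st' := env st' /\ exists par, search_tree es y F false true st' par.
have run2 : runl X (search false true) st2 P.
  apply: search_spec en2 _ => // st3 par3 en3 tree3.
  by split=> //; exists par3.
apply: runs_weaken (runs_agree run2) _ _ => // st3 [ag [en3 [par3 tree3]]].
have sc3 : reg st3 r_sc = reg st2 r_sc by rewrite ag.1.
apply: runl_sem => //; first by lia.
apply: HQ; first by rewrite /=; case: ifP; case: en3.
rewrite strongly_connected_root -sc2 -(st_cnt tree3) -sc3 /= (env_n en3).
by case: (_ == n) => /=; rewrite ?andbT ?andbF.
Qed.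

Record blocks_found (st : store) (par : 'I_n -> 'I_n) (num : 'I_n -> nat)
    (bh : 'I_n -> 'I_n) (hs : seq 'I_n) : Prop := BlocksFound {
  bf_tree : dfs_tree F y par num bh;
  bf_par (v : 'I_n) : arr st a_par v = if v != y then (par v).+1 else 0;
  bf_bh (v : 'I_n) : v != y -> arr st a_bh v = bh v;
  bf_uniq : uniq hs;
  bf_heads h : (h \in hs) = is_head F y par num h;
  bf_size : reg st r_nb = size hs;
  bf_id (h : 'I_n) : h \in hs -> arr st a_id h = index h hs }.

Section LowPoints.

Variables (st0 : store) (par : 'I_n -> 'I_n).
Hypotheses (en0 : env st0) (tree : search_tree es y F true true st0 par).
Hypothesis conn : forall v, connect (sym_edge F) y v.

Let num (v : 'I_n) : nat := arr st0 a_num v.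
Notation head := (is_head F y par num).

Definition same_tree (st : store) : Prop :=
  [/\ env st, arr st a_num =1 arr st0 a_num, arr st a_par =1 arr st0 a_par
    & arr st a_ord =1 arr st0 a_ord].

Lemma same_tree_agree rs ars st st' : agree rs ars st st' ->
  all (fun x => x \notin rs) [:: r_n; r_m; r_y] ->
  all (fun a => a \notin ars) [:: a_src; a_dst; a_act] ->
  all (fun a => a \notin ars) [:: a_num; a_par; a_ord] ->
  same_tree st -> same_tree st'.
Proof.
move=> ag H1 H2 /= /and4P[n1 n2 n3 _] [en E1 E2 E3].
split; first exact: env_agree ag H1 H2 en.
all: by move=> x; rewrite ag.2.
Qed.

Let connE v : connect (dir_edge F true true) y v = true.
Proof. exact: conn. Qed.

Let cntE : reg st0 r_cnt = n.
Proof. by apply/eqP; rewrite (st_cnt tree); apply/forallP. Qed.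

Let ordP i : i < n -> exists v : 'I_n, arr st0 a_ord i = v /\ num v = i.+1.
Proof. by rewrite -{1}cntE; apply: (st_ord tree). Qed.

Let numP (v : 'I_n) : exists i, [/\ i < n, arr st0 a_ord i = v & num v = i.+1].
Proof. by rewrite -{1}cntE; apply: (st_num tree); rewrite connE. Qed.

Let numI : injective num.
Proof.
move=> v w; have [i [_ Ev ->]] := numP v; have [j [_ Ew ->]] := numP w => -[E].
by apply/val_inj; rewrite /= -Ev -Ew E.
Qed.

Let parE (v : 'I_n) : arr st0 a_par v = if v != y then (par v).+1 else 0.
Proof. by rewrite (st_par tree) connE andbT. Qed.

Let num_par v : v != y -> num (par v) < num v.
Proof. by move=> vy; case: (st_node tree vy (connE v)). Qed.

Let par_edge v : v != y -> sym_edge F (par v) v.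
Proof.
move=> vy; case: (st_node tree vy (connE v)) => _ _ [j [k [_]]].
exact: half_dir_edge.
Qed.

Let num_root v : num y <= num v.
Proof.
have [k] := ubnP (num v); elim: k => // k IH in v *; rewrite ltnS => le.
have [->//|vy] := eqVneq v y; have lt := num_par vy.
exact: leq_trans (IH _ (leq_trans lt le)) (ltnW lt).
Qed.

Lemma dfs_tree_of_search bh :
  (forall v, v != y -> bh v = if head v then v else bh (par v)) ->
  dfs_tree F y par num bh.
Proof.
move=> bhP; split=> //; first exact: (st_root tree).
move=> a b ab; have ba : sym_edge F b a by rewrite sym_edgeC.
exact: (st_anc tree (connE a) (connE b) ab ba).
Qed.

Definition low_attained (st : store) : Prop := forall v : 'I_n, exists x z,
  [/\ fconnect par x v, x = z \/ sym_edge F x z & arr st a_low v = num z].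

Definition low_edges (st : store) : Prop := forall v z : 'I_n,
  sym_edge F v z -> arr st a_low v <= num z.

(** Low points are characterised without a minimum: each value is attained at a vertex of the
    subtree or a neighbour of it, bounds the edges at the vertex, and finally does not decrease from
    parent to child. *)
Lemma low_points_spec X (Q : store -> Prop) : n < X -> m < X ->
  (forall st, same_tree st ->
     (forall v : 'I_n, v != y -> (num (par v) <= arr st a_low v) = head v) ->
     Q st) ->
  runl X low_points st0 Q.
Proof.
move=> nX mX HQ; have same0 : same_tree st0 by [].
apply: runl_seq.
pose I1 i st := forall v : 'I_n, v < i -> arr st a_low v = num v.
apply: (runl_for (I := I1) (M := n)) => //.
- exact: env_n en0.
- move=> i st lt_in ag rk Ii v; rewrite /= rk ltnS leq_eqVlt.
  by case: eqP => [<-|_ /= /Ii//] _; rewrite ag.2.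
move=> st1 ag1 I1n; have same1 : same_tree st1 by apply:
  same_tree_agree ag1 _ _ _ same0.
have low1 (v : 'I_n) : arr st1 a_low v = num v by apply: I1n.
apply: runl_seq.
pose I2 i st := (forall v : 'I_n, exists2 z, v = z \/ sym_edge F v z &
    arr st a_low v = num z) /\
  (forall j : 'I_m, j < i -> tnth es j \in F ->
    arr st a_low (tnth es j).1 <= num (tnth es j).2 /\
    arr st a_low (tnth es j).2 <= num (tnth es j).1).
have [en1 _ _ _] := same1.
apply: (runl_for (I := I2) (M := m)) => //.
- exact: env_m en1.
- by split=> // v; exists v; [left | rewrite /= low1].
- move=> i st lt_im ag rk [att bnd]; pose j := Ordinal lt_im.
  have [en E1 _ _] : same_tree st by apply: same_tree_agree ag _ _ _ same1.
  have [sj dj] := env_es en j; have rj : reg st r_k = j by [].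
  have lt_j (j' : 'I_m) : j' < i.+1 -> j' = j \/ j' < i :=
    @ltn_ordS _ _ lt_im j'.
  have actE := env_act en j.
  case: (boolP (tnth es j \in F)) actE => jF actE; last first.
    rewrite /= rj (negbFE actE) /=; split=> // j' /lt_j[->|]; last exact: bnd.
    by rewrite (negbTE jF).
  set u := (tnth es j).1 in sj *; set w := (tnth es j).2 in dj *.
  have uw : sym_edge F u w by rewrite /sym_edge -surjective_pairing jF.
  have lowE s x z (a b : 'I_n) : reg s r_k = j -> arr s x j = a ->
      arr s z j = b -> arr s a_num =1 arr st0 a_num -> forall v : 'I_n,
      arr (sem (lower x z) s) a_low v =
      if (v == a) && (num b < arr s a_low a) then num b else arr s a_low v.
    move=> rs xa zb nE v; rewrite /= rs xa zb nE -/(num b).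
    by case: ltnP => _ /=; rewrite ?andbT ?andbF ?rs ?xa ?zb ?nE ?ordE.
  pose sa := sem (lower a_src a_dst) st.
  have [aga aga'] : agree (wregs (lower a_src a_dst))
    (warrs (lower a_src a_dst)) st sa.
    exact: sem_agree.
  pose st' := sem (lower a_dst a_src) sa.
  have st'E (v : 'I_n) : arr st' a_low v = if (v == w)
    && (num u < arr sa a_low w)
      then num u else arr sa a_low v.
    by apply: lowE; rewrite ?aga ?aga' // => x; rewrite aga' // E1.
  have saE (v : 'I_n) : arr sa a_low v = if (v == u) && (num w < arr st a_low u)
      then num w else arr st a_low v.
    exact: lowE.
  have -> : sem (If (Get a_act (Reg r_k))
      (lower a_src a_dst ;; lower a_dst a_src)%cmd Skip) st = st'.
    by rewrite /st' /sa; cbn [sem eval]; rewrite rj actE.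
  have le_st (v : 'I_n) : arr st' a_low v <= arr st a_low v.
    rewrite st'E; have le_sa : arr sa a_low v <= arr st a_low v.
      by rewrite saE; case: andP => // -[/eqP -> /ltnW].
    by case: andP => // -[/eqP Ev /ltnW]; rewrite -Ev => /leq_trans; apply.
  split.
    move=> v /=; rewrite st'E.
    have W : exists2 z, v = z \/ sym_edge F v z & arr sa a_low v = num z.
      rewrite saE; case: andP => [[/eqP -> _]|_]; last exact: att.
      by exists w => //; right.
    case: andP => [[/eqP -> _]|//]; exists u => //; right; by rewrite sym_edgeC.
  move=> j' /lt_j[-> _|lt j'F]; last first.
    have [l1 l2] := bnd j' lt j'F.
    by split; apply: leq_trans (le_st _) _.
  rewrite -/u -/w /=; split.
    rewrite st'E; case: andP => [[/eqP -> _]|_]; first by [].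
    by rewrite saE eqxx /=; case: ltnP.
  by rewrite st'E eqxx /=; case: ltnP.
move=> st2 ag2 [att2 bnd2].
have same2 : same_tree st2 by apply: same_tree_agree ag2 _ _ _ same1.
have att2' : low_attained st2.
  by move=> v; have [z H1 H2] := att2 v; exists v, z; split.
have edge2 : low_edges st2.
  move=> v z /orP[] vz; have [j E] := env_F en1 vz;
    by have := bnd2 j (ltn_ord j); rewrite E => /(_ vz)[].
(* After [i] rounds the vertices numbered above [n - i] have passed on their values; round [i]
   handles number [n - i], at index [n - 1 - i]. *)
pose I3 i st := [/\ low_attained st, low_edges st & forall v : 'I_n, v != y ->
  n - i < num v -> arr st a_low (par v) <= arr st a_low v].
have [en2 _ _ _] := same2.
apply: (runl_for (I := I3) (M := n)) => //.
- exact: env_n en2.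
- split=> // v vy; rewrite subn0; have [k [lt _ ->]] := numP v; lia.
- move=> i st lt_in ag rk [att edg mono].
  have [en E1 E2 E3] : same_tree st by apply: same_tree_agree ag _ _ _ same2.
  have lt_ni : n - 1 - i < n by lia.
  have [v [ov nv]] := ordP lt_ni.
  have nv' : num v = n - i by rewrite nv; lia.
  rewrite /= (env_n en) rk E3 ov /= E2 parE.
  case: (eqVneq v y) => [vy|vy] /=.
    split=> // w wy lt; apply: mono => //; have := num_par wy.
    have : num w != num v by rewrite (inj_eq numI) vy.
    by rewrite nv'; lia.
  rewrite subn1 /=; set p := par v.
  have lt_p : num p < num v := num_par vy.
  have mono' (w : 'I_n) : w != y -> n - i.+1 < num w -> w = v \/ n - i < num w.
    move=> wy lt; case: (eqVneq w v) => [|ne]; [by left | right].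
    have : num w != num v by rewrite (inj_eq numI).
    by rewrite nv'; lia.
  case: ltnP => lt /=; last first.
    by split=> // w wy /mono'[//|->|]; [|exact: mono].
  have E (w : 'I_n) : (if nat_of_ord w == p then arr st a_low v else arr st a_low w) <=
    arr st a_low w by rewrite ordE; case: eqP => // ->; apply: ltnW.
  split.
  + move=> w /=; rewrite ordE; case: eqP => [->|_]; last exact: att.
    have [x [z [xv xz ->]]] := att v; exists x, z; split=> //.
    exact: connect_trans xv (fconnect1 par v).
  + by move=> w z /edg; apply: leq_trans; apply: E.
  + move=> w wy /(mono' _ wy)[->|lt_w] /=.
      by rewrite eqxx ordE ifN //; apply: contraTneq lt_p => <-; rewrite ltnn.
    have wp : w != p by apply: contraTneq lt_w => ->; rewrite -nv' -leqNgt ltnW.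
    by rewrite [in leqRHS]ordE (negbTE wp); apply: leq_trans (E _)
      (mono w wy lt_w).
move=> st3 ag3 [att edg mono]; apply: HQ.
  exact: same_tree_agree ag3 _ _ _ same2.
have low_anc (x v : 'I_n) : fconnect par x v ->
  arr st3 a_low v <= arr st3 a_low x.
  move=> xv; rewrite -(iter_findex xv); elim: (findex _ _ _) => //= k IH.
  apply: leq_trans IH; set w := iter _ _ _.
  case: (eqVneq w y) => [->|wy]; first by rewrite (st_root tree).
  by apply: mono => //; rewrite subnn; have [? [_ _ ->]] := numP w.
move=> v vy; rewrite /is_head vy /=.
apply/idP/forallP => [le x|H].
  apply/forallP => z; apply/implyP => xv; apply/implyP => xz.
  exact: leq_trans le (leq_trans (low_anc _ _ xv) (edg _ _ xz)).
(* A value attained at a vertex of the subtree itself exceeds [num (par v)]; otherwise it comes from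
   an edge, to which the head condition applies. *)
have [x [z [xv xz ->]]] := att v; case: xz => [<-|xz].
  have anc_le : num v <= num x.
    rewrite -(iter_findex xv); elim: (findex _ _ _) => //= k IH.
    apply: leq_trans IH; set w := iter _ _ _.
    case: (eqVneq w y) => [->|wy]; first by rewrite (st_root tree).
    exact/ltnW/num_par.
  exact: leq_trans (ltnW (num_par vy)) anc_le.
by have /forallP/(_ z) := H x; rewrite xv xz.
Qed.

Lemma find_heads_spec X st1 (Q : store -> Prop) : n < X -> same_tree st1 ->
  (forall v : 'I_n, v != y -> (num (par v) <= arr st1 a_low v) = head v) ->
  (forall st bh hs, env st -> blocks_found st par num bh hs -> Q st) ->
  runl X find_heads st1 Q.
Proof.
move=> nX same1 lowE HQ.
apply: runl_seq; apply: runl_sem => //; first by lia.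
set st2 := sem _ _.
have same2 : same_tree st2 by case: same1 => -[].
have lowE2 (v : 'I_n) : arr st2 a_low v = arr st1 a_low v by [].
(* Numbers start at [1], so [num w <= i] describes the first [i] vertices in [a_ord]. *)
pose I i st := (forall v : 'I_n, v != y -> num v <= i ->
    if head v then arr st a_bh v = v
    else exists2 h : 'I_n, arr st a_bh v = h & arr st a_bh (par v) = h) /\
  exists hs : seq 'I_n, [/\ uniq hs, forall h, (h \in hs)
    = head h && (num h <= i),
    reg st r_nb = size hs & forall h, h \in hs -> arr st a_id h = index h hs].
have [en2 _ _ _] := same2.
have num_gt0 v : 0 < num v by have [? [_ _ ->]] := numP v.
have bh_ord i st : I i st -> forall v : 'I_n, v != y -> num v <= i ->
    exists h : 'I_n, arr st a_bh v = h.
  move=> [H _] v vy le; have := H v vy le; case: ifP => _; first by exists v.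
  by case=> h E _; exists h.
apply: (runl_for (I := I) (M := n)) => //.
- exact: env_n en2.
- split=> [v _|]; first by have := num_gt0 v; lia.
  by exists [::]; split=> // h; have := num_gt0 h; case: (num h) => // k;
    rewrite andbF.
- move=> i st lt_in ag rk inv; have [bhI [hs [uhs hsE nbE idE]]] := inv.
  have [en E1 E2 E3] : same_tree st by apply: same_tree_agree ag _ _ _ same2.
  have E4 (w : 'I_n) : arr st a_low w = arr st1 a_low w by rewrite ag.2.
  have [v [ov nv]] := ordP lt_in.
  rewrite /= rk E3 ov /= E2 parE.
  have le_i (w : 'I_n) : num w <= i.+1 -> w = v \/ num w <= i.
    rewrite leq_eqVlt ltnS -nv (inj_eq numI) => /orP[/eqP|]; by [left | right].
  have le_hs (h : 'I_n) : h != v -> (num h <= i.+1) = (num h <= i).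
    by move=> ne; rewrite leq_eqVlt ltnS -nv (inj_eq numI) (negbTE ne).
  case: (eqVneq v y) => [vy|vy] /=.
    split=> [w wy /le_i[E|]|]; first by rewrite E vy eqxx in wy.
      exact: bhI.
    exists hs; split=> // h; rewrite hsE.
    have [->|ne] := eqVneq h v; first by rewrite /is_head vy eqxx.
    by rewrite le_hs.
  rewrite subn1 /= E4 E1 -/(num _) ltnNge lowE //; set p := par v.
  have lt_p : num p < num v := num_par vy.
  have vp : v != p by apply: contraTneq lt_p => <-; rewrite ltnn.
  have le_p : num p <= i by rewrite -ltnS -nv.
  have par_ne (w : 'I_n) : w != y -> num w <= i -> par w != v.
    move=> wy le; apply: contraTneq (num_par wy) => ->; rewrite nv; lia.
  have nvi : num v <= i = false by rewrite nv ltnn.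
  case: (boolP (head v)) => hv /=.
    split=> [w wy|].
      case: (eqVneq w v) => [->|ne]; first by rewrite hv /= eqxx.
      rewrite /= !ordE (negbTE ne) => /le_i[E|le];
        first by rewrite E eqxx in ne.
      by rewrite (negbTE (par_ne w wy le)); apply: bhI.
    have nvhs : v \notin hs by rewrite hsE nvi andbF.
    exists (rcons hs v); split.
    + by rewrite rcons_uniq nvhs.
    + move=> h; rewrite mem_rcons inE; case: (eqVneq h v) => [->|ne] /=.
        by rewrite hv nv leqnn.
      by rewrite hsE le_hs.
    + by rewrite size_rcons nbE addn1.
    + move=> h; rewrite mem_rcons inE -cats1 index_cat.
      case: (eqVneq h v) => [->|ne] /= hhs.
        by rewrite (negbTE nvhs) !eqxx addn0 nbE.
      by rewrite ordE (negbTE ne) hhs idE.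
  (* Children of the root are heads, so the [a_bh] cell of the root, which is never written, is not
     copied. *)
  have py : p != y.
    apply: contraNneq hv => py; rewrite /is_head vy -/p py.
    apply/forallP => x; apply/forallP => z; rewrite (leq_trans _ (num_root z))
      //.
    by rewrite !implybT.
  have [hp Ehp] := bh_ord i st inv p py le_p.
  split=> [w wy|].
    case: (eqVneq w v) => [->|ne].
      by rewrite (negbTE hv) /= eqxx ordE eq_sym (negbTE vp) => _; exists hp.
    rewrite /= !ordE (negbTE ne) => /le_i[E|le]; first by rewrite E eqxx in ne.
    by rewrite (negbTE (par_ne w wy le)); apply: bhI.
  exists hs; split=> // h; rewrite hsE; have [->|ne] := eqVneq h v.
    by rewrite (negbTE hv).
  by rewrite le_hs.
move=> st ag inv; have [bhI [hs [uhs hsE nbE idE]]] := inv.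
have [en E1 E2 E3] : same_tree st by apply: same_tree_agree ag _ _ _ same2.
have le_n v : num v <= n by have [? [? _ ->]] := numP v.
pose bh (v : 'I_n) : 'I_n := insubd v (arr st a_bh v).
have bhE (v h : 'I_n) : arr st a_bh v = h -> bh v = h.
  by rewrite /bh => ->; rewrite -[X in insubd _ X]/(val h) valKd.
apply: (HQ st bh hs) => //; split=> //.
- apply: dfs_tree_of_search => v vy; have := bhI v vy (le_n v).
  case: ifP => [_ /bhE //|_ [h /bhE -> /bhE -> //]].
- by move=> v; rewrite E2 parE.
- move=> v vy; have [h E] := bh_ord n st inv v vy (le_n v).
  by rewrite (bhE _ _ E).
- by move=> h; rewrite hsE le_n andbT.
Qed.

End LowPoints.

Lemma find_blocks_spec X st (Q : store -> Prop) : n < X -> 4 * m + 1 < X ->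
  env st -> uconnected [set: 'I_n] F ->
  (forall st' par num bh hs, env st' -> blocks_found st' par num bh hs ->
    Q st') ->
  runl X find_blocks st Q.
Proof.
move=> nX mX en /uconnectedP uc HQ; have mX' : m < X by lia.
have conn v : connect (sym_edge F) y v.
  apply: connect_sub (uc y v (in_setT _) (in_setT _)) => a b.
  by rewrite uedgeE => /and3P[_ _]; apply: connect1.
apply: runl_seq; apply: search_spec en _ => // st1 par en1 tree1.
apply: runl_seq; apply: (low_points_spec en1 tree1) => // st2 same2 lowE.
apply: (find_heads_spec tree1 conn nX same2 lowE) => st3 bh hs en3 bf.
exact: HQ bf.
Qed.

End BlockSearch.

(** * Subroutines *)

Definition a_cand' := 24.

Definition fill (e : expr) : cmd := for_to r_k r_m (Put a_act (Reg r_k) e).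

Definition fill_without : cmd :=
  fill (Defs.Sub (Const 1) (Eq (Reg r_k) (Reg r_skip))).

Definition sb_test : cmd :=
  (strong_test ;;
   If (Reg r_sc)
     (find_blocks ;; Assign r_ans (Lt (Reg r_nb) (Const 2)))
     (Assign r_ans (Const 0)))%cmd.

Definition mark_tree (a : nat) : cmd :=
  (for_to r_k r_m (Put a (Reg r_k) (Const 0)) ;;
   for_to r_k r_n
     (If (Get a_par (Reg r_k)) (Put a (Get a_pe (Reg r_k)) (Const 1))
       Skip))%cmd.

Definition test_Ey : cmd := (fill (Get a_Ey (Reg r_k)) ;; sb_test)%cmd.

Definition test_without : cmd :=
  (Assign r_skip (Reg r_e) ;; fill_without ;; sb_test)%cmd.

Definition tree : cmd :=
  (fill (Const 1) ;; search true false ;; mark_tree a_T)%cmd.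

Definition reverse_tree : cmd :=
  (fill (Const 1) ;; search false true ;; mark_tree a_Ty)%cmd.

Definition bridge_test : cmd :=
  (Assign r_skip (Reg r_i) ;; fill_without ;; strong_test ;;
   Put a_U (Reg r_i) (Eq (Reg r_sc) (Const 0)))%cmd.

Definition bridge_step : cmd :=
  (Put a_U (Reg r_i) (Const 0) ;;
   If (Add (Get a_cand (Reg r_i)) (Get a_cand' (Reg r_i)))
     bridge_test Skip)%cmd.

Definition bridge_candidates : cmd :=
  (fill (Const 1) ;; search true false ;; mark_tree a_cand ;;
   search false true ;; mark_tree a_cand')%cmd.

Definition strong_bridges : cmd :=
  (bridge_candidates ;; for_to r_i r_m bridge_step)%cmd.

Definition push (k x : expr) : cmd :=
  (Put a_cid (Reg r_np) k ;; Put a_cvx (Reg r_np) x ;;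
   Assign r_np (Add (Reg r_np) (Const 1)))%cmd.

(** A vertex other than the root is listed in the block of its deepest head, and a head also lists
    its parent there. The last test supplies the component of the one-vertex graph, which has no
    head. *)
Definition components : cmd :=
  (fill (Get a_Ey (Reg r_k)) ;; find_blocks ;;
   Assign r_np (Const 0) ;;
   for_to r_k r_n
     (If (Get a_par (Reg r_k))
        (push (Get a_id (Get a_bh (Reg r_k))) (Reg r_k) ;;
         If (Eq (Get a_bh (Reg r_k)) (Reg r_k))
           (push (Get a_id (Get a_bh (Reg r_k)))
              (Defs.Sub (Get a_par (Reg r_k)) (Const 1)))
           Skip)
        Skip) ;;
   Assign r_nc (Reg r_nb) ;;
   If (Eq (Reg r_nb) (Const 0))
     (push (Const 0) (Reg r_y) ;; Assign r_nc (Const 1))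
     Skip)%cmd.

Definition both (e1 e2 : expr) : expr := Lt (Const 1) (Add e1 e2).

(* Nonzero when the ends of the current edge share a block; the root is the
   vertex whose cell in [a_par] is [0]. *)
Definition common_expr : expr :=
  let v := Reg r_v in let w := Reg r_w in
  let nonroot x := Lt (Const 0) (Get a_par x) in
  let top x := Get a_par (Get a_bh x) in
  Add (Eq v w)
    (Add (both (nonroot v) (both (nonroot w) (Eq (Get a_bh v) (Get a_bh w))))
       (Add (both (nonroot v) (Eq (top v) (Add w (Const 1))))
          (both (nonroot w) (Eq (top w) (Add v (Const 1)))))).

Definition crossing_step : cmd :=
  (Assign r_v (Get a_src (Reg r_k)) ;;
   Assign r_w (Get a_dst (Reg r_k)) ;;
   If common_expr Skip (Assign r_e (Reg r_k)))%cmd.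

(** The blocks are searched again: the contract says nothing about scratch arrays, and the
    constant-time test needs [a_bh] and [a_par], not the list of incidences. *)
Definition find_edge : cmd :=
  (fill (Get a_Ey (Reg r_k)) ;; find_blocks ;;
   for_to r_k r_m crossing_step)%cmd.

(** Reduces the frame conditions of [computes] to a boolean check on the written variables. *)
Lemma computes_runs (pre : store -> Prop) c rs ars (post : store -> Prop) :
  all (fun x => (n_reg <= x) || (x \in rs)) (wregs c) ->
  all (fun a => (n_arr <= a) || (a \in ars)) (warrs c) ->
  (forall st, pre st -> exists k, runs k c st post) ->
    computes pre c rs ars post.
Proof.
move=> /allP Hr /allP Ha H st /H[k [t [st' [ex _ Q]]]]; exists t, st'.
have [rE aE] := exec_agree ex; split=> // [x lt nx|a lt na].
- apply: rE; apply: contra nx => /Hr; by rewrite leqNgt lt.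
- apply: aE; apply: contra na => /Ha; by rewrite leqNgt lt.
Qed.

Section DfsTreeExists.

Variables (n : nat) (y : 'I_n) (F : {set 'I_n * 'I_n}).

(* Obtained by running the search on a store that holds the graph. *)
Lemma treeable_uconnected : uconnected [set: 'I_n] F -> treeable y F.
Proof.
move=> uc; pose es := in_tuple (enum F); set m := size (enum F) in es.
pose col i (b : bool) : nat :=
  oapp (fun j : 'I_m => if b then (tnth es j).1 : nat else (tnth es j).2 : nat)
    0 (insub i).
pose st := Store
  (fun x => if x == r_n then n else if x == r_m then m else y)
  (fun a i => if a == a_act then 1 else col i (a == a_src)).
have en : env es y F st.
  split=> //.
  - by move=> i /=; rewrite /col valK.
  - move=> e; rewrite -mem_enum => /(tnthP es)[j ->]; by exists j.
  - by move=> j; rewrite -mem_enum; apply/esym/mem_tnth.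
pose X := n + 4 * m + 2.
have [t [st' [_ _ [par [num [bh ?]]]]]] : runl X find_blocks st (fun=>
  treeable y F).
  apply: (find_blocks_spec (es := es)) en uc _; rewrite /X; [lia | lia |].
  by move=> ? par num bh hs _ [tr *]; exists par, num, bh.
by exists par, num, bh.
Qed.

End DfsTreeExists.

(** * Spanning out-trees and in-trees *)

Section Trees.

Variables (n : nat) (y : 'I_n).

Lemma spanning_tree_par (F : {set 'I_n * 'I_n}) (par : 'I_n -> 'I_n)
    (num : 'I_n -> nat) :
  (forall v, v != y -> (par v, v) \in F /\ num (par v) < num v) ->
  spanning_tree F y [set (par v, v) | v in [pred v | v != y]].
Proof.
move=> parP; set T := [set _ | _ in _].
have inT u v : ((u, v) \in T) = (v != y) && (u == par v).
  apply/imsetP/andP => [[w wy [-> ->]]|[vy /eqP ->]]; first by rewrite eqxx.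
  by exists v.
apply/and3P; split.
- by apply/subsetP => e /imsetP[v /parP[? _] ->].
- apply/forallP => v; have [k] := ubnP (num v); elim: k => // k IH in v *.
  rewrite ltnS => le; have [->|vy] := eqVneq v y; first exact: connect0.
  have [_ lt] := parP v vy; apply: connect_trans (IH _ (leq_trans lt le)) _.
  by apply: connect1; rewrite /dedge /= !inE inT vy eqxx.
- apply/forallP => v; have [->|vy] := eqVneq v y.
    by rewrite (eq_card0 (A := mem [set _ | _])) // => u; rewrite !inE inT eqxx.
  have -> : [set u | (u, v) \in T] = [set par v].
    by apply/setP => u; rewrite !inE inT vy.
  by rewrite cards1.
Qed.

(** In-degrees are at most one, so an edge is determined by its target. *)
Lemma spanning_tree_card (F T : {set 'I_n * 'I_n}) :
  spanning_tree F y T -> #|T| <= n.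
Proof.
case/and3P=> _ _ /forallP deg; rewrite -[leqRHS]card_ord -(card_in_imset (f :=
  snd)).
  exact: max_card.
move=> [u v] [u' v'] /= uT u'T E; rewrite -{v'}E in u'T *; congr (_, _).
have : #|[set u | (u, v) \in T]| <= 1 by rewrite (eqP (deg v)) leq_b1.
by move/card_le1_eqP; apply; rewrite inE.
Qed.

Lemma in_reverse (F : {set 'I_n * 'I_n}) a b :
  ((a, b) \in reverse F) = ((b, a) \in F).
Proof.
apply/imsetP/idP => [[[u v] uvF [-> ->]] //|baF]; by exists (b, a).
Qed.

(** Serves twice: for the initial [E_y], and for [E] minus an edge outside both trees, which shows
    that such an edge is no strong bridge. *)
Lemma spanning_trees_strong (E T Ty F : {set 'I_n * 'I_n}) :
  spanning_tree E y T -> spanning_tree (reverse E) y Ty ->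
  T \subset F -> reverse Ty \subset F -> strongly_connected [set: 'I_n] F.
Proof.
move=> /and3P[_ /forallP cT _] /and3P[_ /forallP cTy _] /subsetP sT /subsetP sTy.
rewrite (strongly_connected_root y); apply/andP; split; apply/forallP => v.
  apply: connect_sub (cT v) => a b; rewrite /dedge /= !inE => ab.
  by apply: connect1; rewrite /dir_edge /= sT.
apply: connect_sub (cTy v) => a b; rewrite /dedge /= !inE => ab.
by apply: connect1; rewrite /dir_edge /= sTy // in_reverse.
Qed.

End Trees.

(** * Tests, trees and strong bridges *)

Section Subroutines.

Variables (n m : nat) (E : {set 'I_n * 'I_n}).
Variables (es : m.-tuple ('I_n * 'I_n)) (y : 'I_n).

Definition input (st : store) : Prop := is_input E es st /\ reg st r_y = y.

Notation Ey st := (edge_set es a_Ey st).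

Lemma input_agree rs ars st st' : agree rs ars st st' ->
  all (fun x => x \notin rs) [:: r_n; r_m; r_y] ->
  all (fun a => a \notin ars) [:: a_src; a_dst] -> input st -> input st'.
Proof.
move=> [rE aE] /= /and4P[r0 r1 r2 _] /and3P[a0 a1 _] [[H1 H2 H3 H4] H5].
split; last by rewrite rE.
by split; rewrite ?rE // => i; rewrite !aE //; apply: H4.
Qed.

Lemma edge_set_agree (es' : m.-tuple ('I_n * 'I_n)) a st st' :
  arr st' a =1 arr st a -> edge_set es' a st' = edge_set es' a st.
Proof.
by move=> aE; apply/setP => e; apply/imsetP/imsetP => -[i];
  rewrite !inE ?aE => H ->; exists i; rewrite ?inE ?aE.
Qed.

Section Input.

Variable st : store.
Hypothesis inp : input st.

Lemma input_uniq : uniq es.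
Proof. by have [[/perm_uniq -> _ _ _] _] := inp; apply: enum_uniq. Qed.

Lemma input_inj : injective (tnth es).
Proof. exact/tuple_uniqP/input_uniq. Qed.

Lemma input_mem j : tnth es j \in E.
Proof.
by have [[/perm_mem esE _ _ _] _] := inp; rewrite -mem_enum -esE mem_tnth.
Qed.

Lemma input_tnth e : e \in E -> exists j, tnth es j = e.
Proof.
have [[/perm_mem esE _ _ _] _] := inp.
by rewrite -mem_enum -esE => /tnthP[j ->]; exists j.
Qed.

Lemma input_card : #|E| = m.
Proof.
have [[/perm_size sz _ _ _] _] := inp.
by rewrite size_tuple in sz; rewrite cardE.
Qed.

Lemma mem_edge_set a st' (j : 'I_m) :
  (tnth es j \in edge_set es a st') = (arr st' a j != 0).
Proof.
apply/imsetP/idP => [[i]|H]; last by exists j; rewrite ?inE.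
by rewrite inE => H /input_inj ->.
Qed.

Lemma edge_set_sub a st' : edge_set es a st' \subset E.
Proof. by apply/subsetP => e /imsetP[j _ ->]; apply: input_mem. Qed.

Lemma edge_setP a st' (S : {set 'I_n * 'I_n}) : S \subset E ->
  (forall j : 'I_m, (arr st' a j != 0) = (tnth es j \in S)) ->
  edge_set es a st' = S.
Proof.
move=> /subsetP sSE H; apply/setP => e; apply/idP/idP.
  by case/imsetP=> j; rewrite inE H => ? ->.
by move=> eS; have [j Ej] := input_tnth (sSE e eS);
  rewrite -Ej mem_edge_set H Ej.
Qed.

Lemma input_env (F : {set 'I_n * 'I_n}) : F \subset E ->
  (forall j : 'I_m, (arr st a_act j != 0) = (tnth es j \in F)) -> env es y F st.
Proof.
move=> /subsetP sFE act; have [[H1 H2 H3 H4] H5] := inp.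
by split=> // e /sFE; apply: input_tnth.
Qed.

Lemma card_arr a st' : #|[set j :
  'I_m | arr st' a j != 0]| = #|edge_set es a st'|.
Proof. by rewrite card_imset //; apply: input_inj. Qed.

End Input.

Lemma fill_spec X st e (F : {set 'I_n * 'I_n}) (Q : store -> Prop) : m < X ->
  input st -> F \subset E ->
  (forall st' (j : 'I_m), agree [:: r_k] [:: a_act] st st' ->
     reg st' r_k = j -> (eval st' e != 0) = (tnth es j \in F)) ->
  (forall st', agree [:: r_k] [:: a_act] st st' -> input st' ->
    env es y F st' ->
     Q st') ->
  runl X (fill e) st Q.
Proof.
move=> mX inp sFE eE HQ.
pose I i st1 := forall j : 'I_m, j < i ->
  (arr st1 a_act j != 0) = (tnth es j \in F).
apply: (runl_for (I := I) (M := m)) => //.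
- by case: inp => -[].
- move=> i st1 lt_im ag rk Ii j; rewrite /= rk ltnS leq_eqVlt.
  by case: (eqVneq (j : nat) i) => [E1 _|ne /= /Ii//]; rewrite (eE _ j) // rk.
- move=> st1 ag Im; have inp1 : input st1 by apply: input_agree ag _ _ inp.
  by apply: HQ => //; apply: input_env => // j; apply: Im.
Qed.

Lemma fill_all_spec X st (Q : store -> Prop) : m < X -> input st ->
  (forall st', agree [:: r_k] [:: a_act] st st' -> input st' ->
    env es y E st' ->
     Q st') ->
  runl X (fill (Const 1)) st Q.
Proof.
move=> mX inp HQ; apply: fill_spec (inp) (subxx E) _ HQ => // st' j _ _.
by rewrite (input_mem inp).
Qed.

Lemma fill_Ey_spec X st (Q : store -> Prop) : m < X -> input st ->
  (forall st', agree [:: r_k] [:: a_act] st st' -> input st' ->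
     env es y (Ey st) st' -> Q st') ->
  runl X (fill (Get a_Ey (Reg r_k))) st Q.
Proof.
move=> mX inp HQ; apply: fill_spec (inp) (edge_set_sub inp _ _) _ HQ =>
  // st' j ag rk.
by rewrite (mem_edge_set inp) /= rk ag.2.
Qed.

Lemma fill_without_spec X st (i : 'I_m) (Q : store -> Prop) : m < X ->
  input st ->
  reg st r_skip = i ->
  (forall st', agree [:: r_k] [:: a_act] st st' -> input st' ->
     env es y (E :\ tnth es i) st' -> Q st') ->
  runl X fill_without st Q.
Proof.
move=> mX inp ri HQ; apply: fill_spec (inp) (subsetDl _ _) _ HQ =>
  // st' j ag rk.
rewrite !inE (input_mem inp) andbT (inj_eq (input_inj inp))
  /= rk ag.1 // ri ordE.
by case: (j == i).
Qed.

Lemma card_heads st par num bh hs (F : {set 'I_n * 'I_n}) :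
  blocks_found y F st par num bh hs ->
  #|[set h | is_head F y par num h]| = size hs.
Proof.
move=> bf; rewrite -(card_uniqP (bf_uniq bf)); apply: eq_card => h.
by rewrite inE (bf_heads bf).
Qed.

Lemma sb_test_spec X st (F : {set 'I_n * 'I_n}) (Q : store -> Prop) : n < X ->
  4 * m + 1 < X ->
  env es y F st ->
  (forall st', (reg st' r_ans != 0) = strongly_biconnected [set: 'I_n] F ->
    Q st') ->
  runl X sb_test st Q.
Proof.
move=> nX mX en HQ; have X0 : 0 < X by lia.
apply: runl_seq; apply: strong_test_spec en _ => // st1 en1 scE.
apply: runl_if => // /= sc; last first.
  apply: runl_sem => //; apply: HQ => /=;
    rewrite /strongly_biconnected -scE sc //.
rewrite scE in sc.
apply: runl_seq; apply: (find_blocks_spec (es := es))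
  en1 (strongly_uconnected sc) _ => //.
move=> st2 par num bh hs _ bf; apply: runl_sem => //; apply: HQ => /=.
rewrite (sb_heads (bf_tree bf) sc) (card_heads bf) (bf_size bf) eqb0 negbK ltnS.
by [].
Qed.

Lemma test_Ey_spec X st (Q : store -> Prop) : n < X -> 4 * m + 1 < X ->
  input st ->
  (forall st', (reg st' r_ans != 0) = strongly_biconnected [set: 'I_n] (Ey st)
    ->
     Q st') ->
  runl X test_Ey st Q.
Proof.
move=> nX mX inp HQ; apply: runl_seq; apply: fill_Ey_spec (inp) _; first by lia.
by move=> st1 _ _ en; apply: sb_test_spec en _.
Qed.

Lemma test_without_spec X st (i : 'I_m) (Q : store -> Prop) :
  n < X -> 4 * m + 1 < X -> input st -> reg st r_e = i ->
  (forall st', (reg st' r_ans != 0) =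
     strongly_biconnected [set: 'I_n] (E :\ tnth es i) -> Q st') ->
  runl X test_without st Q.
Proof.
move=> nX mX inp ri HQ; apply: runl_seq; apply: runl_sem => //; first by lia.
have inp1 : input (sem (Assign r_skip (Reg r_e)) st).
  by apply: input_agree (sem_agree st _) _ _ inp.
apply: runl_seq; apply: (fill_without_spec (i := i)) => //; first by lia.
by move=> st1 _ _ en; apply: sb_test_spec en _.
Qed.

Lemma mark_tree_spec X st a df dr par (Q : store -> Prop) : n < X -> m < X ->
  input st -> a \notin [:: a_src; a_dst; a_par; a_pe] ->
  search_tree es y E df dr st par ->
  (forall v, connect (dir_edge E df dr) y v) ->
  (forall st', input st' -> (forall j : 'I_m, (arr st' a j != 0) =
     [exists v : 'I_n, (v != y) && (arr st a_pe v == j)]) -> Q st') ->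
  runl X (mark_tree a) st Q.
Proof.
move=> nX mX inp; rewrite !inE !negb_or => /and4P[na0 na1 na2 na3] tr conn HQ.
have [[_ rn rm _] _] := inp.
apply: runl_seq.
pose I1 i st1 := forall k, k < i -> arr st1 a k = 0.
apply: (runl_for (I := I1) (M := m)) => //.
  move=> i st1 lt_im ag rk Ii k; rewrite /= rk eqxx ltnS leq_eqVlt /=.
  by case: eqP => //= _ /Ii.
move=> st1 ag1 I1m.
have inp1 : input st1.
  by apply: input_agree ag1 _ _ inp => //=; rewrite !inE eq_sym na0 eq_sym na1.
pose I2 i st2 := forall j : 'I_m, (arr st2 a j != 0) =
  [exists v : 'I_n, [&& v < i, v != y & arr st a_pe v == j]].
apply: (runl_for (I := I2) (M := n)) => //.
- by rewrite ag1.1.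
- by move=> j; rewrite /= I1m // eqxx; apply/esym/existsP => -[v].
- move=> i st2 lt_in ag2 rk Ii j; pose v := Ordinal lt_in.
  have rv : reg st2 r_k = v by [].
  have arrE b : (b == a) = false -> arr st2 b =1 arr st b.
    move=> nb x; rewrite ag2.2 ?ag1.2 //= ?inE ?nb //.
  have lt_v (w : 'I_n) : w < i.+1 -> w = v \/ w < i :=
    @ltn_ordS _ _ lt_in w.
  have par_ne : (a_par == a) = false by rewrite eq_sym (negbTE na2).
  have pe_ne : (a_pe == a) = false by rewrite eq_sym (negbTE na3).
  rewrite /= rv (arrE _ par_ne) (arrE _ pe_ne).
  rewrite (st_par tr) conn andbT; case: (eqVneq v y) => [vy|vy] /=.
    rewrite Ii; apply/existsP/existsP => -[w /and3P[lt wy pw]]; exists w.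
      by rewrite ltnS (ltnW lt) wy.
    by case: (lt_v w lt) => [E1|->]; [rewrite E1 vy eqxx in wy | rewrite wy].
  rewrite eqxx /=; case: (eqVneq (j : nat) (arr st a_pe v)) => [Ej|ne].
    by apply/esym/existsP; exists v; rewrite ltnSn vy -Ej eqxx.
  rewrite Ii; apply/existsP/existsP => -[w /and3P[lt wy pw]]; exists w.
    by rewrite ltnS (ltnW lt) wy.
  case: (lt_v w lt) => [E1|->]; last by rewrite wy.
  by rewrite E1 eq_sym (negbTE ne) in pw.
- move=> st2 ag2 In; apply: HQ.
    by apply: input_agree ag2 _ _ inp1 => //=;
      rewrite !inE eq_sym na0 eq_sym na1.
  move=> j; rewrite In; apply/existsP/existsP => -[w].
    by case/and3P=> _ wy pw; exists w; rewrite wy.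
  by case/andP=> wy pw; exists w; rewrite ltn_ord wy.
Qed.

(** One proof for both trees: exactly one direction is searched, so a recorded edge number has a
    definite orientation, reversed for the in-tree and read off the swapped list. *)
Lemma tree_edges df dr st par a st' : input st' -> strongly_connected [set:
  'I_n] E ->
  df (+) dr -> search_tree es y E df dr st par ->
  (forall v, connect (dir_edge E df dr) y v) ->
  (forall j : 'I_m, (arr st' a j != 0) =
     [exists v : 'I_n, (v != y) && (arr st a_pe v == j)]) ->
  spanning_tree (if df then E else reverse E) y
    (edge_set (if df then es else [tuple of map (@swap _) es]) a st').
Proof.
move=> inp sc dfr tr conn aE.
have parP v : v != y -> exists j : 'I_m, [/\ arr st a_pe v = j,
    tnth (if df then es else [tuple of map (@swap _) es]) j = (par v, v) &
    (par v, v) \in (if df then E else reverse E)].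
  move=> vy; have [_ _ [j [k [pj [jE H]]]]] := st_node tr vy (conn v).
  exists j; move: H dfr.
  case: (df); case: (dr) => //= -[[d [_ Ej]]|[d [_ Ej]]] _ //; rewrite Ej in jE.
    by [].
  by rewrite tnth_map Ej in_reverse.
set es' := if df then es else _ in parP *; set E' :=
  if df then E else _ in parP *.
suff -> : edge_set es' a st' = [set (par v, v) | v in [pred v | v != y]].
  apply: (spanning_tree_par (num := fun v : 'I_n => arr st a_num v)) => v vy.
  by have [j [_ _ ?]] := parP v vy; have [_ ? _] := st_node tr vy (conn v).
apply/setP => e; apply/imsetP/imsetP => [[j]|[v vy ->]].
  rewrite inE aE => /existsP[v /andP[vy /eqP pj]] ->; exists v => //.
  by have [j' [pj' <- _]] := parP v vy; rewrite pj' in pj; rewrite (val_inj pj).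
have [j [pj Ej _]] := parP v vy; exists j; last by rewrite Ej.
by rewrite inE aE; apply/existsP; exists v; rewrite pj eqxx andbT; exact: vy.
Qed.

Lemma strong_conn_dir df dr : df || dr -> strongly_connected [set: 'I_n] E ->
  forall v, connect (dir_edge E df dr) y v.
Proof.
move=> dfr; rewrite (strongly_connected_root y) =>
  /andP[/forallP H1 /forallP H2] v.
case/orP: dfr => d; [move: (H1 v) | move: (H2 v)]; apply: connect_sub => a b H;
  apply: connect1; move: H; rewrite /dir_edge /= d ?orbF => -> //=.
by rewrite orbT.
Qed.

Lemma tree_spec X st (Q : store -> Prop) : n < X -> 4 * m + 1 < X ->
  input st -> strongly_connected [set: 'I_n] E ->
  (forall st', spanning_tree E y (edge_set es a_T st') -> Q st') ->
  runl X tree st Q.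
Proof.
move=> nX mX inp sc HQ; have mX' : m < X by lia.
have conn := strong_conn_dir (df := true) (dr := false) isT sc.
apply: runl_seq; apply: fill_all_spec (inp) _ => // st1 _ inp1 en1.
apply: runl_seq; apply: runs_weaken (runs_agree (search_spec nX mX en1
  (Q := fun st' => exists par, search_tree es y E true false st' par) _))
    _ _ => //.
  by move=> st2 par _ ?; exists par.
move=> st2 [ag [par tr]]; have inp2 : input st2 by apply:
  input_agree ag _ _ inp1.
apply: (mark_tree_spec nX mX' inp2 _ tr conn) => // st3 inp3 aE; apply: HQ.
exact: (tree_edges inp3 sc _ tr conn aE).
Qed.

Lemma reverse_tree_spec X st (Q : store -> Prop) : n < X -> 4 * m + 1 < X ->
  input st -> strongly_connected [set: 'I_n] E ->
  (forall st', spanning_tree (reverse E) y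
     (edge_set [tuple of map (@swap _) es] a_Ty st') -> Q st') ->
  runl X reverse_tree st Q.
Proof.
move=> nX mX inp sc HQ; have mX' : m < X by lia.
have conn := strong_conn_dir (df := false) (dr := true) isT sc.
apply: runl_seq; apply: fill_all_spec (inp) _ => // st1 _ inp1 en1.
apply: runl_seq; apply: runs_weaken (runs_agree (search_spec nX mX en1
  (Q := fun st' => exists par, search_tree es y E false true st' par) _))
    _ _ => //.
  by move=> st2 par _ ?; exists par.
move=> st2 [ag [par tr]]; have inp2 : input st2 by apply:
  input_agree ag _ _ inp1.
apply: (mark_tree_spec nX mX' inp2 _ tr conn) => // st3 inp3 aE; apply: HQ.
exact: (tree_edges inp3 sc _ tr conn aE).
Qed.

Lemma bridge_candidates_spec X st (Q : store -> Prop) : n < X ->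
  4 * m + 1 < X ->
  input st -> strongly_connected [set: 'I_n] E ->
  (forall st', input st' -> spanning_tree E y (edge_set es a_cand st') ->
     spanning_tree (reverse E) y
       (edge_set [tuple of map (@swap _) es] a_cand' st') -> Q st') ->
  runl X bridge_candidates st Q.
Proof.
move=> nX mX inp sc HQ; have mX' : m < X by lia.
have conn := strong_conn_dir (df := true) (dr := false) isT sc.
have conn' := strong_conn_dir (df := false) (dr := true) isT sc.
apply: runl_seq; apply: fill_all_spec (inp) _ => // st1 _ inp1 en1.
apply: runl_seq; apply: runs_weaken (runs_agree (search_spec nX mX en1
  (Q := fun st' => exists par, search_tree es y E true false st' par) _))
    _ _ => //.
  by move=> st2 par _ ?; exists par.
move=> st2 [ag2 [par tr]]; have inp2 : input st2 by apply:
  input_agree ag2 _ _ inp1.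
have en2 := env_agree ag2 isT isT en1.
apply: runl_seq; apply: runs_weaken (runs_agree (mark_tree_spec (a := a_cand)
  nX mX'
  inp2 isT tr conn (Q := fun st' => input st' /\
    spanning_tree E y (edge_set es a_cand st')) _)) _ _ => //.
  move=> st3 inp3 aE; split=> //; exact: (tree_edges inp3 sc _ tr conn aE).
move=> st3 [ag3 [inp3 sp3]]; have en3 := env_agree ag3 isT isT en2.
apply: runl_seq; apply: runs_weaken (runs_agree (search_spec nX mX en3
  (Q := fun st' => exists par, search_tree es y E false true st' par) _))
    _ _ => //.
  by move=> st4 par' _ ?; exists par'.
move=> st4 [ag4 [par' tr']]; have inp4 : input st4 by apply:
  input_agree ag4 _ _ inp3.
apply: runs_weaken (runs_agree (mark_tree_spec (a := a_cand') nX mX'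
  inp4 isT tr' conn' (Q := fun st' => input st' /\
    spanning_tree (reverse E) y
       (edge_set [tuple of map (@swap _) es] a_cand' st')) _)) _ _ => //.
  move=> st5 inp5 aE; split=> //; exact: (tree_edges inp5 sc _ tr' conn' aE).
move=> st5 [ag5 [inp5 sp5]]; apply: HQ => //.
by rewrite (edge_set_agree _ (st := st3)) // => x; rewrite ag5.2 // ag4.2.
Qed.

Lemma reverse_edge_set a st :
  reverse (edge_set [tuple of map (@swap _) es] a st) = edge_set es a st.
Proof.
apply/setP => -[u v]; rewrite in_reverse; apply/imsetP/imsetP => -[j];
  rewrite inE => ja; rewrite ?tnth_map /swap => Ej; exists j;
    rewrite ?inE ?tnth_map //.
  by case: (tnth es j) Ej => /= p q [-> ->].
by rewrite -Ej.
Qed.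

Lemma card_reverse (F : {set 'I_n * 'I_n}) : #|reverse F| = #|F|.
Proof. by rewrite card_imset // => -[a b] [c d] [-> ->]. Qed.

Lemma card_cover (P1 P2 : pred 'I_m) :
  #|[pred j | P1 j || P2 j]| <= #|[set j | P1 j]| + #|[set j | P2 j]|.
Proof.
apply: leq_trans (leq_card_setU _ _); apply: subset_leq_card.
by apply/subsetP => j; rewrite !inE.
Qed.

(** The high cost [a] is charged to the iterations in [P] only. *)
Lemma sum_cost (P : pred 'I_m) a b :
  \sum_(i < m) (8 + (if P i then a else b)) <= #|P| * a + m * (8 + b).
Proof.
have -> : #|P| * a = \sum_(i < m) (if P i then a else 0).
  by rewrite -big_mkcond sum_nat_const.
have -> : m * (8 + b) = \sum_(i < m) (8 + b) by rewrite sum_nat_const card_ord.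
by rewrite -big_split /=; apply: leq_sum => i _; case: ifP => _; lia.
Qed.

Lemma strong_bridges_spec X st (Q : store -> Prop) : n < X -> 4 * m + 1 < X ->
  input st -> strongly_connected [set: 'I_n] E ->
  (forall st', edge_set es a_U st' = [set e | strong_bridge E e] -> Q st') ->
  runs (lin bridge_candidates * X + (6 + (2 * n * (lin bridge_step * X)
    + m * 18)))
    strong_bridges st Q.
Proof.
move=> nX mX inp sc HQ; have mX' : m < X by lia.
apply: runs_seq; apply: bridge_candidates_spec (inp) sc _ =>
  // st1 inp1 sp1 sp2.
pose cand (i : nat) := (arr st1 a_cand i != 0) || (arr st1 a_cand' i != 0).
(* A skipped edge costs 10: 3 for clearing its cell, 6 for the guard, 1 for [Skip]. With the loop
   overhead of 8 this gives the 18 per edge. *)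
pose f i := if cand i then lin bridge_step * X else 10.
pose I i st2 := input st2 /\ forall j : 'I_m, j < i ->
  (arr st2 a_U j != 0) = strong_bridge E (tnth es j).
have leS : \sum_(i < m) (8 + f i) <= 2 * n * (lin bridge_step * X) + m * 18.
  apply: leq_trans (sum_cost (fun i : 'I_m => cand i) _ _) _.
  rewrite leq_add2r leq_mul2r; apply/orP; right.
  apply: leq_trans (card_cover (fun j => arr st1 a_cand j != 0) _) _.
  rewrite mul2n -addnn leq_add //.
    by rewrite (card_arr inp1); apply: spanning_tree_card sp1.
  rewrite (card_arr inp1) -reverse_edge_set card_reverse.
  exact: spanning_tree_card sp2.
have [[_ rn1 rm1 _] ry1] := inp1.
apply: runs_weaken (runs_for (I := I) (M := m) (f := f) (Q := Q) _ _ _ _ _ _)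
  _ _ => //.
- move=> i st2 lt_im ag ri [inp2 Ui]; pose j := Ordinal lt_im.
  have lt_j (j' : 'I_m) : j' < i.+1 -> j' = j \/ j' < i :=
    @ltn_ordS _ _ lt_im j'.
  have candE : (arr st2 a_cand i + arr st2 a_cand' i != 0) = cand i.
    by rewrite !ag.2 // addn_eq0 negb_and.
  set st3 := sem (Put a_U (Reg r_i) (Const 0)) st2.
  have inp3 : input st3 by apply: input_agree (sem_agree st2 _) _ _ inp2.
  have ri3 : reg st3 r_i = i by [].
  have U3 (j' : 'I_m) :
    arr st3 a_U j' = if nat_of_ord j' == i then 0 else arr st2 a_U j'.
    by rewrite /= ri.
  have candE3 : (eval st3 (Add (Get a_cand (Reg r_i)) (Get a_cand' (Reg r_i)))
    != 0)
      = cand i by rewrite -candE /= ri.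
  rewrite /f; case: ifP candE3 => ci candE3.
    apply: runl_seq; apply: runl_sem => //; first by lia.
    apply: runl_if; [lia | move=> _ | by move=> E0; rewrite E0 in candE3].
    apply: runl_seq; apply: runl_sem => //; first by lia.
    apply: runl_seq.
    pose st4 := sem (Assign r_skip (Reg r_i)) st3.
    pose P st' := agree [:: r_k] [:: a_act] st4 st' /\
      (input st' /\ env es y (E :\ tnth es j) st').
    apply: (@runs_weaken (lin fill_without * X) _ _ _ P) => //.
      apply: (fill_without_spec (i := j)) => //.
    move=> st5 [ag5 [inp5 en5]].
    apply: runl_seq; apply: runs_weaken (runs_agree (strong_test_spec nX mX en5
      (Q := fun st' => (reg st' r_sc != 0) =
         strongly_connected [set: 'I_n] (E :\ tnth es j)) _)) _ _ => //.
    move=> st6 [ag6 scE]; apply: runl_sem => //; first by lia.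
    have ri6 : reg st6 r_i = j by rewrite ag6.1 // ag5.1.
    have U6 x : arr st6 a_U x = arr st3 a_U x by rewrite ag6.2 // ag5.2.
    split.
      have inp6 := input_agree ag6 isT isT inp5.
      by case: inp6.
    move=> j' /lt_j; rewrite /= ri6 ordE U6 U3.
    case: (eqVneq j' j) => [-> _|ne [E1|lt]]; last 2 first.
    + by rewrite E1 eqxx in ne.
    + by rewrite ifN; [apply: Ui | rewrite neq_ltn lt].
    by rewrite /strong_bridge (input_mem inp1) -scE negbK eqb0 negbK.
  rewrite -[10]/(3 + (6 + 1)); apply: runs_seq.
  apply: runs_sem => //.
  exists (6 + 1), st3; split=> //.
    apply: (@ExecIfFalse st3 st3 1 (Add (Get a_cand (Reg r_i))
      (Get a_cand' (Reg r_i)))).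
      by apply/eqP; rewrite -[_ == _]negbK candE3.
    exact: ExecSkip.
  split=> [|j' /lt_j]; first by case: inp3.
  have -> : arr (set_reg st3 r_i i.+1) a_U = arr st3 a_U by [].
  rewrite U3; case: (eqVneq (nat_of_ord j') i) => [E1 _|ne [E1|lt]];
    last 2 first.
  + by rewrite E1 eqxx in ne.
  + exact: Ui.
  (* Both candidate trees avoid this edge, so they keep the graph strongly connected after its
     deletion. *)
  apply/esym/negbTE; rewrite negb_and negbK; apply/orP; right.
  have E2 : j' = j by apply/val_inj.
  have [nc nc'] : arr st1 a_cand j = 0 /\ arr st1 a_cand' j = 0.
    by move/negbT: ci; rewrite /cand negb_or !negbK => /andP[/eqP ? /eqP ?].
  apply: spanning_trees_strong sp1 sp2 _ _; rewrite ?reverse_edge_set E2;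
    apply/subsetP => e /imsetP[j2]; rewrite inE => a2 ->;
    rewrite !inE (input_mem inp1) andbT (inj_eq (input_inj inp1));
    by apply: contraNneq a2 => ->; rewrite ?nc ?nc'.
- move=> st2 ag [inp2 U2]; apply: HQ; apply: (edge_setP inp2).
    by apply/subsetP => e; rewrite inE => /andP[].
  by move=> j; rewrite inE U2.
Qed.

End Subroutines.

(** * Listing components and finding a crossing edge *)

Definition incidence (st : store) (k x : nat) : Prop :=
  exists j, [/\ j < reg st r_np, arr st a_cid j = k & arr st a_cvx j = x].

Lemma stored_componentP n st k (x : 'I_n) :
  reflect (incidence st k x) (x \in stored_component n st k).
Proof.
rewrite inE; apply: (iffP existsP) => [[j /andP[/eqP ? /eqP ?]]|[j [lt Ek Ex]]].
  by exists j.
by exists (Ordinal lt); rewrite Ek Ex !eqxx.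
Qed.

Lemma incidence_push st st' k0 x0 : reg st' r_np = (reg st r_np).+1 ->
  (forall i, arr st' a_cid i = if i == reg st r_np then k0 else arr st a_cid i) ->
  (forall i, arr st' a_cvx i = if i == reg st r_np then x0 else arr st a_cvx i) ->
  forall k x, incidence st' k x <-> incidence st k x \/ k = k0 /\ x = x0.
Proof.
move=> nE kE xE k x; split=> [[j [lt Ek Ex]]|[[j [lt Ek Ex]]|[-> ->]]].
- rewrite nE ltnS leq_eqVlt in lt; case/orP: lt => [/eqP E|lt].
    by right; rewrite -Ek -Ex kE xE E eqxx.
  left; exists j; move: Ek Ex; by rewrite kE xE (ltn_eqF lt).
- by exists j; rewrite nE kE xE (ltn_eqF lt) ltnS ltnW.
- by exists (reg st r_np); rewrite nE kE xE eqxx.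
Qed.

Section Components.

Variables (n m : nat) (E : {set 'I_n * 'I_n}).
Variables (es : m.-tuple ('I_n * 'I_n)) (y : 'I_n).

Notation input st := (input E es y st).
Notation Ey st := (edge_set es a_Ey st).

Lemma components_spec X st (Q : store -> Prop) : n < X -> 4 * m + 1 < X ->
  input st -> strongly_connected [set: 'I_n] (Ey st) ->
  (forall st', stored_components n st' = sb_components (Ey st) -> Q st') ->
  runl X components st Q.
Proof.
move=> nX mX inp sc HQ; have mX' : m < X by lia. have X0 : 0 < X by lia.
apply: runl_seq; apply: fill_Ey_spec (inp) _ => // st1 _ _ en1.
apply: runl_seq; apply: (find_blocks_spec nX mX en1 (strongly_uconnected sc)).
move=> st2 par num bh hs en2 bf; have tr := bf_tree bf.
apply: runl_seq; apply: runl_sem => //; set st3 := sem _ _.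
apply: runl_seq.
have idE (st' : store) (v : 'I_n) : arr st' a_id =1 arr st2 a_id -> v != y ->
    arr st' a_id (bh v) = index (bh v) hs.
  by move=> aE vy; rewrite aE (bf_id bf) // (bf_heads bf) (bh_head tr vy).
pose I i st' := forall k (x : 'I_n), incidence st' k x <-> exists v : 'I_n,
  [/\ v < i, v != y, k = index (bh v) hs & x = v \/ bh v = v /\ x = par v].
apply: (runl_for (I := I) (M := n)) => //.
- exact: env_n en2.
- by move=> k x; split=> [[j []]|[v []]].
- move=> i st4 lt_in ag rk Ii; pose v := Ordinal lt_in.
  have rv : reg st4 r_k = v by [].
  have lt_v (w : 'I_n) : w < i.+1 -> w = v \/ w < i :=
    @ltn_ordS _ _ lt_in w.
  have E1 : arr st4 a_par v = if v != y then (par v).+1 else 0.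
    by rewrite ag.2 // (bf_par bf).
  move=> k x; set c := If _ _ _.
  have -> : incidence (set_reg (sem c st4) r_k i.+1) k x <->
    incidence (sem c st4) k x.
    by [].
  have [vy|vy] := eqVneq v y.
    have -> : sem c st4 = st4 by rewrite /c /= rv E1 vy eqxx.
    rewrite Ii; split=> -[w [lt wy]]; exists w; split=> //; first exact: ltnW.
    by case: (lt_v w lt) => // Ew; rewrite Ew vy eqxx in wy.
  have E2 : arr st4 a_bh v = bh v by rewrite ag.2 // (bf_bh bf).
  have E3 : arr st4 a_id (bh v) = index (bh v) hs.
    by apply: idE => // z; rewrite ag.2.
  pose sta := sem (push (Get a_id (Get a_bh (Reg r_k))) (Reg r_k)) st4.
  have incA k' x' : incidence sta k' x' <->
      incidence st4 k' x' \/ k' = index (bh v) hs /\ x' = v.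
    apply: incidence_push => [|z|z]; rewrite /= ?addn1 //.
      by rewrite rv E2 E3.
    by rewrite rv.
  case: (eqVneq (bh v) v) => [bv|nbv].
    pose stb := sem (push (Get a_id (Get a_bh (Reg r_k)))
      (Defs.Sub (Get a_par (Reg r_k)) (Const 1))) sta.
    have -> : sem c st4 = stb.
      rewrite /c /stb /sta; cbn [sem eval];
        rewrite rv E1 vy /= rv E2 bv eqxx //.
    have -> : incidence stb k x <->
        incidence sta k x \/ k = index (bh v) hs /\ x = par v :> nat.
      apply: incidence_push => [|z|z]; rewrite /= ?addn1 //.
        by rewrite rv E2 E3.
      by rewrite rv E1 vy subn1.
    rewrite incA Ii; split.
      case=> [[[w [lt wy -> H]]|[-> /val_inj ->]]|[-> /val_inj ->]].
      + by exists w; split=> //; apply: ltnW.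
      + by exists v; split=> //; left.
      + by exists v; split=> //; right.
    case=> w [/lt_v[-> _ -> [->|[_ ->]]|lt wy -> H]].
    + by left; right.
    + by right.
    + by left; left; exists w.
  have -> : sem c st4 = sta.
    by rewrite /c /sta; cbn [sem eval];
      rewrite rv E1 vy /= rv E2 ordE (negbTE nbv).
  rewrite incA Ii; split.
    case=> [[w [lt wy -> H]]|[-> /val_inj ->]].
      by exists w; split=> //; apply: ltnW.
    by exists v; split=> //; left.
  case=> w [/lt_v[-> _ -> [->|[bv _]]|lt wy -> H]].
  + by right.
  + by rewrite bv eqxx in nbv.
  + by left; exists w.
move=> st4 ag In.
have nb4 : reg st4 r_nb = size hs by rewrite ag.1 // -(bf_size bf).
apply: runl_sem => //; apply: HQ.
set st5 := sem _ _.
(* Without heads the root is the only vertex, since any other vertex lies below a head. *)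
case hs_nil: hs => [|h0 hs'].
  have Vy v : v = y.
    apply/eqP; apply: contraT => vy.
    by have := bf_heads bf (bh v); rewrite (bh_head tr vy) hs_nil.
  have [_ ->] := sb_components_trivial (Ey st) Vy.
  have st5E : st5 = set_reg (sem (push (Const 0) (Reg r_y))
      (set_reg st4 r_nc 0)) r_nc 1.
    by rewrite /st5 /= nb4 hs_nil.
  have nc5 : reg st5 r_nc = 1 by rewrite st5E.
  apply/setP => C; rewrite inE /stored_components nc5.
  have compE k : k < 1 -> stored_component n st5 k = setT.
    case: k => // _; apply/setP => x; rewrite in_setT; apply/stored_componentP.
    have -> : incidence st5 0 x <-> incidence st4 0 x \/ 0 = 0 /\ x = y :> nat.
      rewrite st5E; apply: incidence_push => [|z|z]; rewrite /= ?addn1 //.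
      have [_ ry] : env es y (Ey st) st4 /\ reg st4 r_y = y.
        by split; [apply: env_agree ag _ _ _ => //; case: en2
                  | rewrite ag.1 //; exact: env_y en2].
      by rewrite ry.
    by right; rewrite (Vy x).
  apply/imsetP/eqP => [[k _ ->]|->]; first exact: compE.
  by exists ord0; rewrite ?compE.
have st5E : st5 = set_reg st4 r_nc (size hs).
  by rewrite /st5 /= nb4 hs_nil.
have h0y : h0 != y.
  have := bf_heads bf h0; rewrite hs_nil mem_head => /esym; exact: head_neq.
rewrite (sb_components_blocks tr h0y sc).
have compE h : h \in hs -> stored_component n st5 (index h hs)
  = block y par bh h.
  move=> hh; have hh' : is_head (Ey st) y par num h by rewrite -(bf_heads bf).
  apply/setP => x; apply/stored_componentP/idP => [|xB].
    have -> : incidence st5 (index h hs) x <-> incidence st4 (index h hs) x.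
      by rewrite st5E.
    rewrite In => -[v [_ vy Eh Ex]].
    have bv : bh v \in hs by rewrite (bf_heads bf) (bh_head tr vy).
    have {}bv : bh v = h.
      by rewrite -(nth_index y hh) Eh nth_index.
    case: Ex => [->|[Ev ->]]; first by rewrite -bv bh_in_block.
    by rewrite -bv Ev par_in_block.
  rewrite st5E; apply/In; move: xB; rewrite in_block.
  case/orP=> [/eqP ->|/andP[xy /eqP bx]].
    exists h; split=> //; [exact: head_neq hh' | by rewrite (head_bh tr hh') |].
    by right; rewrite (head_bh tr hh').
  by exists x; split=> //; [rewrite bx | left].
have nc5 : reg st5 r_nc = size hs by rewrite st5E.
apply/setP => C; apply/imsetP/imsetP => [[k _ ->]|[h hh ->]].
  have ltk : k < size hs by rewrite -nc5.
  exists (nth y hs k);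
    last by rewrite -compE ?mem_nth // index_uniq ?(bf_uniq bf).
  by have := mem_nth y ltk; rewrite (bf_heads bf).
have hhs : h \in hs by rewrite (bf_heads bf).
have lt : index h hs < reg st5 r_nc by rewrite nc5 index_mem.
by exists (Ordinal lt); rewrite ?compE.
Qed.

(** Promises [crossing] instead of [eligible]; the bound on the number of rounds depends on it. *)
Lemma find_edge_spec X st (Q : store -> Prop) : n < X -> 4 * m + 1 < X ->
  input st -> strongly_connected [set: 'I_n] (Ey st) ->
  ~~ strongly_biconnected [set: 'I_n] (Ey st) ->
  strongly_biconnected [set: 'I_n] E ->
  (forall st' (i : 'I_m), reg st' r_e = i -> crossing (Ey st) (tnth es i) ->
     Q st') ->
  runl X find_edge st Q.
Proof.
move=> nX mX inp sc nsb sbE HQ; have mX' : m < X by lia. have X0 : 0 < X by lia.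
apply: runl_seq; apply: fill_Ey_spec (inp) _ => // st1 _ _ en1.
apply: runl_seq; apply: (find_blocks_spec nX mX en1 (strongly_uconnected sc)).
move=> st2 par num bh hs en2 bf; have tr := bf_tree bf.
have [h hh] : exists h, is_head (Ey st) y par num h.
  move: nsb; rewrite (sb_heads tr sc) -ltnNge => /card_gt1P[h [h2 []]].
  by rewrite inE; exists h.
have hy := head_neq hh.
pose common u w := [|| u == w, [&& u != y, w != y & bh u == bh w],
  (u != y) && (w == par (bh u)) | (w != y) && (u == par (bh w))].
have commonP u w : reflect (exists2 h, is_head (Ey st) y par num h &
    (u \in block y par bh h) && (w \in block y par bh h)) (common u w).
  exact: common_blockP tr hy.
pose cross (j : 'I_m) := ~~ common (tnth es j).1 (tnth es j).2.
have crossP j : reflect (crossing (Ey st) (tnth es j)) (cross j).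
  apply: (iffP negP) => [nc C|cr /commonP[g hg]].
    rewrite (sb_components_blocks tr hy sc) => /imsetP[g hg ->].
    by apply/negP => H; apply: nc; apply/commonP; exists g.
  apply/negP/cr; rewrite (sb_components_blocks tr hy sc); exact: imset_f.
(* Later crossing edges overwrite earlier ones, so [r_e] is meaningful once one has been met;
   [crossing_exists] provides one. *)
pose I i st' := forall j : 'I_m, j < i -> cross j ->
  exists2 j' : 'I_m, reg st' r_e = j' & cross j'.
apply: (runl_for (I := I) (M := m)) => //.
- exact: env_m en2.
- move=> i st3 lt_im ag rk Ii j; pose k := Ordinal lt_im.
  have rkk : reg st3 r_k = k by [].
  have en3 := env_agree ag isT isT en2; have [sk dk] := env_es en3 k.
  set u := (tnth es k).1 in sk; set w := (tnth es k).2 in dk.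
  have pE (v : 'I_n) : arr st3 a_par v = if v != y then (par v).+1 else 0.
    by rewrite ag.2 // (bf_par bf).
  have bE (v : 'I_n) : v != y -> arr st3 a_bh v = bh v.
    by move=> vy; rewrite ag.2 // (bf_bh bf).
  have bhy (v : 'I_n) : v != y -> bh v != y.
    by move=> vy; apply: head_neq (bh_head tr vy).
  have bothE (a b : bool) : (1 < a + b) = a && b by case: a b => [] [].
  have eE : reg (sem crossing_step st3) r_e =
      if common u w then reg st3 r_e else k.
    have -> : common u w = (eval (set_reg (set_reg st3 r_v u) r_w w)
      common_expr != 0).
      rewrite /= !bothE !addn_eq0 !eqb0 !negb_and !negbK /common !pE !addn1 !ordE.
      congr orb; congr orb; last congr orb.
      - case: (eqVneq u y) => //= uy; case: (eqVneq w y) => //= wy.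
        by rewrite !bE // negbK.
      - case: (eqVneq u y) => //= uy.
        by rewrite bE // pE bhy // eqSS ordE negbK eq_sym.
      - case: (eqVneq w y) => //= wy.
        by rewrite bE // pE bhy // eqSS ordE negbK eq_sym.
    by cbn [sem crossing_step eval]; rewrite /= rkk sk dk; case: ifP.
  have lt_k (j' : 'I_m) : j' < i.+1 -> j' = k \/ j' < i :=
    @ltn_ordS _ _ lt_im j'.
  have -> : reg (set_reg (sem crossing_step st3) r_k i.+1) r_e =
    reg (sem crossing_step st3) r_e by [].
  rewrite eE; case: (boolP (common u w)) => [co|nc]; last by exists k.
  by case/lt_k=> [->|lt]; [rewrite /cross co | apply: Ii].
move=> st3 ag Im; have tF : treeable y (Ey st) by exists par, num, bh.
have [e eE cr] := crossing_exists tF (edge_set_sub inp a_Ey st) sc nsb sbE.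
have [j Ej] := input_tnth inp eE; rewrite -{}Ej in cr.
have [j' re /crossP cr'] := Im j (ltn_ord j) (introT (crossP j) cr).
exact: HQ re cr'.
Qed.

End Components.

Definition linear_subroutines : subroutines :=
  Subroutines strong_bridges tree reverse_tree test_Ey components find_edge
    test_without.

(** * The contracts of the subroutines *)

Section Correctness.

Variables (n m : nat) (E : {set 'I_n * 'I_n}).
Variables (es : m.-tuple ('I_n * 'I_n)) (y : 'I_n).
Hypothesis sbE : strongly_biconnected [set: 'I_n] E.

Notation input st := (input E es y st).
Notation Ey st := (edge_set es a_Ey st).
Let X := n + 4 * m + 2.

Let scE : strongly_connected [set: 'I_n] E.
Proof. by case/andP: sbE. Qed.

Let nX : n < X. Proof. rewrite /X; lia. Qed.
Let mX : 4 * m + 1 < X. Proof. rewrite /X; lia. Qed.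

Lemma computes_strong_bridges : computes (fun st => input st) strong_bridges
  [::] [:: a_U] (fun st => edge_set es a_U st = [set e | strong_bridge E e]).
Proof.
apply: computes_runs => // st inp; eexists.
exact: (strong_bridges_spec nX mX inp scE).
Qed.

Lemma computes_tree : computes (fun st => input st) tree [::] [:: a_T]
  (fun st => spanning_tree E y (edge_set es a_T st)).
Proof.
apply: computes_runs => // st inp; eexists.
exact: (tree_spec nX mX inp scE).
Qed.

Lemma computes_reverse_tree : computes (fun st => input st) reverse_tree
  [::] [:: a_Ty] (fun st => spanning_tree (reverse E) y
                     (edge_set [tuple of map (@swap _) es] a_Ty st)).
Proof.
apply: computes_runs => // st inp; eexists.
exact: (reverse_tree_spec nX mX inp scE).
Qed.

Lemma computes_test_Ey : computes (fun st => input st) test_Ey [:: r_ans] [::]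
  (fun st => (reg st r_ans != 0) = strongly_biconnected [set: 'I_n] (Ey st)).
Proof.
apply: computes_runs => // st inp; eexists.
apply: runs_weaken (runs_agree (test_Ey_spec nX mX inp (fun _ => id))) _ _ =>
  //.
by move=> st' [ag ->]; rewrite (edge_set_agree _ (st := st)) // => x;
  rewrite ag.2.
Qed.

Lemma computes_components :
  computes (fun st => input st /\ strongly_connected [set: 'I_n] (Ey st))
    components [:: r_nc; r_np] [:: a_cid; a_cvx]
    (fun st => stored_components n st = sb_components (Ey st)).
Proof.
apply: computes_runs => // st [inp sc]; eexists.
apply: runs_weaken (runs_agree (components_spec nX mX inp sc (fun _ => id)))
  _ _ => //.
by move=> st' [ag ->]; rewrite (edge_set_agree _ (st := st)) // => x;
  rewrite ag.2.
Qed.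

Lemma treeable_strong (F : {set 'I_n * 'I_n}) :
  strongly_connected [set: 'I_n] F -> treeable y F.
Proof. by move=> sc; apply/treeable_uconnected/strongly_uconnected. Qed.

Lemma computes_find_edge :
  computes (fun st => [/\ input st, strongly_connected [set: 'I_n] (Ey st),
                          ~~ strongly_biconnected [set: 'I_n] (Ey st)
                        & stored_components n st = sb_components (Ey st)])
    find_edge [:: r_e] [::]
    (fun st => exists2 i : 'I_m,
                 reg st r_e = i & eligible E (Ey st) (tnth es i)).
Proof.
apply: computes_runs => // st [inp sc nsb _]; eexists.
apply: runs_weaken (runs_agree (find_edge_spec (Q := fun st' => exists2 i :
  'I_m,
  reg st' r_e = i & crossing (Ey st) (tnth es i)) nX mX inp sc nsb sbE _))
    _ _ => //.
  by move=> st' i ? ?; exists i.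
move=> st' [ag [i ri cr]]; exists i => //.
rewrite (edge_set_agree _ (st := st)); last by move=> x; rewrite ag.2.
exact: crossing_eligible (treeable_strong sc) sc (input_mem inp i) cr.
Qed.

Lemma computes_test_without (i : 'I_m) :
  computes (fun st => input st /\ reg st r_e = i) test_without [:: r_ans] [::]
    (fun st => (reg st r_ans != 0) =
               strongly_biconnected [set: 'I_n] (E :\ tnth es i)).
Proof.
apply: computes_runs => // st [inp ri]; eexists.
exact: (test_without_spec nX mX inp ri).
Qed.

End Correctness.

Lemma linear_subroutines_correct : correct linear_subroutines.
Proof.
move=> n m E es y sbE /=; split; [| | | split].
- exact: computes_strong_bridges.
- exact: computes_tree.
- move=> st [inp _]; exact: computes_reverse_tree.
- exact: computes_test_Ey.
- exact: computes_components.
- exact: computes_find_edge.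
- exact: computes_test_without.
Qed.

(** * The algorithm *)

Definition reverse_edges : cmd :=
  (Put a_rsrc (Reg r_e) (Get a_dst (Reg r_e)) ;;
   Put a_rdst (Reg r_e) (Get a_src (Reg r_e)))%cmd.

Definition join_trees : cmd :=
  Put a_Ey (Reg r_e) (Add (Get a_T (Reg r_e)) (Get a_Ty (Reg r_e))).

Definition augment : cmd :=
  (components ;; find_edge ;; Put a_Ey (Reg r_e) (Const 1) ;; test_Ey)%cmd.

Definition copy_bridges : cmd := Put a_B (Reg r_e) (Get a_U (Reg r_e)).

Definition bbridge_step : cmd :=
  If (Get a_Ey (Reg r_e))
    (If (Eq (Get a_B (Reg r_e)) (Const 0))
       (test_without ;;
        If (Eq (Reg r_ans) (Const 0)) (Put a_B (Reg r_e) (Const 1)) Skip)%cmd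
       Skip)
    Skip.

Lemma algorithmE : algorithm linear_subroutines =
  (strong_bridges ;; tree ;; for_to r_e r_m reverse_edges ;; reverse_tree ;;
   for_to r_e r_m join_trees ;; test_Ey ;;
   While (Eq (Reg r_ans) (Const 0)) augment ;;
   for_to r_e r_m copy_bridges ;; for_to r_e r_m bbridge_step)%cmd.
Proof. by []. Qed.

Section Algorithm.

Variables (n m : nat) (E : {set 'I_n * 'I_n}).
Variables (es : m.-tuple ('I_n * 'I_n)) (y : 'I_n).
Hypothesis sbE : strongly_biconnected [set: 'I_n] E.

Notation input st := (input E es y st).
Notation Ey st := (edge_set es a_Ey st).
Let X := n + 4 * m + 2.
(** The unit of the global budget: [O(n)] calls of cost [O(X)] each. *)
Let Z := n * X.

Let scE : strongly_connected [set: 'I_n] E.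
Proof. by case/andP: sbE. Qed.

Let nX : n < X. Proof. rewrite /X; lia. Qed.
Let mX : 4 * m + 1 < X. Proof. rewrite /X; lia. Qed.
Let mX' : m < X. Proof. rewrite /X; lia. Qed.
Let n_gt0 : 0 < n. Proof. exact: leq_trans (ltn_ord y). Qed.
Let X_gt0 : 0 < X. Proof. by rewrite /X addn2. Qed.
Let leXZ : X <= Z. Proof. exact: leq_pmull. Qed.

Lemma runz_runl c st (Q : store -> Prop) : runl X c st Q -> runs (lin c * Z)
  c st Q.
Proof. by move=> H; apply: runs_weaken H _ _ => //;
  rewrite leq_mul2l leXZ orbT. Qed.

Lemma runz_seq C1 C2 c1 c2 st (Q : store -> Prop) :
  runs (C1 * Z) c1 st (fun st' => runs (C2 * Z) c2 st' Q) ->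
  runs ((C1 + C2) * Z) (c1 ;; c2)%cmd st Q.
Proof. by rewrite mulnDl; apply: runs_seq. Qed.

Definition bridges_stored (st : store) : Prop :=
  input st /\ edge_set es a_U st = [set e | strong_bridge E e].

Lemma bridges_stored_agree rs ars st st' : agree rs ars st st' ->
  all (fun x => x \notin rs) [:: r_n; r_m; r_y] ->
  all (fun a => a \notin ars) [:: a_src; a_dst] -> a_U \notin ars ->
  bridges_stored st -> bridges_stored st'.
Proof.
move=> ag H1 H2 H3 [inp U]; split; first exact: input_agree ag H1 H2 inp.
by rewrite (edge_set_agree _ (st := st)) // => x; rewrite ag.2.
Qed.

Definition trees_joined (st : store) : Prop :=
  bridges_stored st /\ exists T Ty, [/\ spanning_tree E y T,
    spanning_tree (reverse E) y Ty & Ey st = T :|: reverse Ty].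

Definition setup_coef : nat :=
  lin bridge_candidates + 6 + 2 * lin bridge_step + 18.

Lemma bridges_phase st : input st ->
  runs (setup_coef * Z) strong_bridges st bridges_stored.
Proof.
move=> inp; apply: runs_weaken (runs_agree (strong_bridges_spec (Q := fun st' =>
  edge_set es a_U st' = [set e | strong_bridge E e]) nX mX inp scE _)) _ _ =>
    //.
  rewrite /setup_coef; move: (lin bridge_candidates) (lin bridge_step) => c1 c2.
  have h1 : c1 * X <= c1 * Z by rewrite leq_mul2l leXZ orbT.
  have -> : 2 * n * (c2 * X) = 2 * c2 * Z by rewrite /Z; lia.
  have h2 : m < Z := leq_trans mX' leXZ.
  clear -h1 h2; move: X Z h1 h2 => X' Z' h1 h2; rewrite !mulnDl; lia.
by move=> st' [ag U]; split=> //; apply: input_agree ag _ _ inp.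
Qed.

Lemma join_phase C c st (Q : store -> Prop) : bridges_stored st ->
  (forall st', trees_joined st' -> runs (C * Z) c st' Q) ->
  runs ((lin tree + (lin (for_to r_e r_m reverse_edges) + (lin reverse_tree +
     (lin (for_to r_e r_m join_trees) + C)))) * Z)
    (tree ;; for_to r_e r_m reverse_edges ;; reverse_tree ;;
     for_to r_e r_m join_trees ;; c)%cmd st Q.
Proof.
move=> bs Hc; have [inp _] := bs.
apply/runz_seq/runz_runl; apply: runs_weaken (runs_agree (tree_spec (Q :=
  fun st' =>
  spanning_tree E y (edge_set es a_T st')) nX mX inp scE _)) _ _ => //.
move=> st1 [ag1 T1]; have bs1 := bridges_stored_agree ag1 isT isT isT bs.
have [inp1 _] := bs1; have [[_ _ rm1 _] _] := inp1.
apply/runz_seq/runz_runl.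
apply: (runl_for (I := fun _ _ => True) (M := m)) => // st2 ag2 _.
have bs2 := bridges_stored_agree ag2 isT isT isT bs1; have [inp2 _] := bs2.
apply/runz_seq/runz_runl; apply: runs_weaken (runs_agree (reverse_tree_spec
  (Q := fun st' => spanning_tree (reverse E)
    y (edge_set [tuple of map (@swap _) es]
     a_Ty st')) nX mX inp2 scE _)) _ _ => //.
move=> st3 [ag3 T3]; have bs3 := bridges_stored_agree ag3 isT isT isT bs2.
have [inp3 _] := bs3; have [[_ _ rm3 _] _] := inp3.
have T13 : edge_set es a_T st3 = edge_set es a_T st1.
  by apply: edge_set_agree => x; rewrite ag3.2 // ag2.2.
apply/runz_seq/runz_runl.
pose I i st' := forall j : 'I_m, j < i ->
  (arr st' a_Ey j != 0) = (arr st3 a_T j + arr st3 a_Ty j != 0).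
apply: (runl_for (I := I) (M := m)) => //.
  move=> i st4 lt_im ag rk Ii j; rewrite /= rk ltnS leq_eqVlt.
  case: (eqVneq (j : nat) i) => [->|ne /= /Ii//] _.
  by rewrite !ag.2.
move=> st4 ag4 Im; have bs4 := bridges_stored_agree ag4 isT isT isT bs3.
apply: Hc; split=> //; exists (edge_set es a_T st1),
  (edge_set [tuple of map (@swap _) es] a_Ty st3).
split=> //; have [inp4 _] := bs4; apply: (edge_setP inp4).
  by rewrite reverse_edge_set subUset !(edge_set_sub inp4).
move=> j; rewrite Im // reverse_edge_set -T13 inE !(mem_edge_set inp4).
by rewrite addn_eq0 negb_and.
Qed.

Lemma trees_joined_strong st : trees_joined st ->
  strongly_connected [set: 'I_n] (Ey st) /\ #|Ey st| <= 2 * n.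
Proof.
move=> [_ [T [Ty [T1 T2 ->]]]]; split.
  by apply: spanning_trees_strong T1 T2 _ _; [apply: subsetUl | apply:
    subsetUr].
apply: leq_trans (leq_card_setU _ _) _; rewrite card_reverse mul2n -addnn.
by rewrite leq_add ?(spanning_tree_card T1) ?(spanning_tree_card T2).
Qed.

(** A round adds at most one edge and removes at least one component, so the potential
    [#|Ey st| + k] keeps its initial bound [2 * n + n]. *)
Definition augmented (k : nat) (st : store) : Prop :=
  [/\ bridges_stored st, strongly_connected [set: 'I_n] (Ey st),
      k = #|sb_components (Ey st)|, #|Ey st| + k <= 3 * n
    & (reg st r_ans != 0) = strongly_biconnected [set: 'I_n] (Ey st)].

Lemma augment_step k st : augmented k st -> reg st r_ans = 0 ->
  runl X augment st (fun st' => exists2 k', k' < k & augmented k' st').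
Proof.
move=> [bs sc kE le_k ansE] ans0; have [inp _] := bs.
have nsb : ~~ strongly_biconnected [set: 'I_n] (Ey st) by rewrite -ansE ans0.
apply: runl_seq; apply: runs_weaken (runs_agree (components_spec (Q := fun=>
  True)
  nX mX inp sc _)) _ _ => //.
move=> st1 [ag1 _]; have bs1 := bridges_stored_agree ag1 isT isT isT bs.
have [inp1 _] := bs1.
have E1 : Ey st1 = Ey st by apply: edge_set_agree => x; rewrite ag1.2.
rewrite -E1 in kE le_k sc nsb; apply: runl_seq.
apply: runs_weaken (runs_agree (find_edge_spec (Q := fun st' => exists2 i :
  'I_m,
  reg st' r_e = i & crossing (Ey st1) (tnth es i)) nX mX inp1 sc nsb sbE _))
    _ _ => //.
  by move=> st' i ? ?; exists i.
move=> st2 [ag2 [j rj cr]]; have bs2 :=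
  bridges_stored_agree ag2 isT isT isT bs1.
have [inp2 _] := bs2.
have E2 : Ey st2 = Ey st1 by apply: edge_set_agree => x; rewrite ag2.2.
rewrite -{}E2 in kE le_k sc nsb cr.
apply: runl_seq; apply: runl_sem => //.
set st3 := sem _ _.
have bs3 : bridges_stored st3.
  by apply: bridges_stored_agree (sem_agree st2 _) _ _ _ bs2.
have [inp3 _] := bs3.
have E3 : Ey st3 = tnth es j |: Ey st2.
  apply: (edge_setP inp3) => [|i].
    by rewrite subUset sub1set (input_mem inp3) (edge_set_sub inp3).
  rewrite !inE (inj_eq (input_inj inp3)) (mem_edge_set inp3) /= rj ordE.
  by case: (i == j).
have sc3 : strongly_connected [set: 'I_n] (Ey st3).
  by rewrite E3; apply: strongly_connectedS sc; apply: subsetUr.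
(* A one-vertex graph is strongly biconnected, so the loop would have stopped. *)
have [v vy] : exists v, v != y.
  case: (pickP (fun v => v != y)) => [v vy|Vy]; first by exists v.
  case/negP: nsb; apply: (proj1 (sb_components_trivial (y := y) _ _)) => v.
  by apply/eqP; rewrite -[_ == _]negbK Vy.
have lt3 : #|sb_components (Ey st3)| < k.
  rewrite kE E3; apply: (crossing_merges vy) => //; first exact:
    treeable_strong.
  by rewrite -E3; apply: treeable_strong.
apply: runs_weaken (runs_agree (test_Ey_spec (Q := fun st' =>
  (reg st' r_ans != 0) =
  strongly_biconnected [set: 'I_n] (Ey st3)) nX mX inp3 _)) _ _ => //.
move=> st4 [ag4 ans4].
have E4 : Ey st4 = Ey st3 by apply: edge_set_agree => x; rewrite ag4.2.
exists #|sb_components (Ey st3)|; first exact: lt3.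
split; rewrite ?E4.
- exact: bridges_stored_agree ag4 isT isT isT bs3.
- exact: sc3.
- reflexivity.
- have le3 : #|Ey st3| <= #|Ey st2|.+1.
    by rewrite E3 cardsU1 -[leqRHS]add1n leq_add2r leq_b1.
  apply: leq_trans le_k; apply: leq_trans (leq_add le3 (leqnn _)) _.
  by rewrite addSn -addnS leq_add2l.
- exact: ans4.
Qed.

Lemma augment_phase C c st (Q : store -> Prop) : trees_joined st ->
  (forall st', bridges_stored st' -> #|Ey st'| <= 3 * n ->
     strongly_biconnected [set: 'I_n] (Ey st') -> runs (C * Z) c st' Q) ->
  runs ((lin test_Ey + (12 + 2 * lin augment + C)) * Z)
    (test_Ey ;; While (Eq (Reg r_ans) (Const 0)) augment ;; c)%cmd st Q.
Proof.
move=> tj Hc; have [sc le_n] := trees_joined_strong tj; have [bs _] := tj.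
have [inp _] := bs.
apply/runz_seq/runz_runl.
apply: runs_weaken (runs_agree (test_Ey_spec (Q := fun st' =>
  (reg st' r_ans != 0) =
  strongly_biconnected [set: 'I_n] (Ey st)) nX mX inp _)) _ _ => //.
move=> st1 [ag1 ans1]; have bs1 := bridges_stored_agree ag1 isT isT isT bs.
have E1 : Ey st1 = Ey st by apply: edge_set_agree => x; rewrite ag1.2.
rewrite -{}E1 in sc le_n ans1.
have le_k : #|sb_components (Ey st1)| <= n.
  by rewrite -[leqRHS]card_ord; exact:
    (card_sb_components (treeable_strong y sc) sc).
have aug1 : augmented #|sb_components (Ey st1)| st1.
  by split=> //; rewrite (leq_trans (leq_add le_n le_k)) // mulSn addnC.
have step k st2 : augmented k st2 -> agree (wregs augment) (warrs augment)
  st1 st2 ->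
    eval st2 (Eq (Reg r_ans) (Const 0)) != 0 ->
    runs (lin augment * X) augment st2 (fun st3 => exists2 k',
      k' < k & augmented k' st3).
  by move=> aug _ /=; rewrite eqb0 negbK => /eqP; apply: augment_step.
apply: runz_seq; apply: runs_weaken (runs_while (f := fun=> lin augment * X)
  aug1 step) _ _.
  rewrite sum_nat_const card_ord -[(ecost _).+1]/4; clear step.
  move: (lin augment) le_k => a; move: #|_| => k le_k.
  (* There are at most [k.+1 <= n + 1 <= 2 * n] guarded rounds. The guards cost at most [4 + 8 * n],
     which [12 * Z] covers. *)
  have le1 : k.+1 * (4 + a * X) <= (2 * n) * (4 + a * X).
    by rewrite leq_mul2r; apply/orP; right; lia.
  have le2 : n <= Z by rewrite leq_pmulr // /X addn2.
  have E3 : 2 * n * (a * X) = 2 * a * Z by rewrite /Z; lia.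
  rewrite [X in _ <= X]mulnDr E3 in le1; rewrite mulnDl.
  clear -le1 le2 n_gt0; move: Z (k.+1 * _) le1 le2 => Z' t; move:
    (2 * a * Z'); lia.
move=> st2 [k [bs2 sc2 kE le_k2 ans2] /= e0]; apply: Hc => //.
  exact: leq_trans (leq_addr _ _) le_k2.
by rewrite -ans2; move/eqP: e0; rewrite eqb0.
Qed.

(** An edge outside [E_y] is neither kind of bridge, since [E_y] survives its deletion; a strong
    bridge is always a b-bridge. So only the at most [3 * n] edges of [E_y] are tested. *)
Lemma b_bridge_phase st : bridges_stored st -> #|Ey st| <= 3 * n ->
  strongly_biconnected [set: 'I_n] (Ey st) ->
  runs ((lin (for_to r_e r_m copy_bridges) + (6 + 3 * lin bbridge_step + 12))
    * Z)
    (for_to r_e r_m copy_bridges ;; for_to r_e r_m bbridge_step)%cmd st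
    (fun st' => edge_set es a_B st' = [set e | b_bridge E e]).
Proof.
move=> bs le_n sbEy; have [inp U] := bs; have [[_ _ rm _] _] := inp.
pose I1 i st' := forall j : 'I_m, j < i ->
  (arr st' a_B j != 0) = (arr st a_U j != 0).
apply/runz_seq/runz_runl; apply: (runl_for (I := I1) (M := m)) => //.
  move=> i st1 lt_im ag rk Ii j; rewrite /= rk ltnS leq_eqVlt.
  case: (eqVneq (j : nat) i) => [->|ne /= /Ii//] _.
  by rewrite ag.2.
move=> st1 ag1 I1m; have inp1 : input st1 by apply: input_agree ag1 _ _ inp.
have [[_ _ rm1 _] _] := inp1.
have E1 : Ey st1 = Ey st by apply: edge_set_agree => x; rewrite ag1.2.
rewrite -{}E1 in le_n sbEy.
have B1 (j : 'I_m) : (arr st1 a_B j != 0) = strong_bridge E (tnth es j).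
  by rewrite I1m // -(mem_edge_set inp) U inE.
have strong_b e : strong_bridge E e -> b_bridge E e.
  by case/andP=> eE nsc;
    rewrite /b_bridge eE /strongly_biconnected negb_and nsc.
(* Skipping an edge costs 3 for the guard and 1 for [Skip]; with the loop overhead of 8 this is the
   12 per edge. *)
pose f i := if arr st1 a_Ey i != 0 then lin bbridge_step * X else 4.
pose I i st2 := input st2 /\ forall j : 'I_m, (arr st2 a_B j != 0) =
  if j < i then b_bridge E (tnth es j) else strong_bridge E (tnth es j).
have leS : \sum_(i < m) (8 + f i) <= 3 * n * (lin bbridge_step * X) + m * 12.
  apply: leq_trans (sum_cost (fun i : 'I_m => arr st1 a_Ey i != 0) _ _) _.
  rewrite leq_add2r leq_mul2r; apply/orP; right.
  apply: leq_trans le_n; rewrite -(card_arr inp1); apply: subset_leq_card.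
  by apply/subsetP => j; rewrite !inE.
apply: runs_weaken (runs_for (I := I) (M := m) (f := f) (Q := fun st' =>
  edge_set es a_B st' = [set e | b_bridge E e]) _ _ _ _ _ _) _ _ => //.
- move=> i st2 lt_im ag ri [inp2 Bi]; pose j := Ordinal lt_im.
  have eyE : arr st2 a_Ey i = arr st1 a_Ey i by rewrite ag.2.
  have inpS st' x : input st' -> input (set_reg st' r_e x) by [].
  have step st' : input st' -> (forall j' : 'I_m, j' != j ->
        arr st' a_B j' = arr st2 a_B j') ->
      (arr st' a_B j != 0) = b_bridge E (tnth es j) ->
        I i.+1 (set_reg st' r_e i.+1).
    move=> inp' B' Bj; split; first exact: inpS.
    move=> j'; have -> : arr (set_reg st' r_e i.+1) a_B = arr st' a_B by [].
    have [->|ne] := eqVneq j' j; first by rewrite Bj ltnSn.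
    rewrite B' // Bi ltnS [j' <= i]leq_eqVlt.
    by have /negbTE -> : (j' : nat) != i by [].
  have Bj2 : (arr st2 a_B j != 0) = strong_bridge E (tnth es j).
    by rewrite Bi ltnn.
  rewrite /f; case: ifP => ey.
    apply: runl_if => // /= [_|]; last by rewrite ri eyE => /eqP;
      rewrite (negbTE ey).
    apply: runl_if => //= [B0|].
      rewrite ri eqb0 negbK in B0.
      apply: runl_seq; apply: runs_weaken (runs_agree (test_without_spec (i :=
        j)
        (Q := fun st' => (reg st' r_ans != 0) =
           strongly_biconnected [set: 'I_n] (E :\ tnth es j))
             nX mX inp2 ri _)) _ _ => //.
      move=> st3 [ag3 ans3]; have inp3 := input_agree ag3 isT isT inp2.
      have r3 : reg st3 r_e = j by rewrite ag3.1.
      have B3 x : arr st3 a_B x = arr st2 a_B x by rewrite ag3.2.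
      have bj : b_bridge E (tnth es j) = (reg st3 r_ans == 0).
        by rewrite /b_bridge (input_mem inp) -ans3 negbK.
      apply: runl_sem => //=; case: (reg st3 r_ans =P 0) => [a0|a0] /=.
        apply: step => // [j' ne|].
          by rewrite /= r3 ordE (negbTE ne) B3.
        by rewrite /= r3 eqxx bj a0.
      apply: step => //.
      rewrite B3 -[arr st2 a_B j]/(arr st2 a_B i) (eqP B0) bj.
      by apply/esym/eqP.
    rewrite ri => /eqP; rewrite eqb0 => B0; apply: runl_sem => //; apply:
      step => //.
    by rewrite [LHS]B0; apply/esym/strong_b; rewrite -Bj2.
  exists 4, st2; split=> //.
    apply: (@ExecIfFalse st2 st2 1 (Get a_Ey (Reg r_e))); last exact: ExecSkip.
    by rewrite /= ri eyE; apply/eqP; rewrite -[_ == _]negbK ey.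
  apply: step => //; rewrite Bj2.
  have sb : strongly_biconnected [set: 'I_n] (E :\ tnth es j).
    apply: strongly_biconnectedS sbEy; apply/subsetP => e /imsetP[j'].
    rewrite inE => ey' ->; rewrite !inE (input_mem inp)
      andbT (inj_eq (input_inj inp)).
    by apply: contraNneq ey' => ->; rewrite -[_ == _]negbK ey.
  rewrite /strong_bridge /b_bridge sb; case/andP: sb => -> _.
  by rewrite andbF.
- by move=> st2 ag [inp2 B2]; apply: (edge_setP inp2) => [|j];
    [apply/subsetP => e; rewrite inE => /andP[] | rewrite inE B2 ltn_ord].
have h : m < Z := leq_trans mX' leXZ.
move: leS; set S := \sum_(i < m) _; move: (lin bbridge_step) => b.
have -> : 3 * n * (b * X) = 3 * b * Z by rewrite /Z; lia.
by clear -h; move: Z h => Z' h; rewrite !mulnDl; move: (3 * b * Z'); lia.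
Qed.

End Algorithm.

(** * The bound in terms of [n * m] *)

Definition algorithm_coef : nat :=
  setup_coef + (lin tree + (lin (for_to r_e r_m reverse_edges) +
    (lin reverse_tree + (lin (for_to r_e r_m join_trees) +
  (lin test_Ey + (12 + 2 * lin augment +
    (lin (for_to r_e r_m copy_bridges) + (6 + 3 * lin bbridge_step + 12)))))))).

Lemma algorithm_runs (n m : nat) (E : {set 'I_n * 'I_n})
    (es : m.-tuple ('I_n * 'I_n)) (y : 'I_n) (st : store) :
  strongly_biconnected [set: 'I_n] E -> input E es y st ->
  runs (algorithm_coef * (n * (n + 4 * m + 2))) (algorithm linear_subroutines)
    st
    (fun st' => edge_set es a_B st' = [set e | b_bridge E e]).
Proof.
move=> sbE inp; rewrite algorithmE.
apply: runz_seq; apply: runs_weaken (bridges_phase sbE inp) _ _ => // st1 bs1.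
apply: join_phase (bs1) _ => // st2 tj.
apply: augment_phase (tj) _ => // st3 bs3 le3 sb3.
exact: b_bridge_phase bs3 le3 sb3.
Qed.

(** Every vertex starts an edge on a path to some other vertex, so the sources of edges are all
    vertices. *)
Lemma card_edges_ge (n : nat) (E : {set 'I_n * 'I_n}) : 1 < n ->
  strongly_connected [set: 'I_n] E -> n <= #|E|.
Proof.
move=> n1 /strongly_connectedP sc.
rewrite -[leqLHS]card_ord -cardsT -(_ : fst @: E = setT) ?leq_imset_card //.
apply/setP => v; rewrite inE.
have [w wv] : exists w : 'I_n, w != v.
  apply/existsP; rewrite -negb_forall; apply/negP => /forallP H.
  have := card_le1_eqP (_ : #|[set: 'I_n]| <= 1).
  have /card_gt1P[a [b [_ _]]] : 1 < #|[set: 'I_n]| by rewrite cardsT card_ord.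
  by rewrite (eqP (H a)) (eqP (H b)) eqxx.
have /connectP[[|x p] /=] := sc v w (in_setT v) (in_setT w).
  by move=> _ E1; rewrite E1 eqxx in wv.
by case/andP=> /and3P[_ _ vx] _ _; apply/imsetP; exists (v, x).
Qed.

(** From [2 <= n <= m] one gets [n + 4 * m + 2 <= 7 * m]. For [n = 1] the only possible edge is a
    loop and the left side is at most 7; without that loop [n * m] vanishes, hence [maxn 1]. *)
Lemma linear_size_bound (n : nat) (E : {set 'I_n * 'I_n}) : 0 < n ->
  strongly_connected [set: 'I_n] E ->
  n * (n + 4 * #|E| + 2) <= 7 * maxn 1 (n * #|E|).
Proof.
move=> n0 sc; have [n1|n1] := ltnP 1 n.
  have le := card_edges_ge n1 sc; set m := #|E| in le *.
  apply: leq_trans (_ : 7 * (n * m) <= _); last by rewrite leq_mul2l leq_maxr.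
  rewrite mulnCA leq_mul2l; apply/orP; right; lia.
have n_eq : n = 1 by lia.
have : #|E| <= 1.
  by rewrite (leq_trans (max_card _)) // card_prod !card_ord n_eq.
by move: #|E| => k; rewrite n_eq !mul1n; case: k => [|[|k]].
Qed.

Theorem theorem1 :
  exists (p : subroutines) (c : nat),
    correct p /\
    forall (n m : nat) (E : {set 'I_n * 'I_n}) (es : m.-tuple ('I_n * 'I_n))
           (y : 'I_n) (st : store),
      strongly_biconnected [set: 'I_n] E ->
      is_input E es st ->
      reg st r_y = y ->
      exists (t : nat) (st' : store),
        [/\ exec (algorithm p) st t st',
            t <= c * maxn 1 (n * #|E|)
          & edge_set es a_B st' = [set e | b_bridge E e]].
Proof.
exists linear_subroutines, (algorithm_coef * 7).
split=> [|n m E es y st sbE is_in ry]; first exact: linear_subroutines_correct.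
have inp : input E es y st by [].
have sc : strongly_connected [set: 'I_n] E by case/andP: sbE.
have n0 : 0 < n by apply: leq_trans (ltn_ord y).
apply: runs_weaken (algorithm_runs sbE inp) _ _ => //.
rewrite -(input_card inp) -mulnA leq_mul2l; apply/orP; right.
exact: linear_size_bound.
Qed.
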